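(* Let $\Theta:\mathbb{D}\to M_n$ be a purely contractive analytic function. The linear map $V_\Theta:H^2_\Theta\to K^2_\Theta$ given by $$(V_\Theta f)(z)=(\mathbf 1-\Theta(z))\int_{\mathbb{T}}\frac{1}{1-\overline{\zeta}z}\,\Omega_\Theta(d\zeta)f(\zeta),\qquad z\in\mathbb{D},$$ is an isometry of $H^2_\Theta$ onto $K^2_\Theta$.
   Context: $\mathbb{D}$ is the open unit disc, $\mathbb{T}$ the unit circle, $M_n$ the complex $n\times n$ matrices with operator norm, $\mathbf 1$ the identity, $(\cdot,\cdot)$ the inner product of $\mathbb{C}^n$. Purely contractive means $\|\Theta(z)\|\le1$ on $\mathbb{D}$ and $\|\Theta(0)\|<1$ (hence $\|\Theta(z)\|<1$ on $\mathbb{D}$). $\Omega_\Theta$ is the unique positive $M_n$-valued Borel measure on $\mathbb{T}$ with $\mathrm{Re}\big[(\mathbf 1+\Theta(z))(\mathbf 1-\Theta(z))^{-1}\big]=\mathrm{Re}\int_{\mathbb{T}}\frac{\zeta+z}{\zeta-z}\Omega_\Theta(d\zeta)$ for $z\in\mathbb{D}$ ($\mathrm{Re}\,M=\frac12(M+M^* )$). $L^2_\Theta$ is the Hilbert space of (classes of) $\mathbb{C}^n$-valued functions on $\mathbb{T}$ with inner product $(f,g)_\Theta=\int_{\mathbb{T}}(\Omega_\Theta(d\zeta)f(\zeta),g(\zeta))$, and $H^2_\Theta$ is the closure in $L^2_\Theta$ of the $\mathbb{C}^n$-valued polynomials. $H^2_n(\mathbb{D})$ is the Hardy space of $\mathbb{C}^n$-valued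 functions, $T_\Theta$ is multiplication by $\Theta$ on $H^2_n(\mathbb{D})$, and the de Branges–Rovnyak space $K^2_\Theta$ is the range of $R_\Theta=\sqrt{\mathbf 1-T_\Theta T_\Theta^*}$ with the inner product $\langle\cdot,\cdot\rangle_\Theta$ making $R_\Theta$ a co-isometry of $H^2_n(\mathbb{D})$ onto its range. Equivalently, it is the reproducing kernel Hilbert space with matrix kernel $\Delta_w(z)=\frac{\mathbf 1-\Theta(z)\Theta(w)^*}{1-z\overline w}$. *)

(* Defs.v *)
From HB Require Import structures.
From mathcomp Require Import all_boot all_order all_algebra spectral complex.
From mathcomp Require Import all_classical all_reals all_analysis.

Set Implicit Arguments.
Unset Strict Implicit.
Unset Printing Implicit Defensive.

Import Order.TTheory GRing.Theory Num.Theory.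
Import numFieldNormedType.Exports.

Local Open Scope classical_set_scope.
Local Open Scope ring_scope.
Local Open Scope sesquilinear_scope.

(* [R[i]] gets its usual topology, as a normed space over itself.
   [complex.Re], [complex.Im] : R[i] -> R must be written qualified: the
   unqualified [Re], [Im] are ssrnum's projections R[i] -> R[i]. *)
HB.instance Definition _ (R : realType) := GRing.ComAlgebra.copy R[i] R[i]^o.
HB.instance Definition _ (R : realType) := Vector.copy R[i] R[i]^o.
HB.instance Definition _ (R : realType) := NormedModule.copy R[i] R[i]^o.

Definition disc (R : realType) := {z : R[i] | `|z| < 1}.
Definition circle (R : realType) := {z : R[i] | `|z| == 1}.

Section circle_borel.
Variable R : realType.

HB.instance Definition _ := Choice.on (circle R).

Lemma circle1_subproof : `|1 : R[i]| == 1. Proof. by rewrite normr1. Qed.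

HB.instance Definition _ :=
  isPointed.Build (circle R) (exist _ 1 circle1_subproof).

Definition circle_open : set (set (circle R)) :=
  [set sval @^-1` U | U in @open R[i]].

HB.instance Definition _ :=
  Measurable.copy (circle R) (g_sigma_algebraType circle_open).

End circle_borel.

Section finite_dimensional.
Variables (R : realType) (n : nat).
Implicit Types (x y : 'cV[R[i]]_n) (A : 'M[R[i]]_n).

Definition cdot x y : R[i] := \sum_i x i 0 * (y i 0)^*.

Definition cnorm x : R := Num.sqrt (complex.Re (cdot x x)).

Definition opnorm A : R := sup [set cnorm (A *m x) | x in [set x | cnorm x <= 1]].

(* In [R[i]], [0 <= z] says that [z] is real and nonnegative; over the complex
   numbers this makes [A] Hermitian. *)
Definition psd A := forall x, 0 <= cdot (A *m x) x.

Definition mxRe A : 'M[R[i]]_n := 2^-1 *: (A + A ^t*).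

End finite_dimensional.

(* As for [{measure set T -> \bar R}], positivity is required on all sets,
   countable additivity on measurable ones only. *)
Record psd_measure d (T : measurableType d) (R : realType) (n : nat) := PsdMeasure {
  psdm_fun :> set T -> 'M[R[i]]_n ;
  psdm_ge0 : forall A, psd (psdm_fun A) ;
  psdm0 : psdm_fun set0 = 0 ;
  psdm_sigma_additive : forall F : nat -> set T,
    (forall k, measurable (F k)) -> trivIset setT F ->
    (fun m => \sum_(0 <= k < m) psdm_fun (F k)) @ \oo
      --> psdm_fun (\bigcup_k F k) }.


Section psd_measure_theory.
Context d (T : measurableType d) (R : realType) (n : nat).

Lemma continuous_cRe : continuous (@complex.Re R : R[i] -> R).
Proof.
move=> z; apply/(@cvgrPdist_lt _ _ _ (nbhs z) (nbhs_filter z)) => e e0.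
apply/nbhs_ballP; exists (e%:C)%C; first by rewrite /= ltcR.
move=> w zw; rewrite -raddfB -ltcR.
exact: le_lt_trans (normc_ge_Re _) zw.
Qed.

Lemma continuous_cIm : continuous (@complex.Im R : R[i] -> R).
Proof.
move=> z; apply/(@cvgrPdist_lt _ _ _ (nbhs z) (nbhs_filter z)) => e e0.
apply/nbhs_ballP; exists (e%:C)%C; first by rewrite /= ltcR.
move=> w zw; rewrite -raddfB -normrN -ReiNIm -ltcR.
apply: le_lt_trans (normc_ge_Re _) _.
have i1 : `|'i%C : R[i]| = 1 by rewrite normc_def /= expr0n add0r expr1n sqrtr1.
by rewrite normrM i1 mulr1.
Qed.

Lemma continuous_mxtrace : continuous (fun A : 'M[R[i]]_n => \tr A).
Proof.
rewrite /mxtrace; elim: (index_enum _) => [|i r IHr] A.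
  by under eq_fun do rewrite big_nil; exact: cst_continuous.
under eq_fun do rewrite big_cons.
apply: (@continuousD _ _ _ (fun A : 'M[R[i]]_n => A i i)); last exact: IHr.
exact: coord_continuous.
Qed.

Lemma psd_tr (A : 'M[R[i]]_n) : psd A -> 0 <= complex.Re (\tr A).
Proof.
move=> A0; suff : 0 <= \tr A by rewrite lecE => /andP[].
apply: sumr_ge0 => i _; have := A0 (delta_mx i 0); rewrite /cdot.
rewrite (bigD1 i) //= big1 => [|j ji].
  rewrite addr0 !mxE !eqxx conjC1 mulr1 (bigD1 i) //= big1 => [|j ji].
    by rewrite !mxE !eqxx mulr1 addr0.
  by rewrite !mxE (negbTE ji) mulr0.
by rewrite !mxE (negbTE ji) conjC0 mulr0.
Qed.

Variable Omega : psd_measure T R n.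

Let functional_sigma_additive (L : 'M[R[i]]_n -> R) : continuous L ->
  {morph L : A B / A + B} -> L 0 = 0 ->
  semi_sigma_additive (fun A => (L (Omega A))%:E).
Proof.
move=> cL LD L0 F mF tF _.
have -> : (fun m => \sum_(0 <= k < m) (L (Omega (F k)))%:E)%E =
          EFin \o (L \o (fun m => \sum_(0 <= k < m) Omega (F k))).
  by apply/funext => m /=; rewrite (big_morph L LD L0) sumEFin.
apply: cvg_EFin; first by apply: nearW.
exact: (cvg_comp _ _ (psdm_sigma_additive mF tF) (cL _)).
Qed.

Definition re_entry (i j : 'I_n) (A : set T) : \bar R :=
  (complex.Re (Omega A i j))%:E.
Definition im_entry (i j : 'I_n) (A : set T) : \bar R :=
  (complex.Im (Omega A i j))%:E.
Definition trace_measure (A : set T) : \bar R := (complex.Re (\tr (Omega A)))%:E.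

Section charges.
Variables i j : 'I_n.

Let re0 : re_entry i j set0 = 0%E.
Proof. by rewrite /re_entry psdm0 mxE. Qed.
Let re_fin A : measurable A -> re_entry i j A \is a fin_num.
Proof. by []. Qed.
Let re_sigma_additive : semi_sigma_additive (re_entry i j).
Proof.
apply: (@functional_sigma_additive (fun A => complex.Re (A i j))).
- move=> A; apply: (@continuous_comp _ _ _ (fun A : 'M[R[i]]_n => A i j)).
    exact: coord_continuous.
  exact: continuous_cRe.
- by move=> A B; rewrite mxE raddfD.
- by rewrite mxE.
Qed.
HB.instance Definition _ :=
  isCharge.Build d T R (re_entry i j) re0 re_fin re_sigma_additive.

Let im0 : im_entry i j set0 = 0%E.
Proof. by rewrite /im_entry psdm0 mxE. Qed.
Let im_fin A : measurable A -> im_entry i j A \is a fin_num.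
Proof. by []. Qed.
Let im_sigma_additive : semi_sigma_additive (im_entry i j).
Proof.
apply: (@functional_sigma_additive (fun A => complex.Im (A i j))).
- move=> A; apply: (@continuous_comp _ _ _ (fun A : 'M[R[i]]_n => A i j)).
    exact: coord_continuous.
  exact: continuous_cIm.
- by move=> A B; rewrite mxE raddfD.
- by rewrite mxE.
Qed.
HB.instance Definition _ :=
  isCharge.Build d T R (im_entry i j) im0 im_fin im_sigma_additive.

End charges.

Let trace0 : trace_measure set0 = 0%E.
Proof. by rewrite /trace_measure psdm0 mxtrace0. Qed.
Let trace_ge0 A : (0 <= trace_measure A)%E.
Proof. by rewrite lee_fin psd_tr//; exact: psdm_ge0. Qed.
Let trace_sigma_additive : semi_sigma_additive trace_measure.
Proof.
apply: (@functional_sigma_additive (fun A => complex.Re (\tr A))).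
- move=> A; apply: (@continuous_comp _ _ _ (fun A : 'M[R[i]]_n => \tr A)).
    exact: continuous_mxtrace.
  exact: continuous_cRe.
- by move=> A B; rewrite !raddfD.
- by rewrite mxtrace0.
Qed.
HB.instance Definition _ := isMeasure.Build d T R trace_measure
  trace0 trace_ge0 trace_sigma_additive.

Let trace_fin : fin_num_fun trace_measure. Proof. by []. Qed.
HB.instance Definition _ := Measure_isFinite.Build d T R trace_measure trace_fin.

(* Every entry of [Omega] is absolutely continuous with respect to the trace
   measure, so that Omega(dx) = density(x) trace_measure(dx). *)
Definition density (x : T) : 'M[R[i]]_n := \matrix_(i, j)
  (fine (Radon_Nikodym (re_entry i j) trace_measure x)
   +i* fine (Radon_Nikodym (im_entry i j) trace_measure x))%C.

End psd_measure_theory.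

Section integration.
Context d (T : measurableType d) (R : realType).

Definition cintegral (mu : {measure set T -> \bar R}) (f : T -> R[i]) : R[i] :=
  (Rintegral mu setT (fun x => complex.Re (f x))
   +i* Rintegral mu setT (fun x => complex.Im (f x)))%C.

Definition mxintegral (mu : {measure set T -> \bar R}) m n
    (F : T -> 'M[R[i]]_(m, n)) : 'M[R[i]]_(m, n) :=
  \matrix_(i, j) cintegral mu (fun x => F x i j).

Variables (n : nat) (Omega : psd_measure T R n).

(* [psd_integral phi] is the integral of the scalar function [phi] and
   [psd_integral_vec f] that of the vector function [f] against [Omega]. *)
Definition psd_integral (phi : T -> R[i]) : 'M[R[i]]_n :=
  mxintegral (trace_measure Omega) (fun x => phi x *: density Omega x).
Definition psd_integral_vec (f : T -> 'cV[R[i]]_n) : 'cV[R[i]]_n :=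
  mxintegral (trace_measure Omega) (fun x => density Omega x *m f x).

Definition L2_dot (f g : T -> 'cV[R[i]]_n) : R[i] :=
  cintegral (trace_measure Omega) (fun x => cdot (density Omega x *m f x) (g x)).

Definition L2_norm (f : T -> 'cV[R[i]]_n) : R :=
  Num.sqrt (complex.Re (L2_dot f f)).

Definition L2 : set (T -> 'cV[R[i]]_n) := [set f : T -> 'cV[R[i]]_n |
  (forall i, measurable_fun setT (fun x => complex.Re (f x i 0)) /\
             measurable_fun setT (fun x => complex.Im (f x i 0))) /\
  (\int[trace_measure Omega]_x
     (complex.Re (cdot (density Omega x *m f x) (f x)))%:E < +oo)%E].

End integration.

Section hardy.
Variables (R : realType) (n : nat).
Local Notation fspace := (disc R -> 'cV[R[i]]_n).

Definition taylor_of (F : fspace) (a : nat -> 'cV[R[i]]_n) :=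
  cvgn (series (fun k => cnorm (a k) ^+ 2)) /\
  forall z : disc R, series (fun k => sval z ^+ k *: a k) @ \oo --> F z.

Definition hardy : set fspace := [set F | exists a, taylor_of F a].

Definition taylor (F : fspace) : nat -> 'cV[R[i]]_n := xget 0 (taylor_of F).

Definition hardy_dot (F G : fspace) : R[i] :=
  limn (series (fun k => cdot (taylor F k) (taylor G k))).

End hardy.

(* A (semi-)inner product space is given by the set [H] of its elements inside
   an ambient vector space [U] and by [dot], meaningful on [H] only, linear in
   its first argument. *)
Section inner_product_spaces.
Variable R : realType.

Definition inner_product (U : lmodType R[i]) (H : set U) (dot : U -> U -> R[i]) :=
  [/\ forall (a : R[i]) u v w, H u -> H v -> H w ->
        dot (a *: u + v) w = a * dot u w + dot v w,
      forall u v, H u -> H v -> dot v u = (dot u v)^*,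
      forall u, H u -> 0 <= dot u u
    & forall u, H u -> dot u u = 0 -> u = 0].

Definition linear_on (U W : lmodType R[i]) (H : set U) (T : U -> W) :=
  forall (a : R[i]) u v, H u -> H v -> T (a *: u + v) = a *: T u + T v.

Definition maps_to (U W : Type) (H : set U) (K : set W) (T : U -> W) :=
  forall u, H u -> K (T u).

Definition adjoint_of (U W : lmodType R[i])
    (H : set U) (dotH : U -> U -> R[i]) (K : set W) (dotK : W -> W -> R[i])
    (T : U -> W) (S : W -> U) :=
  [/\ maps_to H K T, maps_to K H S
    & forall u w, H u -> K w -> dotK (T u) w = dotH u (S w)].

Definition positive_sqrt_of (U : lmodType R[i]) (H : set U)
    (dot : U -> U -> R[i]) (A S : U -> U) :=
  [/\ maps_to H H S, linear_on H S,
      exists c : R[i], forall u, H u -> dot (S u) (S u) <= c * dot u u,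
      forall u, H u -> 0 <= dot (S u) u
    & forall u, H u -> S (S u) = A u].

Definition coisometry (U W : lmodType R[i])
    (H : set U) (dotH : U -> U -> R[i]) (K : set W) (dotK : W -> W -> R[i])
    (T : U -> W) :=
  exists2 S, adjoint_of H dotH K dotK T S & forall w, K w -> T (S w) = w.

Definition isometry_onto (U W : lmodType R[i])
    (H : set U) (dotH : U -> U -> R[i]) (K : set W) (dotK : W -> W -> R[i])
    (T : U -> W) :=
  [/\ maps_to H K T, linear_on H T,
      forall u v, H u -> H v -> dotK (T u) (T v) = dotH u v
    & forall w, K w -> exists2 u, H u & T u = w].

End inner_product_spaces.

Section model_spaces.
Variables (R : realType) (n : nat) (Theta : R[i] -> 'M[R[i]]_n).

Definition analytic_on_disc := forall z : R[i], `|z| < 1 -> derivable Theta z 1.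

Definition purely_contractive :=
  (forall z : R[i], `|z| < 1 -> opnorm (Theta z) <= 1) /\ opnorm (Theta 0) < 1.

Definition is_Omega (Omega : psd_measure (circle R) R n) :=
  forall z : R[i], `|z| < 1 ->
    mxRe ((1%:M + Theta z) *m invmx (1%:M - Theta z)) =
    mxRe (psd_integral Omega (fun zeta => (sval zeta + z) / (sval zeta - z))).

Definition vpoly (p : 'cV[{poly R[i]}]_n) (zeta : circle R) : 'cV[R[i]]_n :=
  map_mx (horner_eval (sval zeta)) p.

(* Elements of the L2 space are represented by functions, two of which are the
   same element when the [L2_norm] of their difference vanishes. *)
Definition H2_Omega (Omega : psd_measure (circle R) R n) :
    set (circle R -> 'cV[R[i]]_n) :=
  [set f | L2 Omega f /\
    forall e : R, 0 < e -> exists p, L2_norm Omega (f - vpoly p) < e].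

Definition mult_op (F : disc R -> 'cV[R[i]]_n) : disc R -> 'cV[R[i]]_n :=
  fun z => Theta (sval z) *m F z.

(* [Tadj] is the adjoint of [mult_op] on the Hardy space and [Rt] is the positive
   square root of 1 - T T^*. *)
Definition is_deBranges_Rovnyak (K : set (disc R -> 'cV[R[i]]_n))
    (dotK : (disc R -> 'cV[R[i]]_n) -> (disc R -> 'cV[R[i]]_n) -> R[i]) :=
  let H := @hardy R n in let dotH := @hardy_dot R n in
  exists Tadj Rt : (disc R -> 'cV[R[i]]_n) -> (disc R -> 'cV[R[i]]_n),
  [/\ adjoint_of H dotH H dotH mult_op Tadj,
      positive_sqrt_of H dotH (fun F => F - mult_op (Tadj F)) Rt,
      K = Rt @` H,
      inner_product K dotK
    & coisometry H dotH K dotK Rt].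

Definition V_op (Omega : psd_measure (circle R) R n)
    (f : circle R -> 'cV[R[i]]_n) : disc R -> 'cV[R[i]]_n :=
  fun z => (1%:M - Theta (sval z)) *m
    psd_integral_vec Omega
      (fun zeta => (1 - (sval zeta)^* * sval z)^-1 *: f zeta).

End model_spaces.

(* Main.v *)
(* Put [ka_(z,a) = (1 - conj z zeta)^-1 (1 - Theta z)^* a] in the space H2 of
   Omega and let [de_(z,a)] be the reproducing kernels of [K]. Then
   [(f, ka_(z,a)) = (V f z, a)]: the transform [V] reads off the inner products
   with the vectors [ka]. The two families are total, the first one because the
   Taylor coefficients of [z |-> (f, (1 - conj z zeta)^-1 c)] are the inner
   products of [f] with monomials. They have the same Gram matrix: by
   [2 / ((1 - conj zeta z) (1 - conj w zeta)) =
    (h z + conj (h w)) / (1 - z conj w)], where [h z = (zeta + z) / (zeta - z)],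
   the Gram matrix of [ka] only involves the integral [G] of [h] against Omega,
   and [G] differs from [(1 + Theta) (1 - Theta)^-1] by a constant skew-Hermitian
   matrix. In complete spaces a bijection between total families with equal Gram
   matrices extends to a surjective isometry, which is [V]. *)
Require Import Defs.
From HB Require Import structures.
From mathcomp Require Import all_boot all_order all_algebra spectral complex.
From mathcomp Require Import all_classical all_reals all_analysis.
From mathcomp Require Import measurable_realfun ring lra.

Set Implicit Arguments.
Unset Strict Implicit.
Unset Printing Implicit Defensive.

Import Order.TTheory GRing.Theory Num.Theory.
Import numFieldNormedType.Exports.

Local Open Scope classical_set_scope.
Local Open Scope ring_scope.
Local Open Scope sesquilinear_scope.

(** Elements of H2 are functions, not classes, so the Hilbert space arguments run in spaces where a
    vector of norm zero need not vanish: limits exist without being unique, and an isometry cannot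
    simply be defined by extension. The analytic core is the completeness of L2. The density of
    Omega may be singular at every point, so a sequence that converges in norm need not converge
    pointwise anywhere; only its image under the density does, almost everywhere along rapid
    sequences. This density is moreover positive only almost everywhere, and is first replaced by a
    representative that is positive everywhere with trace at most 1. Invertibility of [1 - Theta z]
    is not given: it is extracted from the positive square root that comes with [K]. The equation
    defining Omega fixes real parts at one point only, while the Gram matrix involves two points;
    the passage from one to two rests on the constancy of an analytic function with vanishing real
    part. *)

Section complex_numbers.
Variable R : realType.
Implicit Types (x y : R) (z w : R[i]).

Lemma cRe_conj z : complex.Re z^* = complex.Re z.
Proof. by case: z. Qed.

Lemma cIm_conj z : complex.Im z^* = - complex.Im z.
Proof. by case: z. Qed.

Lemma ge0_cRe z : 0 <= z -> z = (complex.Re z)%:C%C.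
Proof. by case: z => a b; rewrite lecE /= => /andP[/eqP -> _]. Qed.

Lemma cRe_ge0 z : 0 <= z -> 0 <= complex.Re z.
Proof. by case: z => a b; rewrite lecE /= => /andP[]. Qed.

Lemma cRe_realM x z : complex.Re (x%:C%C * z) = x * complex.Re z.
Proof. by case: z => a b /=; rewrite mul0r subr0. Qed.

Lemma cIm_realM x z : complex.Im (x%:C%C * z) = x * complex.Im z.
Proof. by case: z => a b /=; rewrite mul0r addr0. Qed.

Lemma conjc_real x : (x%:C%C : R[i])^* = x%:C%C.
Proof. by apply/eqP; rewrite eq_complex /= oppr0 !eqxx. Qed.

(** The modulus taken in [R] instead of [R[i]], where the order is total and linear arithmetic
    applies. *)
Definition cmod z : R := complex.Re `|z|.

Lemma cmodE z : `|z| = (cmod z)%:C%C.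
Proof. exact/ge0_cRe/normr_ge0. Qed.

Lemma cmod_ge0 z : 0 <= cmod z.
Proof. exact/cRe_ge0/normr_ge0. Qed.

Lemma cmodM z w : cmod (z * w) = cmod z * cmod w.
Proof. by rewrite /cmod normrM !cmodE cRe_realM. Qed.

Lemma cmodD z w : cmod (z + w) <= cmod z + cmod w.
Proof. by have := ler_normD z w; rewrite !cmodE -rmorphD lecR. Qed.

Lemma cmodB z w : cmod (z - w) <= cmod z + cmod w.
Proof. by have := ler_normB z w; rewrite !cmodE -rmorphD lecR. Qed.

Lemma cmodN z : cmod (- z) = cmod z. Proof. by rewrite /cmod normrN. Qed.

Lemma cmod_conj z : cmod z^* = cmod z. Proof. by rewrite /cmod norm_conjC. Qed.

Lemma cmod0 : cmod 0 = 0. Proof. by rewrite /cmod normr0. Qed.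

Lemma cmod1 : cmod 1 = 1. Proof. by rewrite /cmod normr1. Qed.

Lemma cmod0_eq0 z : cmod z <= 0 -> z = 0.
Proof.
move=> z0; apply/normr0_eq0; rewrite cmodE.
by have /eqP -> : cmod z == 0 by rewrite eq_le z0 cmod_ge0.
Qed.

Lemma cmod_real x : cmod x%:C%C = `|x|.
Proof. by rewrite /cmod normc_def /= expr0n addr0 sqrtr_sqr. Qed.

Lemma cmodV z : cmod z^-1 = (cmod z)^-1.
Proof.
have [->|z0] := eqVneq z 0; first by rewrite invr0 cmod0 invr0.
have cz0 : cmod z != 0.
  by apply: contra_neq z0 => cz0; apply: cmod0_eq0; rewrite cz0.
by apply: (mulfI cz0); rewrite -cmodM mulfV// mulfV// cmod1.
Qed.

Lemma cmodX z k : cmod (z ^+ k) = cmod z ^+ k.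
Proof. by elim: k => [|k IH]; rewrite ?expr0 ?cmod1// !exprS cmodM IH. Qed.

Lemma normcRe_le z : `|complex.Re z| <= cmod z.
Proof. by have := normc_ge_Re z; rewrite cmodE lecR. Qed.

Lemma normcIm_le z : `|complex.Im z| <= cmod z.
Proof.
rewrite -normrN -ReiNIm; apply: le_trans (normcRe_le _) _.
have i1 : cmod 'i%C = 1 by rewrite /cmod normc_def /= expr0n add0r expr1n sqrtr1.
by rewrite cmodM i1 mulr1.
Qed.

Lemma cmod_le_ReIm z : cmod z <= `|complex.Re z| + `|complex.Im z|.
Proof.
rewrite {1}[z]complexE; apply: le_trans (cmodD _ _) _.
have i1 : cmod 'i%C = 1 by rewrite /cmod normc_def /= expr0n add0r expr1n sqrtr1.
by rewrite cmodM !cmod_real i1 mul1r.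
Qed.

Lemma sqr_cmod z : (cmod z ^+ 2)%:C%C = z * z^*.
Proof. by rewrite -normCK cmodE rmorphXn. Qed.

Lemma cRe_le_cmod z : complex.Re z <= cmod z.
Proof. exact: le_trans (ler_norm _) (normcRe_le z). Qed.

Lemma cmod_ge0E z : 0 <= z -> cmod z = complex.Re z.
Proof. by move=> z0; rewrite /cmod ger0_norm. Qed.

End complex_numbers.

Section geometric_bounds.
Variable R : realType.
Implicit Types (a b c : R).

Lemma geo_gt0 k : 0 < 2^-1 ^+ k :> R.
Proof. by apply: exprn_gt0; rewrite invr_gt0. Qed.

Lemma geo_lt (e : R) : 0 < e -> exists k, 2^-1 ^+ k < e :> R.
Proof.
move=> e0; have /(cvgrPdist_lt)/(_ _ e0)[k _ kP] :
    (fun k => (2^-1 : R) ^+ k) @ \oo --> (0 : R).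
  apply: cvg_expr.
  by rewrite ger0_norm ?invr_ge0// invf_lt1// (ltr_nat _ 1 2).
exists k; have := kP k (leqnn k); by rewrite sub0r normrN ger0_norm//.
Qed.

(** Stands in for passing to the limit: since completeness and density are phrased with geometric
    rates, most limit arguments end in such a family of inequalities. *)
Lemma le_geo c a b : (forall k, a <= b + c * 2^-1 ^+ k) -> a <= b.
Proof.
move=> H; rewrite leNgt; apply/negP => ba.
have c0 : 0 < `|c| + 1 by rewrite ltr_wpDl.
have [k] : exists k, 2^-1 ^+ k < (a - b) / (`|c| + 1) :> R.
  by apply: geo_lt; rewrite divr_gt0// subr_gt0.
rewrite ltr_pdivlMr// => kP; have := H k; apply/negP; rewrite -ltNge.
rewrite -ltrBrDl; apply: le_lt_trans kP; rewrite mulrC.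
by rewrite ler_wpM2l// ?(ltW (geo_gt0 _))// (le_trans (ler_norm _))// lerDl.
Qed.

End geometric_bounds.

(** * Semi-inner product spaces *)

Section semi_inner_product.
Variables (R : realType) (U : lmodType R[i]) (H : set U) (dot : U -> U -> R[i]).

(** Definiteness is left out on purpose: in L2 a function of norm zero is not the zero function. The
    axioms are relative to [H] because [dot] is meaningful only there. *)
Record semi_inner_product := SemiInnerProduct {
  sip0 : H 0;
  sipZD : forall (a : R[i]) u v, H u -> H v -> H (a *: u + v);
  sip_linear : forall (a : R[i]) u v w, H u -> H v -> H w ->
    dot (a *: u + v) w = a * dot u w + dot v w;
  sipC : forall u v, H u -> H v -> dot v u = (dot u v)^*;
  sip_ge0 : forall u, H u -> 0 <= dot u u }.

Definition nrm (u : U) : R := Num.sqrt (complex.Re (dot u u)).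

(** Completeness tested on rapid sequences, which every Cauchy sequence has as subsequences. The
    rate [2 * 2^-k] is the tail of the geometric series. Nothing makes [y] unique. *)
Definition complete := forall x : nat -> U, (forall k, H (x k)) ->
  (forall k, nrm (x k.+1 - x k) <= 2^-1 ^+ k) ->
  exists2 y, H y & forall k, nrm (x k - y) <= 2 * 2^-1 ^+ k.

Hypothesis sip : semi_inner_product.

Lemma sipZ a u : H u -> H (a *: u).
Proof. by move=> Hu; rewrite -[_ *: _]addr0; apply: (sipZD sip) => //; exact: (sip0 sip). Qed.

Lemma sipD u v : H u -> H v -> H (u + v).
Proof. by move=> Hu Hv; rewrite -[u]scale1r; exact: (sipZD sip). Qed.

Lemma sipN u : H u -> H (- u).
Proof. by move=> Hu; rewrite -scaleN1r; exact: sipZ. Qed.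

Lemma sipB u v : H u -> H v -> H (u - v).
Proof. by move=> Hu Hv; exact: sipD (sipN Hv). Qed.

Lemma sip_sum (I : Type) (r : seq I) (f : I -> U) :
  (forall i, H (f i)) -> H (\sum_(i <- r) f i).
Proof.
by move=> Hf; elim/big_ind: _ => //; [exact: (sip0 sip)|exact: sipD].
Qed.

Lemma dotDl u v w : H u -> H v -> H w -> dot (u + v) w = dot u w + dot v w.
Proof. by move=> Hu Hv Hw; rewrite -{1}[u]scale1r (sip_linear sip)// mul1r. Qed.

Lemma dot0l w : H w -> dot 0 w = 0.
Proof.
move=> Hw; have H0 := sip0 sip.
by apply: (addrI (dot 0 w)); rewrite -dotDl// !addr0.
Qed.

Lemma dotZl a u w : H u -> H w -> dot (a *: u) w = a * dot u w.
Proof.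
by move=> Hu Hw; have H0 := sip0 sip; rewrite -[a *: u]addr0 (sip_linear sip)// dot0l// addr0.
Qed.

Lemma dotNl u w : H u -> H w -> dot (- u) w = - dot u w.
Proof. by move=> Hu Hw; rewrite -scaleN1r dotZl// mulN1r. Qed.

Lemma dotBl u v w : H u -> H v -> H w -> dot (u - v) w = dot u w - dot v w.
Proof. by move=> Hu Hv Hw; rewrite dotDl// ?dotNl//; exact: sipN. Qed.

Lemma dotDr u v w : H u -> H v -> H w -> dot w (u + v) = dot w u + dot w v.
Proof.
move=> Hu Hv Hw; have Huv := sipD Hu Hv.
by rewrite (sipC sip Huv)// dotDl// rmorphD /= -!(sipC sip).
Qed.

Lemma dotZr a u w : H u -> H w -> dot w (a *: u) = a^* * dot w u.
Proof.
move=> Hu Hw; have Hau := sipZ a Hu.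
by rewrite (sipC sip Hau)// dotZl// rmorphM /= -(sipC sip).
Qed.

Lemma dotNr u w : H u -> H w -> dot w (- u) = - dot w u.
Proof. by move=> Hu Hw; rewrite -scaleN1r dotZr// rmorphN1 mulN1r. Qed.

Lemma dotBr u v w : H u -> H v -> H w -> dot w (u - v) = dot w u - dot w v.
Proof. by move=> Hu Hv Hw; rewrite dotDr// ?dotNr//; exact: sipN. Qed.

Lemma dot0r w : H w -> dot w 0 = 0.
Proof. by move=> Hw; rewrite (sipC sip (sip0 sip) Hw) dot0l// conjC0. Qed.

Lemma dot_suml (I : Type) (r : seq I) (f : I -> U) w :
  (forall i, H (f i)) -> H w ->
  dot (\sum_(i <- r) f i) w = \sum_(i <- r) dot (f i) w.
Proof.
move=> Hf Hw; elim: r => [|i r IH]; first by rewrite !big_nil dot0l.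
by rewrite !big_cons dotDl ?IH//; exact: sip_sum.
Qed.

Lemma dot_sumr (I : Type) (r : seq I) (f : I -> U) w :
  (forall i, H (f i)) -> H w ->
  dot w (\sum_(i <- r) f i) = \sum_(i <- r) dot w (f i).
Proof.
move=> Hf Hw; elim: r => [|i r IH]; first by rewrite !big_nil dot0r.
by rewrite !big_cons dotDr ?IH//; exact: sip_sum.
Qed.

Lemma nrm_ge0 u : 0 <= nrm u. Proof. exact: sqrtr_ge0. Qed.

Lemma sqr_nrm u : H u -> nrm u ^+ 2 = complex.Re (dot u u).
Proof. by move=> Hu; rewrite sqr_sqrtr//; exact/cRe_ge0/(sip_ge0 sip). Qed.

Lemma dot_nrm u : H u -> dot u u = (nrm u ^+ 2)%:C%C.
Proof. by move=> Hu; rewrite sqr_nrm//; exact/ge0_cRe/(sip_ge0 sip). Qed.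

(** If one of the two vectors has nonzero norm, expand the square of [(y,y) x - (x,y) y] and divide.
    Without definiteness both may have norm zero, which needs a separate argument. *)
Lemma cauchy_schwarz u v : H u -> H v -> cmod (dot u v) <= nrm u * nrm v.
Proof.
move=> Hu Hv.
have key x y : H x -> H y ->
    0 <= dot y y * (dot y y * dot x x - dot x y * (dot x y)^*).
  move=> Hx Hy; have := sip_ge0 sip (sipB (sipZ (dot y y) Hx) (sipZ (dot x y) Hy)).
  rewrite dotBl ?dotBr ?dotZl ?dotZr//; do ?[exact: sipZ | exact: sipB (sipZ _ _) (sipZ _ _)].
  rewrite -(sipC sip Hx Hy) -(sipC sip Hy Hy) (sipC sip Hx Hy).
  by congr (0 <= _); ring.
rewrite -ler_sqr ?nnegrE ?cmod_ge0 ?mulr_ge0 ?nrm_ge0//.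
rewrite -lecR sqr_cmod exprMn rmorphM /= -!dot_nrm//.
have := key _ _ Hu Hv; have := key _ _ Hv Hu.
rewrite [dot v u](sipC sip Hu Hv) conjCK.
have [vv0|vv0] := eqVneq (dot v v) 0; last first.
  by move=> _; rewrite pmulr_rge0 ?lt0r ?vv0 ?(sip_ge0 sip)// subr_ge0 [X in _ <= X]mulrC.
rewrite vv0 !mulr0 sub0r => + _.
have [uu0|uu0] := eqVneq (dot u u) 0; last first.
  by rewrite pmulr_rge0 ?lt0r ?uu0 ?(sip_ge0 sip)// oppr_ge0 mulrC.
(* Both norms vanish: the square of [u - (u,v) v] reduces to [-2 |(u,v)|^2]. *)
move=> _; have := sip_ge0 sip (sipB Hu (sipZ (dot u v) Hv)).
rewrite dotBl ?dotBr ?dotZl ?dotZr//; do ?[exact: sipZ | exact: sipB Hu (sipZ _ _)].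
rewrite [dot v u](sipC sip Hu Hv) uu0 vv0 !mulr0 !subr0 sub0r.
rewrite -[_ * dot u v]mulrC -opprD oppr_ge0 -mulr2n.
by rewrite pmulrn_lle0.
Qed.

Lemma nrmD u v : H u -> H v -> nrm (u + v) <= nrm u + nrm v.
Proof.
move=> Hu Hv.
rewrite -ler_sqr ?nnegrE ?addr_ge0 ?nrm_ge0// sqr_nrm; last exact: sipD.
rewrite dotDl ?dotDr//; last exact: sipD.
rewrite !raddfD /= -!sqr_nrm// [dot v u](sipC sip Hu Hv) cRe_conj.
have := le_trans (cRe_le_cmod _) (cauchy_schwarz Hu Hv).
by rewrite sqrrD; lra.
Qed.

Lemma nrmZ a u : H u -> nrm (a *: u) = cmod a * nrm u.
Proof.
move=> Hu; apply/eqP; rewrite -(@eqrXn2 _ 2) ?mulr_ge0 ?nrm_ge0 ?cmod_ge0//.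
rewrite sqr_nrm; last exact: sipZ.
rewrite dotZl ?dotZr//; last exact: sipZ.
by rewrite mulrA -sqr_cmod cRe_realM exprMn sqr_nrm.
Qed.

Lemma nrmN u : H u -> nrm (- u) = nrm u.
Proof. by move=> Hu; rewrite -scaleN1r nrmZ// cmodN cmod1 mul1r. Qed.

Lemma nrm_distC u v : H u -> H v -> nrm (u - v) = nrm (v - u).
Proof. by move=> Hu Hv; rewrite -nrmN ?opprB//; exact: sipB. Qed.

Lemma nrm_dist u v w : H u -> H v -> H w ->
  nrm (u - w) <= nrm (u - v) + nrm (v - w).
Proof.
by move=> Hu Hv Hw; rewrite -[u - w](subrKA v); apply: nrmD; exact: sipB.
Qed.

Lemma nrm0_dot u v : H u -> H v -> nrm u = 0 -> dot u v = 0.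
Proof.
by move=> Hu Hv u0; apply: cmod0_eq0; rewrite (le_trans (cauchy_schwarz _ _))// u0 mul0r.
Qed.

Lemma rapid_dist x : (forall k, H (x k)) ->
  (forall k, nrm (x k.+1 - x k) <= 2^-1 ^+ k) ->
  forall k j, nrm (x (k + j)%N - x k) <= 2 * 2^-1 ^+ k.
Proof.
move=> Hx rx k j.
(* Keeping the part of the geometric series not yet used makes the induction on [j] go through. *)
suff : nrm (x (k + j)%N - x k) <= 2 * 2^-1 ^+ k - 2 * 2^-1 ^+ (k + j).
  by move=> /le_trans; apply; rewrite gerBl mulr_ge0//; exact/ltW/geo_gt0.
elim: j => [|j IH].
  by rewrite addn0 !subrr /nrm dot0l ?sqrtr0//; exact: (sip0 sip).
rewrite addnS; apply: le_trans (nrm_dist (Hx _) (Hx (k + j)%N) (Hx _)) _.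
apply: le_trans (lerD (rx _) IH) _; rewrite [_ ^+ (k + j).+1]exprS.
by rewrite mulrA mulfV// mul1r; lra.
Qed.

(** Test minimality with [a = t (r,m)], [t > 0]: it yields [2 |(r,m)|^2 <= t |(r,m)|^2 |m|^2], and
    [t] tends to 0. *)
Lemma best_approx_orthogonal r m : H r -> H m ->
  (forall a : R[i], nrm r <= nrm (r - a *: m)) -> dot r m = 0.
Proof.
move=> Hr Hm best.
have sq (t : R) : 0 < t ->
    2 * cmod (dot r m) ^+ 2 <= t * (cmod (dot r m) ^+ 2 * nrm m ^+ 2).
  move=> t0; set a := t%:C%C * dot r m.
  have Ham : H (a *: m) by exact: sipZ.
  have := best a; rewrite -ler_sqr ?nnegrE ?nrm_ge0//.
  rewrite [nrm r ^+ 2]sqr_nrm// [nrm (_ - _) ^+ 2]sqr_nrm//; last exact: sipB.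
  rewrite dotBl ?dotBr//; last exact: sipB.
  rewrite !(dotZl, dotZr)// [dot m r](sipC sip Hr Hm).
  rewrite !rmorphM /= conjc_real.
  rewrite (_ : t%:C%C * (dot r m)^* * dot r m = (t * cmod (dot r m) ^+ 2)%:C%C); last first.
    by rewrite rmorphM /= sqr_cmod; ring.
  rewrite (_ : t%:C%C * dot r m * (dot r m)^* = (t * cmod (dot r m) ^+ 2)%:C%C); last first.
    by rewrite rmorphM /= sqr_cmod; ring.
  rewrite (_ : a * (t%:C%C * (dot r m)^* * dot m m) =
     (t ^+ 2 * cmod (dot r m) ^+ 2 * nrm m ^+ 2)%:C%C); last first.
    by rewrite 2!rmorphM /= sqr_cmod dot_nrm// (rmorphXn _ 2 t) /a /=; ring.
  by rewrite !raddfB /= => h; rewrite -(ler_pM2l t0); lra.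
apply: cmod0_eq0; rewrite -(@ler_pXn2r _ 2) ?nnegrE ?cmod_ge0// expr0n /=.
rewrite -(ler_pM2l (ltr0n R 2)) mulr0.
apply: (@le_geo _ (cmod (dot r m) ^+ 2 * nrm m ^+ 2)) => k.
by rewrite add0r mulrC [X in _ <= X]mulrC mulrC; exact/sq/geo_gt0.
Qed.

Lemma parallelogram u v : H u -> H v ->
  nrm (u + v) ^+ 2 + nrm (u - v) ^+ 2 = 2 * nrm u ^+ 2 + 2 * nrm v ^+ 2.
Proof.
move=> Hu Hv; have Hd := sipD Hu Hv; have Hb := sipB Hu Hv.
rewrite !sqr_nrm// dotBl// !dotBr// dotDl// !dotDr// !(raddfD, raddfB) /=; lra.
Qed.

(** The projection theorem: a minimizing sequence in [M] converges to some [y] of [H], the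
    difference [u - y] is orthogonal to [M], hence of norm zero by totality, so the sequence
    approaches [u] itself. *)
Lemma total_dense (M : set U) : complete -> M `<=` H -> M 0 ->
  (forall a u v, M u -> M v -> M (a *: u + v)) ->
  (forall u, H u -> (forall m, M m -> dot u m = 0) -> dot u u = 0) ->
  forall u e, H u -> 0 < e -> exists2 m, M m & nrm (u - m) < e.
Proof.
move=> cH MH M0 MZD tot u e Hu e0.
pose D := [set nrm (u - m) ^+ 2 | m in M].
have D0 : D !=set0 by exists (nrm (u - 0) ^+ 2); exists 0.
have lbD : has_lbound D by exists 0 => _ [m _ <-]; rewrite sqr_ge0.
pose d := inf D.
have d0 : 0 <= d by apply: lb_le_inf => // _ [m _ <-]; rewrite sqr_ge0.
have infD m : M m -> d <= nrm (u - m) ^+ 2.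
  by move=> Mm; apply: ge_inf => //; exists m.
(* With this excess over the infimum the parallelogram law gives
   [|x_(k+1) - x_k|^2 <= (5/8) (2^-k)^2], so the sequence is rapid. *)
have /choice[x xP] : forall k, exists m, M m /\
    nrm (u - m) ^+ 2 <= d + (2^-1 ^+ k) ^+ 2 / 4.
  move=> k; have dk : 0 < (2^-1 ^+ k) ^+ 2 / 4 :> R.
    by rewrite divr_gt0// exprn_gt0// geo_gt0.
  have [_ [m Mm <-] lt] := inf_adherent dk (conj D0 lbD).
  by exists m; split => //; exact: ltW.
have Hx k : H (x k) by apply: MH; case: (xP k).
have rx k : nrm (x k.+1 - x k) <= 2^-1 ^+ k.
  rewrite -ler_sqr ?nnegrE ?nrm_ge0 ?(ltW (geo_gt0 _ _))//.
  have H1 := sipB Hu (Hx k.+1); have H2 := sipB Hu (Hx k).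
  have := parallelogram H2 H1.
  have -> : u - x k - (u - x k.+1) = x k.+1 - x k.
    by rewrite opprB addrC subrKA.
  have -> : u - x k + (u - x k.+1) =
      (2 : R[i]) *: (u - ((2^-1 : R[i]) *: x k.+1 + (2^-1 : R[i]) *: x k)).
    rewrite scalerBr scalerDr !scalerA mulfV ?pnatr_eq0// !scale1r.
    by rewrite scaler_nat mulr2n opprD addrACA [X in _ + X]addrC.
  have Mmid : M ((2^-1 : R[i]) *: x k.+1 + (2^-1 : R[i]) *: x k).
    apply: (MZD _ _ _ (proj1 (xP _))); rewrite -[_ *: _]addr0.
    exact: (MZD _ _ _ (proj1 (xP _))).
  rewrite nrmZ; last by apply: sipB => //; exact: MH.
  rewrite exprMn (_ : cmod 2 = 2); last by rewrite cmod_ge0E ?ler0n// (@raddfMn _ _ _ 2 1).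
  have := infD _ Mmid; have [_] := xP k; have [_] := xP k.+1.
  set a := nrm _ ^+ 2; set b := nrm _ ^+ 2; set c := nrm _ ^+ 2.
  rewrite [_ ^+ k.+1]exprS exprMn; have := exprn_ge0 2 (ltW (geo_gt0 R k)).
  set g := (_ ^+ k) ^+ 2; lra.
have [y Hy yP] := cH x Hx rx; pose r := u - y.
have Hr : H r by exact: sipB.
have ort m : M m -> dot r m = 0.
  move=> Mm; have Hm := MH _ Mm; apply: best_approx_orthogonal => // a.
  have Ham := sipZ a Hm.
  (* One [2^-k] from the excess of [|u - x k|] over the distance, and two for each of the two
     replacements of [x k] by [y]. *)
  apply: (@le_geo _ 5) => k.
  have up : nrm (u - x k) <= Num.sqrt d + 2^-1 ^+ k.
    have g0 := geo_gt0 R k; have s0 := sqrtr_ge0 d.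
    rewrite -ler_sqr ?nnegrE ?nrm_ge0 ?addr_ge0 ?(ltW g0)//.
    have [_ /le_trans] := xP k; apply; rewrite sqrrD sqr_sqrtr//.
    by have := mulr_ge0 s0 (ltW g0); have := exprn_gt0 2 g0; lra.
  have lo : Num.sqrt d <= nrm (u - x k - a *: m).
    rewrite -ler_sqr ?nnegrE ?nrm_ge0 ?sqrtr_ge0// sqr_sqrtr//.
    rewrite -addrA -opprD; apply: infD.
    by rewrite addrC; apply: MZD => //; case: (xP k).
  have t1 : nrm r <= nrm (u - x k) + nrm (x k - y) by exact: nrm_dist.
  have t2 : nrm (u - x k - a *: m) <= nrm (r - a *: m) + nrm (x k - y).
    rewrite (nrm_distC (Hx k) Hy).
    have -> : u - x k - a *: m = (r - a *: m) + (y - x k).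
      by rewrite /r [u - y - _]addrAC subrKA addrAC.
    by apply: nrmD; apply: sipB.
  by have := yP k; lra.
have r0 : nrm r = 0 by rewrite /nrm tot// sqrtr0.
have [k kP] := geo_lt (divr_gt0 e0 (ltr0n R 2)).
exists (x k); first by case: (xP k).
apply: le_lt_trans (nrm_dist Hu Hy (Hx k)) _.
rewrite r0 add0r nrm_distC//; apply: le_lt_trans (yP k) _.
by rewrite -ltr_pdivlMl// mulrC.
Qed.

End semi_inner_product.

(** * Transfer between total families with equal Gram matrices *)

Section sip_dist.
Variables (R : realType) (U : lmodType R[i]) (H : set U) (dot : U -> U -> R[i]).
Hypothesis sip : semi_inner_product H dot.

(** The norm of [x] is estimated through [u], so that the bound involves only the limits and the
    distances to them. *)
Lemma dot_dist u u' x x' : H u -> H u' -> H x -> H x' ->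
  cmod (dot u u' - dot x x') <=
  nrm dot (u - x) * nrm dot u' + (nrm dot u + nrm dot (u - x)) * nrm dot (u' - x').
Proof.
move=> Hu Hu' Hx Hx'; have Hux := sipB sip Hu Hx; have Hux' := sipB sip Hu' Hx'.
have -> : dot u u' - dot x x' = dot (u - x) u' + dot x (u' - x').
  by rewrite (dotBl sip)// (dotBr sip)// subrKA.
apply: le_trans (cmodD _ _) (lerD _ _); first exact: (cauchy_schwarz sip).
apply: le_trans (cauchy_schwarz sip Hx Hux') _.
rewrite ler_wpM2r ?nrm_ge0// -[x in leLHS](subrK u) addrC.
apply: le_trans (nrmD sip Hu (sipB sip Hx Hu)) _.
by rewrite (nrm_distC sip).
Qed.

End sip_dist.

Definition lin_comb (R : realType) (U : lmodType R[i]) (I : Type) (e : I -> U)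
  (s : seq (R[i] * I)) : U := \sum_(p <- s) p.1 *: e p.2.

Lemma lin_combZD (R : realType) (U : lmodType R[i]) (I : Type) (e : I -> U)
    (a : R[i]) s t :
  lin_comb e ([seq (a * p.1, p.2) | p <- s] ++ t) =
  a *: lin_comb e s + lin_comb e t.
Proof.
rewrite /lin_comb big_cat big_map scaler_sumr; congr (_ + _).
by apply: eq_bigr => p _; rewrite scalerA.
Qed.

Section gram_transfer.
Variables (R : realType) (U W : lmodType R[i]).
Variables (X : set U) (dotX : U -> U -> R[i]) (K : set W) (dotK : W -> W -> R[i]).
Hypotheses (sipX : semi_inner_product X dotX) (sipK : semi_inner_product K dotK).
Variables (I : Type) (ka : I -> U) (de : I -> W).
Hypotheses (Xka : forall i, X (ka i)) (Kde : forall i, K (de i)).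
Hypothesis gram : forall i j, dotX (ka i) (ka j) = dotK (de i) (de j).

Lemma lin_comb_sip (V : lmodType R[i]) (H : set V) dot (e : I -> V) s :
  semi_inner_product H dot -> (forall i, H (e i)) -> H (lin_comb e s).
Proof. by move=> sip He; apply: (sip_sum sip) => p; exact: (sipZ sip). Qed.

Lemma gram_lin_comb s t :
  dotX (lin_comb ka s) (lin_comb ka t) = dotK (lin_comb de s) (lin_comb de t).
Proof.
rewrite {1 3}/lin_comb (dot_suml sipX); last 2 first.
- by move=> p; exact: (sipZ sipX).
- exact: lin_comb_sip sipX _.
rewrite (dot_suml sipK); last 2 first.
- by move=> p; exact: (sipZ sipK).
- exact: lin_comb_sip sipK _.
apply: eq_bigr => p _; rewrite (dotZl sipX)//; last exact: lin_comb_sip sipX _.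
rewrite (dotZl sipK)//; last exact: lin_comb_sip sipK _.
congr (_ * _).
rewrite (dot_sumr sipX)//; last by move=> q; exact: (sipZ sipX).
rewrite (dot_sumr sipK)//; last by move=> q; exact: (sipZ sipK).
by apply: eq_bigr => q _; rewrite (dotZr sipX)// (dotZr sipK)// gram.
Qed.

Lemma nrm_gram_lin_comb s : nrm dotX (lin_comb ka s) = nrm dotK (lin_comb de s).
Proof. by rewrite /nrm gram_lin_comb. Qed.

(** The graph of the isometry to be built: [u] and [w] are limits of combinations with the same
    coefficients. Being symmetric in the two spaces, it also serves the inverse map. *)
Definition gram_related u w := exists s : nat -> seq (R[i] * I), forall k,
  nrm dotX (u - lin_comb ka (s k)) <= 2 * 2^-1 ^+ k /\
  nrm dotK (w - lin_comb de (s k)) <= 2 * 2^-1 ^+ k.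

Lemma gram_related_family i : gram_related (ka i) (de i).
Proof.
exists (fun _ => [:: (1, i)]) => k; rewrite /lin_comb !big_seq1 /= !scale1r !subrr.
rewrite /nrm (dot0l sipX) ?(dot0l sipK) ?sqrtr0; try exact: sip0 sipX; try exact: sip0 sipK.
by split; apply: mulr_ge0 => //; exact/ltW/geo_gt0.
Qed.

(** Both products differ from a common Gram sum by at most a constant times [2^-k]; the constant
    comes from [dot_dist] with distances [2 * 2^-k] and [2^-k <= 1]. *)
Lemma gram_related_dot u u' w w' : X u -> X u' -> K w -> K w' ->
  gram_related u w -> gram_related u' w' -> dotX u u' = dotK w w'.
Proof.
move=> Xu Xu' Kw Kw' [s sP] [s' sP']; apply/eqP; rewrite -subr_eq0; apply/eqP.
apply: cmod0_eq0.
apply: (@le_geo _ (2 * nrm dotX u' + 2 * (nrm dotX u + 2) +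
                  (2 * nrm dotK w' + 2 * (nrm dotK w + 2)))) => k.
have [a1 b1] := sP k; have [a2 b2] := sP' k.
set x := lin_comb ka (s k) in a1; set x' := lin_comb ka (s' k) in a2.
set y := lin_comb de (s k) in b1; set y' := lin_comb de (s' k) in b2.
have Xx : X x by exact: lin_comb_sip sipX _.
have Xx' : X x' by exact: lin_comb_sip sipX _.
have Ky : K y by exact: lin_comb_sip sipK _.
have Ky' : K y' by exact: lin_comb_sip sipK _.
have -> : dotX u u' - dotK w w' =
    (dotX u u' - dotX x x') - (dotK w w' - dotK y y').
  by rewrite gram_lin_comb opprB addrA subrK.
apply: le_trans (cmodB _ _) _; rewrite add0r mulrDl.
have g0 := geo_gt0 R k; have g1 : 2^-1 ^+ k <= 1 :> R.
  by rewrite exprn_ile1 ?invr_ge0// invf_le1// ler1n.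
have bound (V : lmodType R[i]) (dot : V -> V -> R[i]) a b c d :
    nrm dot a <= 2 * 2^-1 ^+ k -> nrm dot b <= 2 * 2^-1 ^+ k ->
    nrm dot a * nrm dot c + (nrm dot d + nrm dot a) * nrm dot b <=
    (2 * nrm dot c + 2 * (nrm dot d + 2)) * 2^-1 ^+ k.
  move=> ha hb; have := nrm_ge0 dot a; have := nrm_ge0 dot b.
  have := nrm_ge0 dot c; have := nrm_ge0 dot d.
  move: (nrm dot a) (nrm dot b) (nrm dot c) (nrm dot d) (2^-1 ^+ k) ha hb g0 g1.
  move=> A B C D g hA hB g0 g1 D0 C0 B0 A0.
  rewrite [leRHS]mulrDl; apply: lerD; first by rewrite [leRHS]mulrAC ler_wpM2r.
  rewrite [leRHS](_ : _ = (D + 2) * (2 * g)); last by ring.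
  by apply: ler_pM => //; [exact: addr_ge0|lra].
apply: lerD.
  exact: le_trans (dot_dist sipX Xu Xu' Xx Xx') (bound _ _ _ _ _ _ a1 a2).
exact: le_trans (dot_dist sipK Kw Kw' Ky Ky') (bound _ _ _ _ _ _ b1 b2).
Qed.

Hypothesis cK : complete K dotK.
Hypothesis cX : complete X dotX.
Hypothesis tX : forall u, X u -> (forall i, dotX u (ka i) = 0) -> dotX u u = 0.

Lemma gram_transfer u : X u -> exists2 w, K w & gram_related u w.
Proof.
move=> Xu; pose M := [set lin_comb ka s | s in setT].
(* Half of [2^-k], so that consecutive combinations are within [3/4] of [2^-k]. Equality of the Gram
   matrices carries this rate to the other space, whose completeness supplies [w]. *)
have /choice[s sP] : forall k, exists s,
    nrm dotX (u - lin_comb ka s) <= 2^-1 ^+ k / 2.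
  move=> k; have e0 : 0 < 2^-1 ^+ k / 2 :> R by rewrite divr_gt0// geo_gt0.
  have [] := @total_dense _ _ _ _ sipX M cX _ _ _ _ u _ Xu e0.
  - by move=> _ [t _ <-]; exact: lin_comb_sip sipX _.
  - by exists [::] => //; rewrite /lin_comb big_nil.
  - move=> a _ _ [t _ <-] [t' _ <-]; rewrite -lin_combZD.
    by eexists; last reflexivity.
  - move=> v Xv Mv; apply: tX => // i; apply: Mv.
    by exists [:: (1, i)] => //; rewrite /lin_comb big_seq1 scale1r.
  by move=> _ [t _ <-] lt; exists t; exact: ltW.
have Xs k : X (lin_comb ka (s k)) by exact: lin_comb_sip sipX _.
have Ks k : K (lin_comb de (s k)) by exact: lin_comb_sip sipK _.
have [] := cK (x := fun k => lin_comb de (s k)); first by [].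
  move=> k; have := lin_combZD de (-1) (s k) (s k.+1).
  rewrite scaleN1r addrC => <-; rewrite -nrm_gram_lin_comb lin_combZD scaleN1r addrC.
  apply: le_trans (nrm_dist sipX (Xs k.+1) Xu (Xs k)) _.
  rewrite (nrm_distC sipX)//; apply: le_trans (lerD (sP _) (sP _)) _.
  by rewrite exprS; have := geo_gt0 R k; set g := _ ^+ k; lra.
move=> w Kw wP; exists w => //; exists s => k; split; last by rewrite (nrm_distC sipK).
by apply: le_trans (sP k) _; have := geo_gt0 R k; set g := _ ^+ k; lra.
Qed.

End gram_transfer.

(* An element of a space is determined by its inner products with a total
   family, so equal Gram matrices identify the two completions. *)
Lemma isometry_of_gram (R : realType) (U W : lmodType R[i])
    (X : set U) (dotX : U -> U -> R[i]) (K : set W) (dotK : W -> W -> R[i])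
    (I : Type) (ka : I -> U) (de : I -> W) (T : U -> W) :
  semi_inner_product X dotX -> semi_inner_product K dotK ->
  complete X dotX -> complete K dotK ->
  (forall i, X (ka i)) -> (forall i, K (de i)) ->
  (forall i j, dotX (ka i) (ka j) = dotK (de i) (de j)) ->
  (forall u, X u -> (forall i, dotX u (ka i) = 0) -> dotX u u = 0) ->
  (forall w, K w -> (forall i, dotK w (de i) = 0) -> dotK w w = 0) ->
  (forall u w, X u -> K w -> (forall i, dotX u (ka i) = dotK w (de i)) -> T u = w) ->
  (forall f g, X f -> X g -> nrm dotX (f - g) = 0 -> T f = T g) /\
  isometry_onto X dotX K dotK T.
Proof.
move=> sipX sipK cX cK Xka Kde gram tX tK TE.
have related_family := gram_related_family sipX sipK ka de.
(* Linearity of [T] is not assumed: it too is recovered from inner products, by [TE]. *)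
have TP u : X u -> K (T u) /\ gram_related dotX dotK ka de u (T u).
  move=> Xu; have [w Kw uw] := gram_transfer sipX sipK Xka Kde gram cK cX tX Xu.
  suff -> : T u = w by [].
  by apply: TE => // i; apply: (gram_related_dot sipX sipK Xka Kde gram).
have Tka u i : X u -> dotX u (ka i) = dotK (T u) (de i).
  by move=> Xu; have [? ?] := TP u Xu; apply: (gram_related_dot sipX sipK Xka Kde gram).
split.
  move=> f g Xf Xg fg0; apply: TE => //; first by case: (TP g Xg).
  move=> i; rewrite -Tka//; apply/eqP; rewrite -subr_eq0 -(dotBl sipX)//; apply/eqP.
  by apply: (nrm0_dot sipX) => //; exact: (sipB sipX).
split.
- by move=> u /TP[].
- move=> a u v Xu Xv; have [Ku _] := TP u Xu; have [Kv _] := TP v Xv.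
  apply: TE; [exact: (sipZD sipX)|exact: (sipZD sipK)|move=> i].
  by rewrite (sip_linear sipX)// (sip_linear sipK)// !Tka.
- move=> u v Xu Xv; have [? ?] := TP u Xu; have [? ?] := TP v Xv.
  by apply/esym; apply: (gram_related_dot sipX sipK Xka Kde gram).
- move=> w Kw.
  (* Surjectivity is the transfer in the opposite direction. *)
  have [u Xu wu] := gram_transfer sipK sipX Kde Xka (fun i j => esym (gram i j)) cX cK tK Kw.
  exists u => //; apply: TE => // i; apply: (gram_related_dot sipX sipK Xka Kde gram) => //.
  by have [s sP] := wu; exists s => k; have [? ?] := sP k.
Qed.

(** * Positive semidefinite matrices *)

Section hermitian_forms.
Variables (R : realType) (U : lmodType R[i]) (H : set U) (B : U -> U -> R[i]).
Hypothesis H0 : H 0.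
Hypothesis HZD : forall (a : R[i]) u v, H u -> H v -> H (a *: u + v).
Hypothesis BZDl : forall (a : R[i]) u v w, H u -> H v -> H w ->
  B (a *: u + v) w = a * B u w + B v w.
Hypothesis BZDr : forall (a : R[i]) u v w, H u -> H v -> H w ->
  B w (a *: u + v) = a^* * B w u + B w v.
Hypothesis B_ge0 : forall u, H u -> 0 <= B u u.

(* Polarization: [B (u + v) (u + v)] and [B (i u + v) (i u + v)] are real. *)
Lemma sip_of_form : semi_inner_product H B.
Proof.
split=> // u v Hu Hv.
have real z : 0 <= z -> z^* = z :> R[i] by move=> z0; rewrite (ge0_cRe z0) conjc_real.
have e a : a * B u v + a^* * B v u = (a * B u v + a^* * B v u)^*.
  have Hw := HZD a Hu Hv.
  have := real _ (B_ge0 Hw); rewrite BZDl// !BZDr// !(rmorphD, rmorphM) /= !conjCK.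
  rewrite (real _ (B_ge0 Hu)) (real _ (B_ge0 Hv)).
  move=> h; apply/eqP; rewrite -subr_eq0 -oppr_eq0; apply/eqP.
  by move/eqP: h; rewrite -subr_eq0 => /eqP <-; ring.
have := e 1; rewrite conjC1 !mul1r rmorphD /= => e1.
have := e 'i; rewrite conjCi !mulNr rmorphB !rmorphM /= conjCi !mulNr opprK.
move=> h; have e2 : B u v - B v u = (B v u)^* - (B u v)^*.
  by apply: (mulfI (neq0Ci _)); rewrite !mulrBr h addrC.
apply: (@mulfI _ 2); first by rewrite pnatr_eq0.
rewrite mulr_natl mulr2n mulr_natl mulr2n.
have -> : B v u + B v u = (B u v + B v u) - (B u v - B v u) by ring.
by rewrite e1 e2; ring.
Qed.

End hermitian_forms.

Section euclidean.
Variables (R : realType) (n : nat).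
Implicit Types (x y : 'cV[R[i]]_n) (A : 'M[R[i]]_n).

Lemma cdotZDl a x y z : cdot (a *: x + y) z = a * cdot x z + cdot y z.
Proof.
rewrite /cdot mulr_sumr -big_split /=; apply: eq_bigr => i _.
by rewrite !mxE mulrDl mulrA.
Qed.

Lemma cdotC x y : cdot y x = (cdot x y)^*.
Proof.
rewrite /cdot rmorph_sum; apply: eq_bigr => i _.
by rewrite rmorphM /= conjCK mulrC.
Qed.

Lemma cdot_sum_cmod x : cdot x x = (\sum_i cmod (x i 0) ^+ 2)%:C%C.
Proof. by rewrite /cdot rmorph_sum; apply: eq_bigr => i _; rewrite /= sqr_cmod. Qed.

Lemma cdot_ge0 x : 0 <= cdot x x.
Proof. by rewrite cdot_sum_cmod lecR; apply: sumr_ge0 => i _; exact: sqr_ge0. Qed.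

Lemma cdot_sip : semi_inner_product setT (@cdot R n).
Proof.
split=> //; [by move=> *; exact: cdotZDl|by move=> *; exact: cdotC|].
by move=> *; exact: cdot_ge0.
Qed.

Lemma sqr_cnorm x : cnorm x ^+ 2 = \sum_i cmod (x i 0) ^+ 2.
Proof. by rewrite (sqr_nrm cdot_sip)// cdot_sum_cmod. Qed.

Lemma cnorm_ge0 x : 0 <= cnorm x. Proof. exact: sqrtr_ge0. Qed.

Lemma cmod_le_cnorm x i : cmod (x i 0) <= cnorm x.
Proof.
rewrite -ler_sqr ?nnegrE ?cmod_ge0 ?cnorm_ge0// sqr_cnorm (bigD1 i)//= lerDl.
by apply: sumr_ge0 => j _; exact: sqr_ge0.
Qed.

Lemma cnorm0_eq0 x : cnorm x <= 0 -> x = 0.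
Proof.
move=> x0; apply/matrixP => i j; rewrite ord1 mxE; apply: cmod0_eq0.
exact: le_trans (cmod_le_cnorm x i) x0.
Qed.

Lemma cdot_eq0 x : cdot x x = 0 -> x = 0.
Proof. by move=> x0; apply: cnorm0_eq0; rewrite /cnorm x0 /= sqrtr0. Qed.

Lemma cdot_delta x i : cdot x (delta_mx i 0) = x i 0.
Proof.
rewrite /cdot (bigD1 i)//= big1 => [|j ji].
  by rewrite !mxE !eqxx conjC1 mulr1 addr0.
by rewrite !mxE (negbTE ji) conjC0 mulr0.
Qed.

Lemma cdot_inj x y : (forall z, cdot x z = cdot y z) -> x = y.
Proof. by move=> e; apply/matrixP => i j; rewrite ord1 -!cdot_delta e. Qed.

Lemma cdot_adj A x y : cdot (A *m x) y = cdot x ((A^t* : 'M[R[i]]_n) *m y).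
Proof.
rewrite /cdot.
transitivity (\sum_i \sum_j A i j * x j 0 * (y i 0)^*).
  by apply: eq_bigr => i _; rewrite !mxE mulr_suml.
rewrite exchange_big /=; apply: eq_bigr => j _.
rewrite !mxE rmorph_sum mulr_sumr; apply: eq_bigr => i _.
by rewrite !mxE rmorphM /= conjCK; ring.
Qed.

Lemma adjK A : A^t*^t* = A.
Proof. by apply/matrixP => i j; rewrite !mxE conjCK. Qed.

Lemma mx_delta A i j : cdot (A *m delta_mx j 0) (delta_mx i 0) = A i j.
Proof.
rewrite cdot_delta mxE (bigD1 j)//= big1 => [|k kj].
  by rewrite !mxE !eqxx mulr1 addr0.
by rewrite !mxE (negbTE kj) mulr0.
Qed.

Lemma cvg_le_geo (u : nat -> R[i]) l (c : R) :
  (forall k, cmod (u k - l) <= c * 2^-1 ^+ k) -> u @ \oo --> l.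
Proof.
move=> uc; have : (fun k => c * 2^-1 ^+ k) @ \oo --> (0 : R).
  rewrite -(mulr0 c); apply: cvgMr; apply: cvg_expr.
  by rewrite ger0_norm ?invr_ge0// invf_lt1// (ltr_nat _ 1 2).
move=> cg; apply/cvgrPdist_lt => e e0.
have er : e = (complex.Re e)%:C%C by exact/ge0_cRe/ltW.
have e'0 : 0 < complex.Re e by rewrite -ltcR -er.
move/cvgrPdist_lt : cg => /(_ _ e'0)[N _ NP]; exists N => // k /NP.
rewrite sub0r normrN => lt; rewrite cmodE er ltcR; apply: le_lt_trans lt.
by rewrite -cmodN opprB; apply: le_trans (uc k) (ler_norm _).
Qed.

End euclidean.

Section complex_limits.
Variables (R : realType) (T : Type) (F : set_system T).
Context {FF : ProperFilter F}.
Implicit Types (u v : T -> R[i]) (l m : R[i]).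

Lemma cvg_cRe u l : u @ F --> l -> (fun t => complex.Re (u t)) @ F --> complex.Re l.
Proof. by move=> ul; apply: (cvg_comp _ _ ul); exact: continuous_cRe. Qed.

Lemma cvg_cIm u l : u @ F --> l -> (fun t => complex.Im (u t)) @ F --> complex.Im l.
Proof. by move=> ul; apply: (cvg_comp _ _ ul); exact: continuous_cIm. Qed.

Lemma cvg_complex u l : (fun t => complex.Re (u t)) @ F --> complex.Re l ->
  (fun t => complex.Im (u t)) @ F --> complex.Im l -> u @ F --> l.
Proof.
move=> /cvgrPdist_lt ur /cvgrPdist_lt ui; apply/cvgrPdist_lt => e e0.
have er : e = (complex.Re e)%:C%C by exact/ge0_cRe/ltW.
have e'0 : 0 < complex.Re e / 2 by rewrite divr_gt0// -ltcR -er.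
near=> t; rewrite er cmodE ltcR; apply: le_lt_trans (cmod_le_ReIm _) _.
rewrite !raddfB /= (splitr (complex.Re e)); apply: ltrD.
  by near: t; exact: ur.
by near: t; exact: ui.
Unshelve. all: by end_near. Qed.

Lemma cvg_conj u l : u @ F --> l -> (fun t => (u t)^*) @ F --> l^*.
Proof.
move=> ul; apply: cvg_complex.
  by rewrite cRe_conj; under eq_fun do rewrite cRe_conj; exact: cvg_cRe.
rewrite cIm_conj; under eq_fun do rewrite cIm_conj.
by apply: cvgN; exact: cvg_cIm.
Qed.

Lemma cvgD_complex u v l m : u @ F --> l -> v @ F --> m ->
  (fun t => u t + v t) @ F --> l + m.
Proof. exact: cvgD. Qed.

Lemma cvgB_complex u v l m : u @ F --> l -> v @ F --> m ->
  (fun t => u t - v t) @ F --> l - m.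
Proof. exact: cvgB. Qed.

Lemma cvgM_complex u v l m : u @ F --> l -> v @ F --> m ->
  (fun t => u t * v t) @ F --> l * m.
Proof. exact: cvgM. Qed.

Lemma cvg_bigsum (I : Type) (r : seq I) (u : I -> T -> R[i]) (l : I -> R[i]) :
  (forall i, u i @ F --> l i) ->
  (fun t => \sum_(i <- r) u i t) @ F --> \sum_(i <- r) l i.
Proof.
move=> ul; elim: r => [|i r IH].
  by rewrite big_nil; under eq_fun do rewrite big_nil; exact: cvg_cst.
rewrite big_cons; under eq_fun do rewrite big_cons.
by apply: (cvgD_complex (ul i) IH).
Qed.

Lemma cvg_cdot n (u v : T -> 'cV[R[i]]_n) (x y : 'cV[R[i]]_n) :
  (forall i, (fun t => u t i 0) @ F --> x i 0) ->
  (forall i, (fun t => v t i 0) @ F --> y i 0) ->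
  (fun t => cdot (u t) (v t)) @ F --> cdot x y.
Proof.
by move=> ux vy; apply: cvg_bigsum => i; apply: cvgM_complex => //; exact: cvg_conj.
Qed.

Lemma cvg_mulmx p n (A : 'M[R[i]]_(p, n)) (u : T -> 'cV[R[i]]_n) (x : 'cV[R[i]]_n) i :
  (forall i, (fun t => u t i 0) @ F --> x i 0) ->
  (fun t => (A *m u t) i 0) @ F --> (A *m x) i 0.
Proof.
move=> ux; rewrite mxE; under eq_fun do rewrite mxE.
by apply: cvg_bigsum => j; apply: cvgM_complex => //; exact: cvg_cst.
Qed.

End complex_limits.

Section psd_matrices.
Variables (R : realType) (n : nat) (A : 'M[R[i]]_n).
Hypothesis A0 : psd A.
Implicit Types (x y : 'cV[R[i]]_n).

Definition mxform x y := cdot (A *m x) y.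

Lemma mxform_sip : semi_inner_product setT mxform.
Proof.
apply: sip_of_form => // [a u v w|a u v w|u] _.
- by move=> _ _; rewrite /mxform mulmxDr -scalemxAr cdotZDl.
- by move=> _ _; rewrite /mxform cdotC cdotZDl rmorphD rmorphM /= -!cdotC.
- exact: A0.
Qed.

Lemma psd_herm : A^t* = A.
Proof.
apply/matrixP => i j; rewrite !mxE -!mx_delta.
by rewrite -[cdot (A *m delta_mx j 0) _]/(mxform _ _) (sipC mxform_sip).
Qed.

Lemma psd_diag_ge0 i : 0 <= A i i.
Proof. by rewrite -mx_delta; exact: A0. Qed.

Lemma psd_diag_le i : complex.Re (A i i) <= complex.Re (\tr A).
Proof.
rewrite /mxtrace (bigD1 i)//= raddfD /= lerDl; apply: cRe_ge0.
by apply: sumr_ge0 => j _; exact: psd_diag_ge0.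
Qed.

Lemma nrm_mxform_delta i : nrm mxform (delta_mx i 0) <= Num.sqrt (complex.Re (\tr A)).
Proof. by rewrite /nrm /mxform mx_delta ler_wsqrtr// psd_diag_le. Qed.

(** Cauchy-Schwarz for the form of [A]: the entries of [A x] are controlled by the seminorm of [x],
    although [x] itself is not when [A] is singular. *)
Lemma psd_mulmx_le x i :
  cmod ((A *m x) i 0) <= nrm mxform x * Num.sqrt (complex.Re (\tr A)).
Proof.
rewrite -cdot_delta; apply: le_trans (cauchy_schwarz mxform_sip _ _) _ => //.
by rewrite ler_wpM2l ?nrm_ge0// nrm_mxform_delta.
Qed.

Lemma psd_entry_le i j : cmod (A i j) <= complex.Re (\tr A).
Proof.
rewrite -mx_delta cdot_delta; apply: le_trans (psd_mulmx_le _ _) _.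
rewrite -[leRHS]sqr_sqrtr ?expr2 ?ler_wpM2r ?sqrtr_ge0 ?nrm_mxform_delta//.
exact: psd_tr.
Qed.

(** This makes a matrix measure absolutely continuous with respect to its trace. *)
Lemma psd_tr0 : complex.Re (\tr A) = 0 -> A = 0.
Proof.
move=> t0; apply/matrixP => i j; rewrite mxE; apply: cmod0_eq0.
by rewrite -t0 psd_entry_le.
Qed.

(** The range of [A] is closed: it is the kernel of a matrix [C], and [C] vanishes on all [A v_k],
    hence on their limit. *)
Lemma cvg_mulmx_range (v : nat -> 'cV[R[i]]_n) (h : 'cV[R[i]]_n) :
  (forall i, (fun k => (A *m v k) i 0) @ \oo --> h i 0) -> exists y, h = A *m y.
Proof.
move=> vh; suff /submxP[D hD] : (h^T <= A^T)%MS.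
  by exists D^T; apply: (can_inj (@trmxK _ _ _)); rewrite trmx_mul trmxK.
rewrite submxE -trmx_eq0; apply/eqP; rewrite trmx_mul trmxK.
apply/matrixP => i j; rewrite ord1 [RHS]mxE.
pose C : 'M[R[i]]_n := (cokermx A^T)^T; rewrite -/C.
have := @cvg_mulmx R nat \oo eventually_filter n n C (fun t => A *m v t) h i vh.
have -> : (fun t => (C *m (A *m v t)) i 0) = fun => 0.
  apply/funext => t; rewrite mulmxA /C -[A]trmxK -trmx_mul trmxK mulmx_coker trmx0.
  by rewrite mul0mx mxE.
move=> /cvg_lim <- //; exact: lim_cst.
Qed.

Lemma psd_sqr_mul0 (C : 'M[R[i]]_n) : A *m A *m C = 0 -> A *m C = 0.
Proof.
move=> AAC; apply/matrixP => i j; rewrite [RHS]mxE -mx_delta.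
have : cdot (A *m (C *m delta_mx j 0)) (A *m (C *m delta_mx j 0)) = 0.
  by rewrite cdot_adj psd_herm !mulmxA AAC mul0mx cdotC (dot0l (@cdot_sip R n))// conjC0.
by rewrite -mulmxA => /cdot_eq0 ->; rewrite (dot0l (@cdot_sip R n)).
Qed.

(** A Hermitian matrix and its square have the same range. The kernel side is [psd_sqr_mul0]; it
    gives [A = D A A], and taking adjoints moves [D] to the right. *)
Lemma psd_range_sqr y : exists u, A *m y = A *m (A *m u).
Proof.
suff /submxP[D AD] : (A <= A *m A)%MS.
  have AD' : A = D *m (A *m A) by exact: AD.
  exists ((D^t* : 'M[R[i]]_n) *m y); apply: cdot_inj => z.
  rewrite [RHS]cdot_adj psd_herm [RHS]cdot_adj psd_herm [RHS]cdot_adj adjK.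
  by rewrite cdot_adj psd_herm {1}AD' !mulmxA.
by rewrite submxE; apply/eqP; apply: psd_sqr_mul0; exact: mulmx_coker.
Qed.

Lemma psd_ginv : exists E : 'M[R[i]]_n, A *m E *m A = A.
Proof. by exists (pinvmx A); exact: (mulmxKpV (submx_refl A)). Qed.

(** The vectors [v k] need not converge, but the form depends on [A y] alone: with a generalized
    inverse [E] of [A], [(A y, y) = (E A y, A y)]. *)
Lemma cvg_mxform_quad (v : nat -> 'cV[R[i]]_n) h x :
  (forall i, (fun k => (A *m v k) i 0) @ \oo --> (A *m h) i 0) ->
  (fun k => mxform (x - v k) (x - v k)) @ \oo --> mxform (x - h) (x - h).
Proof.
move=> vh; have [E AEA] := psd_ginv.
have AE y : mxform y y = cdot (E *m (A *m y)) (A *m y).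
  rewrite [RHS](_ : _ = cdot (A *m (E *m (A *m y))) y); last first.
    by rewrite [RHS]cdot_adj psd_herm.
  by rewrite !mulmxA AEA.
have mulB y i : (A *m (x - y)) i 0 = (A *m x) i 0 - (A *m y) i 0.
  by rewrite mulmxBr !mxE.
have d i : (fun k => (A *m (x - v k)) i 0) @ \oo --> (A *m (x - h)) i 0.
  rewrite mulB; under eq_fun do rewrite mulB.
  by apply: cvgB_complex; [exact: cvg_cst|exact: vh].
rewrite AE; under eq_fun do rewrite AE.
by apply: cvg_cdot => i //; exact: cvg_mulmx.
Qed.

(** Tikhonov regularization: an invertible perturbation of [A], whose inverse selects a solution of
    [A f = h] by a formula measurable in [A] and [h]. *)
Definition psd_reg k : 'M[R[i]]_n := A + ((2^-1 ^+ k : R)%:C%C)%:M.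

Lemma psd_reg_bound k v : 2^-1 ^+ k * cnorm v <= cnorm (psd_reg k *m v).
Proof.
have g0 := geo_gt0 R k; set e := _ ^+ k.
have [->|v0] := eqVneq (cnorm v) 0; first by rewrite mulr0 cnorm_ge0.
have v1 : 0 < cnorm v by rewrite lt0r v0 cnorm_ge0.
rewrite -(ler_pM2r v1); apply: le_trans (cauchy_schwarz (@cdot_sip R n) _ _) => //.
apply: le_trans (cRe_le_cmod _).
rewrite mulmxDl (dotDl (@cdot_sip R n))// mul_scalar_mx (dotZl (@cdot_sip R n))//.
rewrite raddfD /= cRe_realM -mulrA -expr2 (sqr_nrm (@cdot_sip R n))// lerDr.
exact/cRe_ge0/A0.
Qed.

Lemma psd_reg_unit k : psd_reg k \in unitmx.
Proof.
rewrite -unitmx_tr -row_free_unit; apply/row_freeP.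
apply: contrapT => nf; apply: nf.
apply/row_freeP; rewrite -kermx_eq0; apply/eqP.
set C := kermx _; have C0 : psd_reg k *m C^T = 0.
  by apply: (can_inj (@trmxK _ _ _)); rewrite trmx_mul trmxK mulmx_ker trmx0.
apply: (can_inj (@trmxK _ _ _)); rewrite trmx0; apply/matrixP => i j.
have := psd_reg_bound k (C^T *m delta_mx j 0).
rewrite mulmxA C0 mul0mx [X in _ <= X](_ : _ = 0); last first.
  by rewrite /cnorm (dot0l (@cdot_sip R n)) //= sqrtr0.
rewrite pmulr_rle0 ?geo_gt0// => /cnorm0_eq0 /(congr1 (fun v => cdot v (delta_mx i 0))).
by rewrite mx_delta => ->; rewrite (dot0l (@cdot_sip R n))// mxE.
Qed.

Definition psd_inv k : 'M[R[i]]_n := invmx (psd_reg k).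

Lemma psd_invK k (z : 'cV[R[i]]_n) : psd_inv k *m (psd_reg k *m z) = z.
Proof. by apply: mulKmx; exact: psd_reg_unit. Qed.

Lemma psd_invKV k (z : 'cV[R[i]]_n) : psd_reg k *m (psd_inv k *m z) = z.
Proof. by apply: mulKVmx; exact: psd_reg_unit. Qed.

(** By [psd_range_sqr] one may write [A y = A A u]; the regularized solutions then converge to
    [A u]. *)
Lemma cvg_psd_reg y : exists2 f, A *m f = A *m y &
  forall i, (fun k => (psd_inv k *m (A *m y)) i 0) @ \oo --> f i 0.
Proof.
have [u yu] := psd_range_sqr y; exists (A *m u) => // i.
apply: (@cvg_le_geo _ _ _ (2 * cnorm u)) => k.
rewrite yu; set e := _ ^+ k; have g0 := geo_gt0 R k.
(* Two steps of dividing [A A u] by [A + e]. The last two terms have norm at most [e |u|] each,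
   since the inverse of [A + e] has norm at most [1/e]. *)
have -> : psd_inv k *m (A *m (A *m u)) =
    A *m u - e%:C%C *: u + (e ^+ 2)%:C%C *: (psd_inv k *m u).
  have -> : A *m (A *m u) = psd_reg k *m (A *m u - e%:C%C *: u) + (e ^+ 2)%:C%C *: u.
    rewrite mulmxBr /psd_reg !mulmxDl !mul_scalar_mx -scalemxAr scalerA.
    by rewrite -rmorphM -expr2 /= -/e opprD addrA addrK subrK.
  by rewrite mulmxDr psd_invK -scalemxAr.
have -> : forall a b c : 'cV[R[i]]_n, (a - b + c) i 0 - a i 0 = c i 0 - b i 0.
  by move=> a b c; rewrite !mxE; ring.
apply: le_trans (cmodB _ _) _; rewrite !mxE !cmodM !cmod_real.
rewrite !ger0_norm ?exprn_ge0 ?(ltW g0)//.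
have := cmod_le_cnorm u i; have := cmod_le_cnorm (psd_inv k *m u) i.
have := psd_reg_bound k (psd_inv k *m u); rewrite psd_invKV.
rewrite -/e mxE; set a := cmod _; set b := cnorm _; set c := cnorm _; set d := cmod _.
move=> h1 h2 h3; have g0' : 0 < e by [].
have : e * (e * a) <= e * c by rewrite ler_pM2l// (le_trans _ h1)// ler_pM2l.
have : e * d <= e * c by rewrite ler_pM2l.
lra.
Qed.

End psd_matrices.

(** * Square-integrable vector functions against a matrix measure *)

Section complex_measurability.
Context d (T : measurableType d) (R : realType).
Implicit Types (f g : T -> R[i]).

Definition cmeasurable f :=
  measurable_fun setT (fun x => complex.Re (f x)) /\
  measurable_fun setT (fun x => complex.Im (f x)).

Lemma cmeasurable_cst (c : R[i]) : cmeasurable (fun=> c).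
Proof. by split; exact: measurable_cst. Qed.

Lemma cmeasurable_real (h : T -> R) : measurable_fun setT h ->
  cmeasurable (fun x => (h x)%:C%C).
Proof. by split => //=; exact: measurable_cst. Qed.

Lemma cmeasurableD f g : cmeasurable f -> cmeasurable g ->
  cmeasurable (fun x => f x + g x).
Proof.
move=> [fr fi] [gr gi]; split; under eq_fun do rewrite raddfD /=;
  exact: measurable_funD.
Qed.

Lemma cmeasurableM f g : cmeasurable f -> cmeasurable g ->
  cmeasurable (fun x => f x * g x).
Proof.
have ReM (z w : R[i]) : complex.Re (z * w) =
    complex.Re z * complex.Re w - complex.Im z * complex.Im w by case: z w => ? ? [].
have ImM (z w : R[i]) : complex.Im (z * w) =
    complex.Re z * complex.Im w + complex.Im z * complex.Re w by case: z w => ? ? [].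
move=> [fr fi] [gr gi]; split.
  by under eq_fun do rewrite ReM; apply: measurable_funB; exact: measurable_funM.
by under eq_fun do rewrite ImM; apply: measurable_funD; exact: measurable_funM.
Qed.

Lemma cmeasurableN f : cmeasurable f -> cmeasurable (fun x => - f x).
Proof.
move=> mf; under [X in cmeasurable X]eq_fun do rewrite -mulN1r.
by apply: cmeasurableM => //; exact: cmeasurable_cst.
Qed.

Lemma cmeasurableB f g : cmeasurable f -> cmeasurable g ->
  cmeasurable (fun x => f x - g x).
Proof. by move=> mf mg; apply: cmeasurableD => //; exact: cmeasurableN. Qed.

Lemma cmeasurable_conj f : cmeasurable f -> cmeasurable (fun x => (f x)^*).
Proof.
move=> [fr fi]; split; first by under eq_fun do rewrite cRe_conj.
by under eq_fun do rewrite cIm_conj; exact: measurable_funN.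
Qed.

Lemma cmeasurable_sum (I : Type) (r : seq I) (f : I -> T -> R[i]) :
  (forall i, cmeasurable (f i)) -> cmeasurable (fun x => \sum_(i <- r) f i x).
Proof.
move=> mf; elim: r => [|i r IH].
  by under [X in cmeasurable X]eq_fun do rewrite big_nil; exact: cmeasurable_cst.
under [X in cmeasurable X]eq_fun do rewrite big_cons.
exact: cmeasurableD.
Qed.

Lemma cmeasurable_prod (I : Type) (r : seq I) (f : I -> T -> R[i]) :
  (forall i, cmeasurable (f i)) -> cmeasurable (fun x => \prod_(i <- r) f i x).
Proof.
move=> mf; elim: r => [|i r IH].
  by under [X in cmeasurable X]eq_fun do rewrite big_nil; exact: cmeasurable_cst.
under [X in cmeasurable X]eq_fun do rewrite big_cons.
exact: cmeasurableM.
Qed.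

Lemma cmodE_sqrt (z : R[i]) : cmod z = Num.sqrt (complex.Re z ^+ 2 + complex.Im z ^+ 2).
Proof. by rewrite /cmod normc_def. Qed.

Lemma measurable_cmod f : cmeasurable f -> measurable_fun setT (fun x => cmod (f x)).
Proof.
move=> [fr fi]; under eq_fun do rewrite cmodE_sqrt.
apply: (measurableT_comp (f := @Num.sqrt R)).
  by apply: continuous_measurable_fun; exact: sqrt_continuous.
by apply: measurable_funD; exact: measurable_funX.
Qed.

Lemma cmeasurableV f : cmeasurable f -> cmeasurable (fun x => (f x)^-1).
Proof.
(* Inversion becomes conjugation times a real power. At a zero of [f] both sides are 0 by the
   convention on the inverse of 0, so the domain is not split. *)
move=> mf; pose h x := (cmod (f x) ^+ 2) `^ (-1).
have -> : (fun x => (f x)^-1) = (fun x => (f x)^* * (h x)%:C%C).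
  apply/funext => x; have [->|fx0] := eqVneq (f x) 0.
    by rewrite invr0 conjC0 mul0r.
  rewrite /h powR_inv1 ?sqr_ge0// rmorphV /=; last first.
    by rewrite unitfE expf_eq0 /=; apply: contra_neq fx0 => fx0; apply: cmod0_eq0; rewrite fx0.
  by rewrite sqr_cmod invfM mulrA [_ / f x]mulrC mulfK// conjC_eq0.
apply: cmeasurableM; first exact: cmeasurable_conj.
apply: cmeasurable_real; apply: (measurableT_comp (measurable_powR _)).
by apply: measurable_funX; exact: measurable_cmod.
Qed.

Lemma cmeasurable_cvg (h : nat -> T -> R[i]) f : (forall k, cmeasurable (h k)) ->
  (forall x, (fun k => h k x) @ \oo --> f x) -> cmeasurable f.
Proof.
move=> mh hf; split.
  apply: (measurable_fun_cvg (h := fun k x => complex.Re (h k x))).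
    by move=> k; case: (mh k).
  by move=> x _; exact: cvg_cRe.
apply: (measurable_fun_cvg (h := fun k x => complex.Im (h k x))).
  by move=> k; case: (mh k).
by move=> x _; exact: cvg_cIm.
Qed.

Definition mxmeasurable m n (F : T -> 'M[R[i]]_(m, n)) :=
  forall i j, cmeasurable (fun x => F x i j).

Lemma mxmeasurable_mul m n p (F : T -> 'M[R[i]]_(m, n)) (G : T -> 'M[R[i]]_(n, p)) :
  mxmeasurable F -> mxmeasurable G -> mxmeasurable (fun x => F x *m G x).
Proof.
move=> mF mG i j; under [X in cmeasurable X]eq_fun do rewrite mxE.
by apply: cmeasurable_sum => k; exact: cmeasurableM.
Qed.

Lemma mxmeasurableD m n (F G : T -> 'M[R[i]]_(m, n)) :
  mxmeasurable F -> mxmeasurable G -> mxmeasurable (fun x => F x + G x).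
Proof.
move=> mF mG i j; under [X in cmeasurable X]eq_fun do rewrite mxE.
exact: cmeasurableD.
Qed.

Lemma mxmeasurableZ m n (a : T -> R[i]) (F : T -> 'M[R[i]]_(m, n)) :
  cmeasurable a -> mxmeasurable F -> mxmeasurable (fun x => a x *: F x).
Proof.
move=> ma mF i j; under [X in cmeasurable X]eq_fun do rewrite mxE.
exact: cmeasurableM.
Qed.

Lemma mxmeasurable_cst m n (A : 'M[R[i]]_(m, n)) : mxmeasurable (fun=> A : 'M[R[i]]_(m, n)).
Proof. by move=> i j; exact: cmeasurable_cst. Qed.

Lemma cmeasurable_det n (F : T -> 'M[R[i]]_n) :
  mxmeasurable F -> cmeasurable (fun x => \det (F x)).
Proof.
move=> mF; apply: cmeasurable_sum => s; apply: cmeasurableM.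
  exact: cmeasurable_cst.
by apply: cmeasurable_prod => i; exact: mF.
Qed.

Lemma mxmeasurable_inv n (F : T -> 'M[R[i]]_n) : (forall x, F x \in unitmx) ->
  mxmeasurable F -> mxmeasurable (fun x => invmx (F x)).
Proof.
move=> uF mF i j; under [X in cmeasurable X]eq_fun do rewrite /invmx uF !mxE.
apply: cmeasurableM; first by apply: cmeasurableV; exact: cmeasurable_det.
apply: cmeasurableM; first exact: cmeasurable_cst.
apply: cmeasurable_det => k l.
by under [X in cmeasurable X]eq_fun do rewrite !mxE; exact: mF.
Qed.

Lemma cmeasurable_cdot n (f g : T -> 'cV[R[i]]_n) :
  mxmeasurable f -> mxmeasurable g -> cmeasurable (fun x => cdot (f x) (g x)).
Proof.
move=> mf mg; apply: cmeasurable_sum => i; apply: cmeasurableM; first exact: mf.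
by apply: cmeasurable_conj; exact: mg.
Qed.

End complex_measurability.

Section complex_integral.
Context d (T : measurableType d) (R : realType) (mu : {measure set T -> \bar R}).
Implicit Types (f g : T -> R[i]).

Definition cintegrable f :=
  mu.-integrable setT (fun x => (complex.Re (f x))%:E) /\
  mu.-integrable setT (fun x => (complex.Im (f x))%:E).

Lemma cintegrable_measurable f : cintegrable f -> cmeasurable f.
Proof. by move=> [/measurable_int/measurable_EFinP ? /measurable_int/measurable_EFinP ?]. Qed.

Lemma cintegrable_le f (g : T -> R) : cmeasurable f ->
  mu.-integrable setT (fun x => (g x)%:E) -> (forall x, cmod (f x) <= g x) ->
  cintegrable f.
Proof.
move=> [fr fi] ig fg; split; apply: le_integrable ig => //=.
- exact/measurable_EFinP.
- move=> x _; rewrite lee_fin (le_trans (normcRe_le _))// (le_trans (fg x))//.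
  exact: ler_norm.
- exact/measurable_EFinP.
- move=> x _; rewrite lee_fin (le_trans (normcIm_le _))// (le_trans (fg x))//.
  exact: ler_norm.
Qed.

Lemma cintegrableD f g : cintegrable f -> cintegrable g -> cintegrable (fun x => f x + g x).
Proof.
move=> [fr fi] [gr gi]; split; under eq_fun do rewrite raddfD /= EFinD;
  exact: integrableD.
Qed.

Lemma cintegrableZ a f : cintegrable f -> cintegrable (fun x => a * f x).
Proof.
case: a => a b [fr fi]; split.
  have -> : (fun x => (complex.Re ((a +i* b)%C * f x))%:E) =
      ((fun x => a%:E * (complex.Re (f x))%:E - b%:E * (complex.Im (f x))%:E)%E).
    by apply/funext => x; case: (f x) => ? ? /=; rewrite EFinB !EFinM.
  by apply: integrableB => //; exact: integrableZl.
have -> : (fun x => (complex.Im ((a +i* b)%C * f x))%:E) =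
    ((fun x => a%:E * (complex.Im (f x))%:E + b%:E * (complex.Re (f x))%:E)%E).
  by apply/funext => x; case: (f x) => ? ? /=; rewrite EFinD !EFinM.
by apply: integrableD => //; exact: integrableZl.
Qed.

Lemma cintegrable_sum (I : Type) (r : seq I) (f : I -> T -> R[i]) :
  (forall i, cintegrable (f i)) -> cintegrable (fun x => \sum_(i <- r) f i x).
Proof.
move=> mf; elim: r => [|i r IH].
  under [X in cintegrable X]eq_fun do rewrite big_nil.
  by split; exact: integrable0.
under [X in cintegrable X]eq_fun do rewrite big_cons.
exact: cintegrableD.
Qed.

Lemma cintegralD f g : cintegrable f -> cintegrable g ->
  cintegral mu (fun x => f x + g x) = cintegral mu f + cintegral mu g.
Proof.
move=> [fr fi] [gr gi]; rewrite /cintegral.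
have -> : (fun x => complex.Re (f x + g x)) =
    (fun x => complex.Re (f x) + complex.Re (g x)) by apply/funext => x; rewrite raddfD.
have -> : (fun x => complex.Im (f x + g x)) =
    (fun x => complex.Im (f x) + complex.Im (g x)) by apply/funext => x; rewrite raddfD.
by rewrite !RintegralD.
Qed.

Lemma cintegralZ a f : cintegrable f ->
  cintegral mu (fun x => a * f x) = a * cintegral mu f.
Proof.
case: a => a b [fr fi]; rewrite /cintegral.
have -> : (fun x => complex.Re ((a +i* b)%C * f x)) =
    (fun x => a * complex.Re (f x) - b * complex.Im (f x)).
  by apply/funext => x; case: (f x).
have -> : (fun x => complex.Im ((a +i* b)%C * f x)) =
    (fun x => a * complex.Im (f x) + b * complex.Re (f x)).
  by apply/funext => x; case: (f x).
have iZ c (h : T -> R) : mu.-integrable setT (fun x => (h x)%:E) ->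
    mu.-integrable setT (EFin \o (fun x => c * h x)).
  by move=> ih; exact: (integrableZl measurableT c ih).
rewrite RintegralB//; try exact: iZ.
rewrite RintegralD//; try exact: iZ.
by rewrite !RintegralZl.
Qed.

Lemma cintegral_sum (I : Type) (r : seq I) (f : I -> T -> R[i]) :
  (forall i, cintegrable (f i)) ->
  cintegral mu (fun x => \sum_(i <- r) f i x) = \sum_(i <- r) cintegral mu (f i).
Proof.
move=> If; elim: r => [|i r IH].
  under [X in cintegral _ X]eq_fun do rewrite big_nil.
  by rewrite big_nil /cintegral /= /Rintegral !integral0.
under [X in cintegral _ X]eq_fun do rewrite big_cons.
by rewrite cintegralD ?IH ?big_cons//; exact: cintegrable_sum.
Qed.

Lemma cintegral_conj f : cintegrable f ->
  cintegral mu (fun x => (f x)^*) = (cintegral mu f)^*.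
Proof.
move=> [fr fi]; rewrite /cintegral.
have -> : (fun x => complex.Re (f x)^*) = (fun x => complex.Re (f x)).
  by apply/funext => x; rewrite cRe_conj.
have -> : (fun x => complex.Im (f x)^*) = (fun x => -1 * complex.Im (f x)).
  by apply/funext => x; rewrite cIm_conj mulN1r.
rewrite RintegralZl// mulN1r; apply/eqP.
by rewrite eq_complex cRe_conj cIm_conj /= !eqxx.
Qed.

Lemma cintegral_ge0 f : (forall x, 0 <= f x) -> 0 <= cintegral mu f.
Proof.
move=> f0; rewrite lecE /= /cintegral; apply/andP; split.
  have -> : (fun x => complex.Im (f x)) = cst 0.
    by apply/funext => x; rewrite (ge0_cRe (f0 x)).
  by rewrite /Rintegral integral0.
by apply: Rintegral_ge0 => x _; exact: cRe_ge0.
Qed.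

(** Real and imaginary parts are bounded separately, whence the factor 2. *)
Lemma cmod_cintegral_le f (g : T -> R) : cmeasurable f ->
  mu.-integrable setT (fun x => (g x)%:E) -> (forall x, cmod (f x) <= g x) ->
  cmod (cintegral mu f) <= 2 * Rintegral mu setT g.
Proof.
move=> mf ig fg; have [ir ii] := cintegrable_le mf ig fg.
apply: le_trans (cmod_le_ReIm _) _; rewrite mulr_natl mulr2n; apply: lerD.
  apply: le_trans (le_normr_Rintegral _ ir) _ => //.
  apply: le_Rintegral => //; first exact: integrable_norm.
  by move=> x _; exact: le_trans (normcRe_le _) (fg x).
apply: le_trans (le_normr_Rintegral _ ii) _ => //.
apply: le_Rintegral => //; first exact: integrable_norm.
by move=> x _; exact: le_trans (normcIm_le _) (fg x).
Qed.

Lemma ae_eq_cintegral f g : cmeasurable f -> cmeasurable g ->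
  {ae mu, forall x, f x = g x} -> cintegral mu f = cintegral mu g.
Proof.
move=> [fr fi] [gr gi] fg; rewrite /cintegral /Rintegral.
congr (fine _ +i* fine _)%C; apply: ae_eq_integral => //;
  by [exact/measurable_EFinP|apply: filterS fg => x fgx _ /=; rewrite fgx].
Qed.

End complex_integral.

Section increments.
Variable R : realType.

Lemma cvg_increments (u g : nat -> R) : (forall k, `|u k.+1 - u k| <= g k) ->
  cvgn (series g) -> cvgn u.
Proof.
move=> ug cg; have -> : u = (fun n => u 0%N + series (telescope u) n).
  by apply/funext => n; rewrite -eq_sum_telescope.
apply: is_cvgD; first exact: is_cvg_cst.
apply: normed_cvg; apply: series_le_cvg cg => // k; first by rewrite normr_ge0.
exact: le_trans (normr_ge0 _) (ug k).
Qed.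

Lemma cvg_complex_increments (u : nat -> R[i]) (g : nat -> R) :
  (forall k, cmod (u k.+1 - u k) <= g k) -> cvgn (series g) ->
  exists l : R[i], u @ \oo --> l.
Proof.
move=> ug cg.
have /cvg_ex[a ar] : cvgn (fun k => complex.Re (u k)).
  apply: cvg_increments cg => k; rewrite -raddfB.
  exact: le_trans (normcRe_le _) (ug k).
have /cvg_ex[b bi] : cvgn (fun k => complex.Im (u k)).
  apply: cvg_increments cg => k; rewrite -raddfB.
  exact: le_trans (normcIm_le _) (ug k).
by exists (a +i* b)%C; apply: cvg_complex.
Qed.

Lemma limn_einf_le (u : nat -> \bar R) (c : \bar R) :
  (forall k, (u k <= c)%E) -> (limn_einf u <= c)%E.
Proof.
move=> uc; rewrite limn_einf_lim; apply: lime_le; first exact: is_cvg_einfs.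
apply: nearW => k; apply: le_trans (uc k); apply: ereal_inf_lbound.
by exists k => /=.
Qed.

Lemma sum_geo_le m : \sum_(0 <= k < m) (2^-1 : R) ^+ k <= 2.
Proof.
suff -> : \sum_(0 <= k < m) (2^-1 : R) ^+ k = 2 - 2 * 2^-1 ^+ m.
  by rewrite gerBl mulr_ge0//; exact/ltW/geo_gt0.
elim: m => [|m IH]; first by rewrite big_nil expr0 mulr1 subrr.
by rewrite big_nat_recr//= IH exprS mulrA mulfV// mul1r; ring.
Qed.

End increments.

(** * Vector functions square-integrable against a positive matrix weight *)

Section weighted_L2.
Context d (T : measurableType d) (R : realType) (n : nat).
Variables (mu : {finite_measure set T -> \bar R}) (W : T -> 'M[R[i]]_n).
Hypothesis mW : mxmeasurable W.
Hypothesis W0 : forall x, psd (W x).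
Hypothesis W1 : forall x, complex.Re (\tr (W x)) <= 1.
Implicit Types (f g : T -> 'cV[R[i]]_n).

Definition wquad f (x : T) : R := complex.Re (mxform (W x) (f x) (f x)).

Definition wL2 : set (T -> 'cV[R[i]]_n) := [set f : T -> 'cV[R[i]]_n |
  mxmeasurable f /\ mu.-integrable setT (fun x => (wquad f x)%:E)].

Definition wdot f g := cintegral mu (fun x => mxform (W x) (f x) (g x)).

Lemma wquad_ge0 f x : 0 <= wquad f x.
Proof. by apply: cRe_ge0; exact: W0. Qed.

Lemma wquad_nrm f x : wquad f x = nrm (mxform (W x)) (f x) ^+ 2.
Proof. by rewrite (sqr_nrm (mxform_sip (W0 x))). Qed.

Lemma cmeasurable_mxform f g : mxmeasurable f -> mxmeasurable g ->
  cmeasurable (fun x => mxform (W x) (f x) (g x)).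
Proof. by move=> mf mg; apply: cmeasurable_cdot => //; exact: mxmeasurable_mul. Qed.

Lemma measurable_wquad f : mxmeasurable f -> measurable_fun setT (wquad f).
Proof. by move=> mf; have [] := cmeasurable_mxform mf mf. Qed.

Lemma wL2_integrable f g : wL2 f -> wL2 g ->
  cintegrable mu (fun x => mxform (W x) (f x) (g x)).
Proof.
move=> [mf qf] [mg qg]; apply: (cintegrable_le (g := fun x => wquad f x + wquad g x)).
- exact: cmeasurable_mxform.
- by under eq_fun do rewrite EFinD; exact: integrableD.
- move=> x; apply: le_trans (cauchy_schwarz (mxform_sip (W0 x)) _ _) _ => //.
  rewrite !wquad_nrm; have := sqr_ge0 (nrm (mxform (W x)) (f x) - nrm (mxform (W x)) (g x)).
  have := sqr_ge0 (nrm (mxform (W x)) (f x)); have := sqr_ge0 (nrm (mxform (W x)) (g x)).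
  by rewrite sqrrB; lra.
Qed.

Lemma integrable_le_ge0 (h k : T -> R) : measurable_fun setT h ->
  (forall x, 0 <= h x <= k x) -> mu.-integrable setT (fun x => (k x)%:E) ->
  mu.-integrable setT (fun x => (h x)%:E).
Proof.
move=> mh hk; apply: le_integrable => //; first exact/measurable_EFinP.
move=> x _; have /andP[h0 hkx] := hk x.
by rewrite lee_fin !ger0_norm// (le_trans h0 hkx).
Qed.

Lemma wL2ZD (a : R[i]) f g : wL2 f -> wL2 g -> wL2 (a *: f + g).
Proof.
move=> [mf qf] [mg qg].
have mfg : mxmeasurable (a *: f + g).
  by apply: mxmeasurableD => //; apply: mxmeasurableZ => //; exact: cmeasurable_cst.
split=> //.
apply: (integrable_le_ge0 (k := fun x => (2 * cmod a ^+ 2) * wquad f x + 2 * wquad g x)).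
- exact: measurable_wquad.
- move=> x; rewrite wquad_ge0 !wquad_nrm /=; have S := mxform_sip (W0 x).
  have := nrmD S (u := a *: f x) (v := g x) I I; rewrite (nrmZ S)//.
  set A := nrm _ (f x); set B := nrm _ (g x) => h.
  have AB : 0 <= cmod a * A + B by rewrite addr_ge0 ?mulr_ge0 ?cmod_ge0 ?nrm_ge0.
  rewrite -(@ler_pXn2r _ 2) ?nnegrE ?nrm_ge0// in h; apply: le_trans h _.
  by have := sqr_ge0 (cmod a * A - B); rewrite sqrrB sqrrD exprMn; lra.
- have e : (fun x => ((2 * cmod a ^+ 2) * wquad f x + 2 * wquad g x)%:E) =
    (fun x => (2 * cmod a ^+ 2)%:E * (wquad f x)%:E + 2%:E * (wquad g x)%:E)%E by [].
  by rewrite e; apply: integrableD => //; exact: integrableZl.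
Qed.

Lemma wL2_bounded f (C : R) : mxmeasurable f -> (forall x i, cmod (f x i 0) <= C) ->
  (forall x, wquad f x <= (n%:R * C) ^+ 2) /\ wL2 f.
Proof.
move=> mf fC; suff q x : wquad f x <= (n%:R * C) ^+ 2.
  split=> //; split=> //.
  apply: (integrable_le_ge0 (k := fun=> (n%:R * C) ^+ 2)).
  - exact: measurable_wquad.
  - by move=> x; rewrite wquad_ge0 q.
  - exact: finite_measure_integrable_cst.
rewrite wquad_nrm; have S := mxform_sip (W0 x).
have C0 : 0 <= n%:R * C.
  (* For [n = 0] the bound on the entries is void and [C] may be negative. *)
  case: (posnP n) => [n0|n0]; first by rewrite n0 mul0r.
  by apply: mulr_ge0 => //; exact: le_trans (cmod_ge0 _) (fC x (Ordinal n0)).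
rewrite ler_pXn2r ?nnegrE ?nrm_ge0//.
have -> : f x = \sum_i f x i 0 *: delta_mx i 0.
  by rewrite [LHS]matrix_sum_delta; apply: eq_bigr => i _; rewrite big_ord1.
have -> : n%:R * C = \sum_(i < n) C by rewrite sumr_const card_ord mulr_natl.
elim/big_ind2: _ => [|u a v b ua vb|i _].
- by rewrite /nrm (dot0l S) //= sqrtr0.
- by apply: le_trans (nrmD S _ _) (lerD ua vb).
- rewrite (nrmZ S)// -[C]mulr1; apply: ler_pM; rewrite ?cmod_ge0 ?nrm_ge0//.
  by apply: le_trans (nrm_mxform_delta (W0 x) i) _; rewrite -sqrtr1 ler_wsqrtr.
Qed.

Lemma wdot_sip : semi_inner_product wL2 wdot.
Proof.
split.
- by have [|x i|_ //] := @wL2_bounded 0 0; [exact: mxmeasurable_cst|rewrite mxE cmod0].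
- exact: wL2ZD.
- move=> a f g h Lf Lg Lh; rewrite /wdot -cintegralZ; last exact: wL2_integrable.
  rewrite -cintegralD//; first by congr cintegral; apply/funext => x;
    rewrite (sip_linear (mxform_sip (W0 x))).
  + by apply: cintegrableZ; exact: wL2_integrable.
  + exact: wL2_integrable.
- move=> f g Lf Lg; rewrite /wdot -cintegral_conj; last exact: wL2_integrable.
  by congr cintegral; apply/funext => x; rewrite (sipC (mxform_sip (W0 x))).
- by move=> f Lf; apply: cintegral_ge0 => x; exact: W0.
Qed.

Lemma sqr_nrm_wdot f : wL2 f ->
  (nrm wdot f ^+ 2)%:E = (\int[mu]_x (wquad f x)%:E)%E.
Proof.
move=> Lf; rewrite (sqr_nrm wdot_sip)// /wdot /= /Rintegral fineK//.
by apply: integrable_fin_num => //; case: Lf.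
Qed.

Lemma nrm_wdot_bounded f (C : R) : mxmeasurable f -> 0 <= C ->
  (forall x i, cmod (f x i 0) <= C) ->
  nrm wdot f <= C * (n%:R * Num.sqrt (fine (mu setT))).
Proof.
move=> mf C0 fC; have [q Lf] := wL2_bounded mf fC.
have m0 : 0 <= fine (mu setT) by apply: fine_ge0.
rewrite -ler_sqr ?nnegrE ?nrm_ge0 ?mulr_ge0 ?sqrtr_ge0// -lee_fin sqr_nrm_wdot//.
apply: (@le_trans _ _ (\int[mu]_x ((n%:R * C) ^+ 2)%:E)%E).
  apply: ge0_le_integral => //.
  - by move=> x _; rewrite lee_fin wquad_ge0.
  - by apply/measurable_EFinP; apply: measurable_wquad; case: Lf.
  - by move=> x _; rewrite lee_fin q.
rewrite integral_cst//.
rewrite [X in (_ * X)%E](_ : _ = (fine (mu setT))%:E); last first.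
    by rewrite fineK// fin_num_measure.
rewrite -EFinM lee_fin.
by rewrite !exprMn sqr_sqrtr// mulrA [C ^+ 2 * _]mulrC.
Qed.

Lemma wL2Z (a : T -> R[i]) f (C : R) : cmeasurable a -> (forall x, cmod (a x) <= C) ->
  wL2 f -> wL2 (fun x => a x *: f x).
Proof.
move=> ma aC [mf qf]; have mg := mxmeasurableZ ma mf; split=> //.
apply: (integrable_le_ge0 (k := fun x => C ^+ 2 * wquad f x)).
- exact: measurable_wquad.
- move=> x; rewrite wquad_ge0 !wquad_nrm (nrmZ (mxform_sip (W0 x)))// exprMn.
  rewrite ler_wpM2r ?sqr_ge0//= ler_pXn2r ?nnegrE ?cmod_ge0//.
  exact: le_trans (cmod_ge0 _) (aC x).
- exact: (integrableZl measurableT (C ^+ 2) qf).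
Qed.

Lemma wL2_delta i : wL2 (fun=> delta_mx i 0).
Proof.
have [|x j|_ //] := @wL2_bounded (fun=> delta_mx i 0) 1; first exact: mxmeasurable_cst.
by rewrite mxE; case: (_ && _); rewrite /= ?cmod1 ?cmod0 ?ler01.
Qed.

(** Entries of [W f] are integrable although those of [f] need not be: each is the form of [W]
    evaluated at [f] and a basis vector. *)
Lemma wL2_row_integrable (a : T -> R[i]) f (C : R) i :
  cmeasurable a -> (forall x, cmod (a x) <= C) -> wL2 f ->
  cintegrable mu (fun x => a x * (W x *m f x) i 0).
Proof.
move=> ma aC Lf.
have -> : (fun x => a x * (W x *m f x) i 0) =
    (fun x => mxform (W x) (a x *: f x) (delta_mx i 0)).
  by apply/funext => x; rewrite (dotZl (mxform_sip (W0 x)))// /mxform cdot_delta.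
by apply: wL2_integrable; [exact: wL2Z aC Lf|exact: wL2_delta].
Qed.

Lemma measurable_nrm_wquad f : mxmeasurable f ->
  measurable_fun setT (fun x => nrm (mxform (W x)) (f x)).
Proof.
move=> mf; apply: (measurableT_comp (f := @Num.sqrt R)); last exact: measurable_wquad.
by apply: continuous_measurable_fun; exact: sqrt_continuous.
Qed.

(** The Riesz-Fischer step: the sum of the pointwise seminorms has integral at most [2 c], so it is
    finite off a null set. *)
Lemma rapid_ae_summable (f : nat -> T -> 'cV[R[i]]_n) : (forall k, wL2 (f k)) ->
  (forall k, nrm wdot (f k) <= 2^-1 ^+ k) ->
  exists A, [/\ measurable A, mu (~` A) = 0 &
    forall x, A x -> cvgn (series (fun k => nrm (mxform (W x)) (f k x)))].
Proof.
move=> Lf rf; pose g k x := (nrm (mxform (W x)) (f k x))%:E.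
have g0 k x : (0 <= g k x)%E by rewrite lee_fin nrm_ge0.
have mg k : measurable_fun setT (g k).
  by apply/measurable_EFinP; apply: measurable_nrm_wquad; case: (Lf k).
pose S x := (\sum_(0 <= k <oo | k \in xpredT) g k x)%E.
have mS : measurable_fun setT S by apply: ge0_emeasurable_sum => // k _.
pose c := 1 + fine (mu setT).
have c0 : 0 <= c by rewrite addr_ge0// fine_ge0.
(* AM-GM : [g k <= 2^k (g k)^2 + 2^-k] *)
have ig k : (\int[mu]_x g k x <= (c * 2^-1 ^+ k)%:E)%E.
  have gk0 := geo_gt0 R k; have [mfk qfk] := Lf k.
  apply: (@le_trans _ _ (\int[mu]_x ((2 ^+ k)%:E * (wquad (f k) x)%:E + (2^-1 ^+ k)%:E))%E).
    apply: ge0_le_integral => //.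
    - apply: emeasurable_funD; last exact: measurable_cst.
      by apply/measurable_EFinP; apply: measurable_funM;
        [exact: measurable_cst|exact: measurable_wquad].
    - move=> x _; rewrite /g -EFinM -EFinD lee_fin wquad_nrm; set a := nrm _ _.
      have e1 : 2 ^+ k * 2^-1 ^+ k = 1 :> R by rewrite -exprMn mulfV// expr1n.
      have k2 : 0 < 2 ^+ k :> R by rewrite exprn_gt0.
      rewrite -(ler_pM2l k2) mulrDr e1 mulrA -expr2 -exprMn.
      have := sqr_ge0 (2 ^+ k * a - 1); have := sqr_ge0 (2 ^+ k * a).
      by rewrite sqrrB expr1n mulr1 -mulr_natr; lra.
  rewrite integralD//; last 2 first.
  - exact: integrableZl.
  - exact: finite_measure_integrable_cst.
  rewrite integralZl// -sqr_nrm_wdot// integral_cst//.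
  rewrite [X in (_ + _ * X)%E](_ : _ = (fine (mu setT))%:E); last by rewrite fineK// fin_num_measure.
  rewrite -!EFinM -EFinD lee_fin.
  rewrite mulrDl mul1r; apply: lerD; last by rewrite mulrC.
  have h : nrm wdot (f k) ^+ 2 <= (2^-1 ^+ k) ^+ 2.
    by rewrite ler_pXn2r ?nnegrE ?nrm_ge0 ?(ltW gk0).
  apply: le_trans (ler_wpM2l _ h) _; first exact: exprn_ge0.
  by rewrite expr2 mulrA -exprMn mulfV// expr1n mul1r.
have iS : (\int[mu]_x S x < +oo)%E.
  rewrite /S integral_nneseries//.
  apply: (@le_lt_trans _ _ (c * 2)%:E); last exact: ltry.
  apply: lime_le.
    by apply: is_cvg_nneseries => k _ _; apply: integral_ge0.
  apply: nearW => m; apply: (@le_trans _ _ (\sum_(0 <= k < m) (c * 2^-1 ^+ k)%:E)%E).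
    by rewrite big_mkcond [leRHS]big_mkcond; apply: lee_sum => k _; exact: ig.
  rewrite sumEFin lee_fin -mulr_sumr ler_wpM2l//.
  exact: sum_geo_le.
have S0 x : (0 <= S x)%E by apply: nneseries_ge0.
have intS : mu.-integrable setT S.
  apply/integrableP; split=> //.
  by under eq_integral do rewrite gee0_abs//.
pose A := setT `&` [set x | S x \is a fin_num].
have mA : measurable A by exact: emeasurable_fin_num.
exists A; split=> //.
  have := integrable_ae measurableT intS => -[N [mN N0 NA]].
  apply: (subset_measure0 _ mN _ N0); first exact: measurableC.
  by move=> x nAx; apply: NA => /= h; apply: nAx; split=> //; exact: h.
move=> x [_ fS]; apply: nondecreasing_is_cvgn.
  apply/nondecreasing_seqP => k; rewrite /series /= big_nat_recr//= lerDl.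
  exact: nrm_ge0.
exists (fine (S x)) => _ [m _ <-]; rewrite -lee_fin fineK// /series /= -sumEFin.
have := @nneseries_lim_ge _ (fun k => g k x) xpredT 0%N m.
by apply => k _ _; exact: g0.
Qed.

(* Only [W f_k] converges pointwise a.e.; its limit [h] lies in the range of [W],
   and the limit function is the measurable choice [lim (W + 1/m)^-1 h]. *)
Lemma wL2_complete : complete wL2 wdot.
Proof.
move=> f Lf rf; have S := wdot_sip.
pose df k := f k.+1 - f k.
have Ldf k : wL2 (df k) by exact: (sipB S).
have [A [mA A0 cA]] := rapid_ae_summable Ldf rf.
(* The choice is made point by point. Its second clause makes [p] measurable after the fact: it
   expresses [p] as a limit computed from [W p], and [W p] is itself a limit of the [W f_k]. Off [A]
   the value 0 keeps both facts true. *)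
have /choice[p pP] : forall x, exists p : 'cV[R[i]]_n,
    (A x -> (forall i, (fun k => (W x *m f k x) i 0) @ \oo --> (W x *m p) i 0) /\
       forall i, (fun m => (psd_inv (W x) m *m (W x *m p)) i 0) @ \oo --> p i 0) /\
    (~ A x -> p = 0).
  move=> x; have [Ax|nAx] := pselect (A x); last by exists 0; split.
  have /choice[h hP] : forall i, exists l : R[i], (fun k => (W x *m f k x) i 0) @ \oo --> l.
    move=> i; apply: cvg_complex_increments (cA x Ax) => k.
    have -> : (W x *m f k.+1 x) i 0 - (W x *m f k x) i 0 = (W x *m df k x) i 0.
      by rewrite /df /= [in RHS]/GRing.add /= mulmxBr !mxE.
    apply: le_trans (psd_mulmx_le (W0 x) _ _) _.
    rewrite -[leRHS]mulr1 ler_wpM2l ?nrm_ge0// -sqrtr1.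
    by rewrite ler_wsqrtr.
  have [y hy] : exists y, (\col_i h i) = W x *m y.
    by apply: (@cvg_mulmx_range _ _ (W x) (fun k => f k x)) => i; rewrite mxE; exact: hP.
  have [p Wp pP] := cvg_psd_reg (W0 x) y.
  exists p; split; last by move=> /(_ Ax).
  move=> _; split=> i; last by rewrite Wp; exact: pP.
  by rewrite Wp -hy mxE; exact: hP.
(* Cutting [W f_k] down to [A] turns almost everywhere convergence into convergence at every
   point. *)
pose chi x : R[i] := ((\1_A x : R)%:C)%C.
have mchi : cmeasurable chi.
  by apply: cmeasurable_real; exact: measurable_indic.
have chiA x : A x -> chi x = 1 by move=> Ax; rewrite /chi indicE mem_set.
have chiNA x : ~ A x -> chi x = 0 by move=> nAx; rewrite /chi indicE memNset.
have mWp : mxmeasurable (fun x => W x *m p x).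
  move=> i j; rewrite ord1.
  apply: (cmeasurable_cvg (h := fun k x => chi x * (W x *m f k x) i 0)).
    move=> k; apply: cmeasurableM => //.
    by apply: (mxmeasurable_mul mW); case: (Lf k).
  move=> x; have [pA pN] := pP x; have [Ax|nAx] := pselect (A x).
    rewrite chiA//; under eq_fun do rewrite mul1r.
    by case: (pA Ax) => + _; exact.
  rewrite pN// mulmx0 mxE chiNA//; under eq_fun do rewrite mul0r.
  exact: cvg_cst.
have mp : mxmeasurable p.
  move=> i j; rewrite ord1.
  apply: (cmeasurable_cvg (h := fun m x => (psd_inv (W x) m *m (W x *m p x)) i 0)).
    move=> m; apply: mxmeasurable_mul => //.
    apply: mxmeasurable_inv; first by move=> x; exact: psd_reg_unit.
    by apply: mxmeasurableD => //; exact: mxmeasurable_cst.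
  move=> x; have [pA pN] := pP x; have [Ax|nAx] := pselect (A x).
    by case: (pA Ax) => _; exact.
  rewrite pN// mulmx0; under eq_fun do rewrite mulmx0 mxE.
  by rewrite mxE; exact: cvg_cst.
(* Fatou's lemma applied to [f k - f (k + j)] as [j] grows; the pointwise limit is the quadratic
   form at [f k - p] by [cvg_mxform_quad]. *)
have bound k : (\int[mu]_x (wquad (f k - p) x)%:E <= ((2 * 2^-1 ^+ k) ^+ 2)%:E)%E.
  have mq : measurable_fun setT (fun x => (wquad (f k - p) x)%:E).
    apply/measurable_EFinP; apply: measurable_wquad => i j.
    have -> : (fun x => (f k - p) x i j) = (fun x => f k x i j - p x i j).
      by apply/funext => x; rewrite /GRing.add /= /GRing.opp /= !mxE.
    by apply: cmeasurableB; [case: (Lf k) => + _; exact|exact: mp].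
  rewrite (@ge0_negligible_integral _ _ _ mu setT (~` A))//; last 2 first.
  - exact: measurableC.
  - by move=> x _; rewrite lee_fin wquad_ge0.
  rewrite setTD setCK.
  pose F j x := (wquad (f k - f (k + j)%N) x)%:E.
  have Lfk j : wL2 (f k - f (k + j)%N) by exact: (sipB S).
  have mF j : measurable_fun setT (F j).
    by apply/measurable_EFinP; apply: measurable_wquad; case: (Lfk j).
  have -> : (\int[mu]_(x in A) (wquad (f k - p) x)%:E =
      \int[mu]_(x in A) limn_einf (F ^~ x))%E.
    apply: eq_integral => x /set_mem Ax; apply/esym.
    suff Fl : F ^~ x @ \oo --> (wquad (f k - p) x)%:E.
      by have [-> _] := cvg_limn_einf_sup Fl.
    apply: cvg_EFin; first exact: nearW.
    have [/(_ Ax)[WP _] _] := pP x.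
    have sh : (fun j => f (k + j)%N x) = (fun j => f (j + k)%N x).
      by apply/funext => j; rewrite addnC.
    apply: cvg_cRe; rewrite [X in X @ _](_ : _ =
      fun j => mxform (W x) (f k x - f (j + k)%N x) (f k x - f (j + k)%N x)); last first.
      by apply/funext => j; rewrite addnC.
    have := @cvg_mxform_quad _ _ _ (W0 x) (fun j => f (j + k)%N x) (p x) (f k x).
    apply => i; have := WP i; rewrite -(cvg_shiftn k) => h; exact: h.
  apply: le_trans (fatou _ mA _ _) _.
  - by move=> j; exact: measurable_funTS.
  - by move=> j x _; rewrite lee_fin wquad_ge0.
  apply: limn_einf_le => j.
  apply: le_trans (ge0_subset_integral _ mA measurableT (mF j) _ _) _ => //.
    by move=> x _; rewrite lee_fin wquad_ge0.
  rewrite -sqr_nrm_wdot// lee_fin ler_pXn2r ?nnegrE ?nrm_ge0//.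
  by rewrite (nrm_distC S)//; exact: (rapid_dist S).
have Lfp k : wL2 (f k - p).
  have m : mxmeasurable (f k - p).
    move=> i j; have -> : (fun x => (f k - p) x i j) = (fun x => f k x i j - p x i j).
      by apply/funext => x; rewrite /GRing.add /= /GRing.opp /= !mxE.
    by apply: cmeasurableB; [case: (Lf k) => + _; exact|exact: mp].
  split=> //; apply/integrableP; split.
    by apply/measurable_EFinP; exact: measurable_wquad.
  under eq_integral => x _ do rewrite gee0_abs ?lee_fin ?wquad_ge0//.
  by apply: le_lt_trans (bound k) _; exact: ltry.
exists p.
  by have -> : p = f 0%N - (f 0%N - p); [rewrite opprB addrC subrK|exact: (sipB S)].
move=> k; rewrite -ler_sqr ?nnegrE ?nrm_ge0//.
by rewrite -lee_fin sqr_nrm_wdot.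
Qed.

End weighted_L2.

(** * Positivity of the Radon-Nikodym density of a matrix measure *)

Section rational_vectors.
Variables (R : realType) (n : nat).

(** A dense family with countable index type: statements true almost everywhere for each vector of
    it hold simultaneously off one null set. *)
Definition ratvec (q : 'cV[rat * rat]_n) : 'cV[R[i]]_n :=
  \col_i (ratr (q i 0).1 +i* ratr (q i 0).2)%C.

Lemma ratvec_dense (x : 'cV[R[i]]_n) : exists q : nat -> 'cV[rat * rat]_n,
  forall i, (fun k => ratvec (q k) i 0) @ \oo --> x i 0.
Proof.
have approx (r : R) k : exists a : rat, `|ratr a - r| <= 2^-1 ^+ k.
  have [a] : exists a : rat, ratr a \in `](r - 2^-1 ^+ k), (r + 2^-1 ^+ k)[%R.
    by apply: rat_in_itvoo; have := geo_gt0 R k; lra.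
  by rewrite in_itv /= => /andP[a1 a2]; exists a; rewrite ler_norml; lra.
have /choice[q qP] : forall k, exists q : 'cV[rat * rat]_n,
    forall i, cmod (ratvec q i 0 - x i 0) <= 2 * 2^-1 ^+ k.
  move=> k; have /choice[q qP] : forall i, exists q : rat * rat,
      cmod ((ratr q.1 +i* ratr q.2)%C - x i 0) <= 2 * 2^-1 ^+ k.
    move=> i; have [a aP] := approx (complex.Re (x i 0)) k.
    have [b bP] := approx (complex.Im (x i 0)) k; exists (a, b).
    apply: le_trans (cmod_le_ReIm _) _; rewrite !raddfB /=.
    by rewrite mulr_natl mulr2n; exact: lerD.
  by exists (\col_i q i) => i; rewrite !mxE; exact: qP.
by exists q => i; apply: cvg_le_geo => k; exact: qP.
Qed.

Lemma psd_ratvec (A : 'M[R[i]]_n) :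
  (forall q, 0 <= cdot (A *m ratvec q) (ratvec q)) -> psd A.
Proof.
move=> A0 x; have [q qx] := ratvec_dense x.
have lim : (fun k => cdot (A *m ratvec (q k)) (ratvec (q k))) @ \oo --> cdot (A *m x) x.
  by apply: cvg_cdot => i; [exact: cvg_mulmx|exact: qx].
rewrite lecE /=; apply/andP; split.
  have := cvg_cIm lim; under eq_fun do rewrite (ge0_cRe (A0 _)) /=.
  by move/cvg_lim => <- //; rewrite lim_cst.
have := cvg_cRe lim => /cvg_lim <- //; apply: limr_ge.
  by apply/cvg_ex; eexists; exact: (cvg_cRe lim).
by apply: nearW => k; exact/cRe_ge0/A0.
Qed.

End rational_vectors.

Section density.
Context d (T : measurableType d) (R : realType) (n : nat).
Variable Omega : psd_measure T R n.
Let mu := trace_measure Omega.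
Let D := density Omega.

Let chi (A : set T) (x : T) : R[i] := ((\1_A x : R)%:C)%C.

Let Omega0 A : mu A = 0%E -> Omega A = 0.
Proof. by move=> [A0]; apply: psd_tr0 => //; exact: psdm_ge0. Qed.

Lemma re_entry_dominated i j : re_entry Omega i j `<< mu.
Proof.
by apply/null_content_dominatesP => A mA A0; rewrite /re_entry (Omega0 A0) mxE.
Qed.

Lemma im_entry_dominated i j : im_entry Omega i j `<< mu.
Proof.
by apply/null_content_dominatesP => A mA A0; rewrite /im_entry (Omega0 A0) mxE.
Qed.

(** A Radon-Nikodym derivative takes extended values but is finite almost everywhere, so the [fine]
    in [density] changes no integral. *)
Lemma fine_Radon_Nikodym (nu : {charge set T -> \bar R}) : nu `<< mu ->
  mu.-integrable setT (fun x => (fine (Radon_Nikodym nu mu x))%:E) /\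
  forall A, measurable A ->
    (\int[mu]_(x in A) (fine (Radon_Nikodym nu mu x))%:E = nu A)%E.
Proof.
move=> numu; have irn := Radon_Nikodym_integrable numu.
have mrn := measurable_int _ irn.
have mf : measurable_fun setT (fun x => (fine (Radon_Nikodym nu mu x))%:E).
  by apply/measurable_EFinP; apply: measurableT_comp mrn; exact: fine_measurable.
have ae : ae_eq mu setT (fun x => (fine (Radon_Nikodym nu mu x))%:E) (Radon_Nikodym nu mu).
  have := integrable_ae measurableT irn; apply: filterS => x /(_ I) fx _.
  by rewrite fineK.
split.
  apply/integrableP; split=> //; have /integrableP[_] := irn.
  congr (_ < _)%E; apply/esym; apply: ae_eq_integral => //.
  - exact: measurableT_comp.
  - exact: measurableT_comp.
  - exact: ae_eq_abse.
move=> A mA; rewrite (Radon_Nikodym_integral numu)//.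
apply: ae_eq_integral => //; try exact: measurable_funTS.
exact: ae_eq_subset ae.
Qed.

Lemma density_integrable i j : cintegrable mu (fun x => D x i j).
Proof.
split.
  under eq_fun do rewrite mxE /=.
  by case: (fine_Radon_Nikodym (re_entry_dominated i j)).
under eq_fun do rewrite mxE /=.
by case: (fine_Radon_Nikodym (im_entry_dominated i j)).
Qed.

Lemma mxmeasurable_density : mxmeasurable D.
Proof. by move=> i j; exact: cintegrable_measurable (density_integrable i j). Qed.

Let chi_re A (z : T -> R[i]) :
  (fun x => complex.Re (chi A x * z x)) = (fun x => complex.Re (z x)) \_ A.
Proof.
apply/funext => x; rewrite /chi cRe_realM patchE indicE.
by case: (x \in A); rewrite ?mul1r ?mul0r.
Qed.

Let chi_im A (z : T -> R[i]) :
  (fun x => complex.Im (chi A x * z x)) = (fun x => complex.Im (z x)) \_ A.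
Proof.
apply/funext => x; rewrite /chi cIm_realM patchE indicE.
by case: (x \in A); rewrite ?mul1r ?mul0r.
Qed.

Let chi_integrable A (f : T -> R[i]) : measurable A -> cintegrable mu f ->
  cintegrable mu (fun x => chi A x * f x).
Proof.
move=> mA If; have [ir ii] := If.
apply: (cintegrable_le (g := fun x => `|complex.Re (f x)| + `|complex.Im (f x)|)).
- apply: cmeasurableM; last exact: cintegrable_measurable If.
  by apply: cmeasurable_real; exact: measurable_indic.
- under eq_fun do rewrite EFinD.
  by apply: integrableD => //; exact: integrable_norm.
- move=> x; apply: le_trans (cmod_le_ReIm (f x)).
  rewrite cmodM -[leRHS]mul1r ler_wpM2r ?cmod_ge0//.
  by rewrite /chi cmod_real indicE; case: (x \in A); rewrite ?normr1 ?normr0.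
Qed.

Lemma cintegral_density A i j : measurable A ->
  cintegral mu (fun x => chi A x * D x i j) = Omega A i j.
Proof.
move=> mA; rewrite /cintegral chi_re chi_im -!Rintegral_mkcond /Rintegral.
under eq_integral do rewrite mxE /=.
under [X in (_ +i* fine X)%C]eq_integral do rewrite mxE /=.
have [_ ->//] := fine_Radon_Nikodym (re_entry_dominated i j).
have [_ ->//] := fine_Radon_Nikodym (im_entry_dominated i j).
by rewrite /re_entry /im_entry /=; case: (Omega A i j).
Qed.

Let cintegral_chi A (b : R[i]) : measurable A ->
  cintegral mu (fun x => chi A x * b) = b * (fine (mu A))%:C%C.
Proof.
move=> mA; rewrite /cintegral chi_re chi_im -!Rintegral_mkcond !Rintegral_cst//.
case: b => b1 b2; apply/eqP; rewrite eq_complex.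
by apply/andP; split; apply/eqP; rewrite /=; ring.
Qed.

(* A condition [0 <= b mu(A) + Re (linear form of Omega(A))] valid for every
   [A] localizes to the densities. *)
Lemma density_functional_ge0 (b : R) (c : 'I_n -> 'I_n -> R[i]) :
  (forall A, measurable A ->
    0 <= b * fine (mu A) + complex.Re (\sum_i \sum_j c i j * Omega A i j)) ->
  {ae mu, forall x, 0 <= b + complex.Re (\sum_i \sum_j c i j * D x i j)}.
Proof.
move=> pos; pose h x : R[i] := b%:C%C + \sum_i \sum_j c i j * D x i j.
have Is : cintegrable mu (fun x => \sum_i \sum_j c i j * D x i j).
  apply: cintegrable_sum => i; apply: cintegrable_sum => j.
  by apply: cintegrableZ; exact: density_integrable.
have Ib : cintegrable mu (fun=> b%:C%C).
  by split=> /=; exact: finite_measure_integrable_cst.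
have Ih : cintegrable mu h by exact: cintegrableD.
have mh : measurable_fun setT (fun x => complex.Re (h x)).
  by case: (cintegrable_measurable Ih).
(* Over the set where the claim fails the integral is nonpositive by definition and nonnegative by
   hypothesis, so the integrand vanishes almost everywhere there. *)
pose A := [set x | complex.Re (h x) < 0].
have mA : measurable A.
  have := mh measurableT `]-oo, 0[%classic (measurable_itv _).
  rewrite setTI; congr measurable; apply/seteqP; split=> x /=; rewrite /A /= in_itv//.
have [iA _] := chi_integrable mA Ih.
have e : cintegral mu (fun x => chi A x * h x) =
    b%:C%C * (fine (mu A))%:C%C + \sum_i \sum_j c i j * Omega A i j.
  have -> : (fun x => chi A x * h x) =
      (fun x => chi A x * b%:C%C + \sum_i \sum_j c i j * (chi A x * D x i j)).
    apply/funext => x; rewrite /h mulrDr; congr (_ + _).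
    rewrite mulr_sumr; apply: eq_bigr => i _; rewrite mulr_sumr.
    by apply: eq_bigr => j _; rewrite mulrCA.
  have Iij i j : cintegrable mu (fun x => c i j * (chi A x * D x i j)).
    by apply: cintegrableZ; apply: chi_integrable => //; exact: density_integrable.
  rewrite cintegralD ?cintegral_chi//; first last.
  - by apply: cintegrable_sum => i; exact: cintegrable_sum.
  - exact: chi_integrable.
  congr (_ + _); rewrite cintegral_sum; last by move=> i; exact: cintegrable_sum.
  apply: eq_bigr => i _; rewrite cintegral_sum//; apply: eq_bigr => j _.
  rewrite cintegralZ ?cintegral_density//.
  by apply: chi_integrable => //; exact: density_integrable.
have le0 x : complex.Re (chi A x * h x) <= 0.
  rewrite /chi cRe_realM indicE; have [|] := boolP (x \in A); last by rewrite mul0r.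
  by rewrite mul1r inE => /ltW.
have int0 : (\int[mu]_x `|(complex.Re (chi A x * h x))%:E| = 0)%E.
  under eq_integral => x _ do rewrite abse_EFin ler0_norm ?le0// EFinN.
  have : (\int[mu]_x - (complex.Re (chi A x * h x))%:E <= 0)%E.
    rewrite integralN /=; last by apply: integrable_add_def.
    rewrite leeNl oppe0 -[X in (_ <= X)%E]fineK; last exact: integrable_fin_num.
    rewrite lee_fin; have := pos A mA.
    have -> : b * fine (mu A) + complex.Re (\sum_i \sum_j c i j * Omega A i j) =
        complex.Re (cintegral mu (fun x => chi A x * h x)).
      by rewrite e [RHS]raddfD [X in _ = X + _]cRe_realM.
    by [].
  move=> le; apply/eqP; rewrite eq_le le /=; apply: integral_ge0 => x _.
  by rewrite -?EFinN lee_fin oppr_ge0.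
have := (ae_eq_integral_abs mu measurableT (measurable_int _ iA)).1 int0.
apply: filterS => x /(_ I) [x0]; rewrite leNgt; apply/negP => hx.
have Ax : A x by rewrite /A /= /h raddfD /=.
move: x0; rewrite /chi cRe_realM indicE mem_set// mul1r => x0.
by move: Ax; rewrite /A /= x0 ltxx.
Qed.

Let cdot_mulmxE (A : 'M[R[i]]_n) x :
  cdot (A *m x) x = \sum_i \sum_j (x j 0 * (x i 0)^*) * A i j.
Proof.
rewrite /cdot; apply: eq_bigr => i _; rewrite mxE mulr_suml.
by apply: eq_bigr => j _; ring.
Qed.

(** In [R[i]] nonnegativity includes being real. The multipliers [1], [i], [-i] test the real part
    and both signs of the imaginary part. *)
Lemma density_quad_ge0 (x : 'cV[R[i]]_n) :
  {ae mu, forall t, 0 <= cdot (D t *m x) x}.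
Proof.
have key (a : R[i]) : (forall z : R[i], 0 <= z -> 0 <= complex.Re (a * z)) ->
    {ae mu, forall t, 0 <= complex.Re (a * cdot (D t *m x) x)}.
  move=> az; have E (A : 'M[R[i]]_n) : a * cdot (A *m x) x =
      \sum_i \sum_j (a * (x j 0 * (x i 0)^*)) * A i j.
    rewrite cdot_mulmxE mulr_sumr; apply: eq_bigr => i _; rewrite mulr_sumr.
    by apply: eq_bigr => j _; rewrite mulrA.
  have := @density_functional_ge0 0 (fun i j => a * (x j 0 * (x i 0)^*)).
  move=> /(_ _)/filterS; apply.
    by move=> t; rewrite add0r -E.
  by move=> A mA; rewrite mul0r add0r -E; apply: az; exact: psdm_ge0.
have h1 : {ae mu, forall t, 0 <= complex.Re (1 * cdot (D t *m x) x)}.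
  by apply: key => z z0; rewrite mul1r; exact: cRe_ge0.
have h2 : {ae mu, forall t, 0 <= complex.Re ('i%C * cdot (D t *m x) x)}.
  by apply: key => z z0; rewrite (ge0_cRe z0) /=; lra.
have h3 : {ae mu, forall t, 0 <= complex.Re (- 'i%C * cdot (D t *m x) x)}.
  by apply: key => z z0; rewrite (ge0_cRe z0) /=; lra.
apply: filterS3 h1 h2 h3 => t; rewrite mul1r mulNr; case: (cdot _ _) => a b /=.
rewrite !mul0r !mul1r !sub0r opprK => a0 b0 b1.
by rewrite lecE /= a0 andbT eq_le; apply/andP; split; lra.
Qed.

Lemma density_psd : {ae mu, forall t, psd (D t)}.
Proof.
pose P k t := if (unpickle k : option 'cV[rat * rat]_n) is Some q
  then 0 <= cdot (D t *m ratvec R q) (ratvec R q) else true.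
have : {ae mu, forall t, forall k, P k t}.
  apply: ae_foralln => k; rewrite /P; case: unpickle => [q|]; last exact: aeW.
  exact: density_quad_ge0.
apply: filterS => t Pt; apply: psd_ratvec => q.
by have := Pt (pickle q); rewrite /P pickleK.
Qed.

(** The functional [mu - Re tr Omega] is identically zero, so the localization applies with
    equality. *)
Lemma density_trace : {ae mu, forall t, complex.Re (\tr (D t)) <= 1}.
Proof.
have trE (A : 'M[R[i]]_n) : \sum_i \sum_j (- (i == j)%:R) * A i j = - \tr A.
  rewrite /mxtrace -sumrN; apply: eq_bigr => i _; rewrite (bigD1 i)//= eqxx big1.
    by rewrite addr0 mulN1r.
  by move=> j ji; rewrite eq_sym (negbTE ji) oppr0 mul0r.
have := @density_functional_ge0 1 (fun i j => - (i == j)%:R).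
move=> /(_ _)/filterS; apply.
  by move=> t; rewrite trE raddfN /= subr_ge0.
by move=> A mA; rewrite mul1r trE raddfN /= subrr.
Qed.

(** Setting the density to 0 on the exceptional null set gives a weight with its properties at every
    point, as the weighted theory requires. *)
Lemma psd_density : exists W : T -> 'M[R[i]]_n,
  [/\ mxmeasurable W, forall t, psd (W t),
      forall t, complex.Re (\tr (W t)) <= 1 & {ae mu, forall t, D t = W t}].
Proof.
have [N [mN N0 NP]] := filterI density_psd density_trace.
have NP' t : ~ N t -> psd (D t) /\ complex.Re (\tr (D t)) <= 1.
  by move=> nN; apply: contrapT => h; apply: nN; exact: NP.
exists (fun t => chi (~` N) t *: D t); split.
- apply: mxmeasurableZ; last exact: mxmeasurable_density.
  by apply: cmeasurable_real; apply: measurable_indic; exact: measurableC.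
- move=> t x; rewrite /chi indicE; have [|] := boolP (t \in ~` N).
    by rewrite inE scale1r => /NP'[+ _]; exact.
  by rewrite scale0r mul0mx (dot0l (@cdot_sip R n)).
- move=> t; rewrite /chi indicE; have [|] := boolP (t \in ~` N).
    by rewrite inE scale1r => /NP'[].
  by rewrite scale0r mxtrace0.
- exists N; split=> // t /= h; apply: contrapT => nN; apply: h.
  by rewrite /chi indicE mem_set// scale1r.
Qed.

End density.

Section semi_inner_ext.
Variables (R : realType) (U : lmodType R[i]) (H : set U) (dot dot' : U -> U -> R[i]).
Hypothesis e : forall u v, H u -> H v -> dot u v = dot' u v.
Hypothesis S : semi_inner_product H dot'.

Lemma eq_sip : semi_inner_product H dot.
Proof.
case: (S) => H0 HZD lin hC ge0; split=> //.
- by move=> a u v w Hu Hv Hw; rewrite !e ?lin//; exact: HZD.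
- by move=> u v Hu Hv; rewrite !e ?(hC u).
- by move=> u Hu; rewrite e ?ge0.
Qed.

Lemma eq_nrm u : H u -> nrm dot u = nrm dot' u.
Proof. by move=> Hu; rewrite /nrm e. Qed.

Lemma eq_complete : complete H dot' -> complete H dot.
Proof.
move=> c x Hx rx; have [|y Hy yP] := c x Hx.
  by move=> k; rewrite -eq_nrm//; exact: (sipB S).
by exists y => // k; rewrite eq_nrm//; exact: (sipB S).
Qed.

End semi_inner_ext.

(** * The space L2 and the integrals against a matrix measure *)

Section psd_L2.
Context d (T : measurableType d) (R : realType) (n : nat).
Variable Omega : psd_measure T R n.
Let mu := trace_measure Omega.
Implicit Types (f g : T -> 'cV[R[i]]_n) (phi psi : T -> R[i]).

Definition regular_density (W : T -> 'M[R[i]]_n) :=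
  [/\ mxmeasurable W, forall t, psd (W t),
      forall t, complex.Re (\tr (W t)) <= 1 & {ae mu, forall t, density Omega t = W t}].

Definition bounded_measurable phi := cmeasurable phi /\ exists C : R, forall x, cmod (phi x) <= C.

Section with_density.
Variable W : T -> 'M[R[i]]_n.
Hypothesis HW : regular_density W.

Let mW : mxmeasurable W. Proof. by case: HW. Qed.
Let W0 t : psd (W t). Proof. by case: HW. Qed.
Let W1 t : complex.Re (\tr (W t)) <= 1. Proof. by case: HW. Qed.
Let DW : {ae mu, forall t, density Omega t = W t}. Proof. by case: HW. Qed.
Let mD := mxmeasurable_density Omega.

Lemma L2_measurable f : L2 Omega f -> mxmeasurable f.
Proof. by move=> [mf _] i j; rewrite ord1; exact: mf. Qed.

Lemma L2E : L2 Omega = wL2 mu W.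
Proof.
have E f : mxmeasurable f -> (\int[mu]_x
     (complex.Re (cdot (density Omega x *m f x) (f x)))%:E =
     \int[mu]_x (wquad W f x)%:E)%E.
  move=> mf; apply: ae_eq_integral => //.
  - by apply/measurable_EFinP; have [] := cmeasurable_cdot (mxmeasurable_mul mD mf) mf.
  - by apply/measurable_EFinP; exact: measurable_wquad.
  - by apply: filterS DW => t Dt _; rewrite /wquad /mxform Dt.
apply/seteqP; split=> f.
  move=> Lf; have mf := L2_measurable Lf; split=> //; apply/integrableP; split.
    by apply/measurable_EFinP; exact: measurable_wquad.
  under eq_integral => x _ do rewrite gee0_abs ?lee_fin ?(wquad_ge0 W0)//.
  by rewrite -E//; case: Lf.
move=> [mf /integrableP[_]]; under eq_integral => x _ do
  rewrite gee0_abs ?lee_fin ?(wquad_ge0 W0)//.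
by rewrite -E// => lt; split=> // i; have [] := mf i 0.
Qed.

Lemma L2_dotE f g : L2 Omega f -> L2 Omega g -> L2_dot Omega f g = wdot mu W f g.
Proof.
move=> /L2_measurable mf /L2_measurable mg; apply: ae_eq_cintegral.
- by apply: cmeasurable_cdot => //; exact: mxmeasurable_mul.
- exact: cmeasurable_mxform.
- by apply: filterS DW => t Dt; rewrite /mxform Dt.
Qed.

Lemma psd_integralE phi i j : cmeasurable phi ->
  psd_integral Omega phi i j = cintegral mu (fun x => phi x * W x i j).
Proof.
move=> mphi; rewrite mxE; apply: ae_eq_cintegral.
- by under [X in cmeasurable X]eq_fun do rewrite mxE; apply: cmeasurableM.
- exact: cmeasurableM.
- by apply: filterS DW => t Dt; rewrite mxE Dt.
Qed.

Lemma psd_integral_vecE f i : mxmeasurable f ->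
  psd_integral_vec Omega f i 0 = cintegral mu (fun x => (W x *m f x) i 0).
Proof.
move=> mf; rewrite mxE; apply: ae_eq_cintegral.
- exact: mxmeasurable_mul.
- exact: mxmeasurable_mul.
- by apply: filterS DW => t Dt; rewrite Dt.
Qed.

Lemma density_entry_integrable phi i j : bounded_measurable phi ->
  cintegrable mu (fun x => phi x * W x i j).
Proof.
move=> [mphi [C phiC]]; apply: (cintegrable_le (g := fun=> C)).
- exact: cmeasurableM.
- exact: finite_measure_integrable_cst.
- move=> x; rewrite cmodM -[C]mulr1; apply: ler_pM; rewrite ?cmod_ge0//.
  exact: le_trans (psd_entry_le (W0 x) i j) (W1 x).
Qed.

End with_density.

Lemma L2_sip : semi_inner_product (L2 Omega) (L2_dot Omega).
Proof.
have [W HW] := psd_density Omega; have [mW W0 W1 _] := HW.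
apply: (@eq_sip _ _ _ _ (wdot mu W)); first by move=> *; exact: L2_dotE.
by rewrite (L2E HW); exact: wdot_sip.
Qed.

Lemma L2_complete : complete (L2 Omega) (L2_dot Omega).
Proof.
have [W HW] := psd_density Omega; have [mW W0 W1 _] := HW.
apply: (@eq_complete _ _ _ _ (wdot mu W)); first by move=> *; exact: L2_dotE.
  by rewrite (L2E HW); exact: wdot_sip.
by rewrite (L2E HW); exact: wL2_complete.
Qed.

Lemma L2_bounded f (C : R) : mxmeasurable f -> 0 <= C ->
  (forall x i, cmod (f x i 0) <= C) ->
  L2 Omega f /\ L2_norm Omega f <= C * (n%:R * Num.sqrt (fine (mu setT))).
Proof.
move=> mf C0 fC; have [W HW] := psd_density Omega; have [mW W0 W1 _] := HW.
have Lf : L2 Omega f by rewrite (L2E HW); case: (wL2_bounded mu mW W0 W1 mf fC).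
split=> //; rewrite [leLHS](_ : _ = nrm (wdot mu W) f).
  exact: nrm_wdot_bounded.
by rewrite /L2_norm (L2_dotE HW).
Qed.

Lemma bounded_measurable_conj phi : bounded_measurable phi ->
  bounded_measurable (fun x => (phi x)^*).
Proof.
move=> [mphi [C phiC]]; split; first exact: cmeasurable_conj.
by exists C => x; rewrite cmod_conj.
Qed.

Lemma bounded_measurableZD a phi psi : bounded_measurable phi ->
  bounded_measurable psi -> bounded_measurable (fun x => a * phi x + psi x).
Proof.
move=> [mphi [C phiC]] [mpsi [E psiE]]; split.
  by apply: cmeasurableD => //; apply: cmeasurableM => //; exact: cmeasurable_cst.
exists (cmod a * C + E) => x; apply: le_trans (cmodD _ _) _.
by rewrite cmodM lerD// ler_wpM2l ?cmod_ge0.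
Qed.

Lemma bounded_measurableM phi psi : bounded_measurable phi ->
  bounded_measurable psi -> bounded_measurable (fun x => phi x * psi x).
Proof.
move=> [mphi [C phiC]] [mpsi [E psiE]]; split; first exact: cmeasurableM.
by exists (C * E) => x; rewrite cmodM; apply: ler_pM; rewrite ?cmod_ge0.
Qed.

Lemma L2_scaled phi (c : 'cV[R[i]]_n) : bounded_measurable phi ->
  L2 Omega (fun x => phi x *: c).
Proof.
move=> [mphi [C phiC]].
have mf : mxmeasurable (fun x => phi x *: c).
  by apply: mxmeasurableZ => //; exact: mxmeasurable_cst.
(* On an empty space the bound [C] may be negative, whereas [L2_bounded] requires a nonnegative
   one. *)
have [x|C0] := pselect (inhabited T).
  have C0 : 0 <= C by case: x => x; exact: le_trans (cmod_ge0 _) (phiC x).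
  have [||] := @L2_bounded _ (C * cnorm c) mf; last by [].
    by rewrite mulr_ge0// cnorm_ge0.
  move=> y i; rewrite mxE cmodM; apply: ler_pM; rewrite ?cmod_ge0//.
  exact: cmod_le_cnorm.
have [||] := @L2_bounded _ 0 mf; [by []|move=> x|by []].
by exfalso; apply: C0; exists; exact: x.
Qed.

(** When [phi] is a Cauchy kernel, the right-hand side contains the integral that defines [V_op]. *)
Lemma L2_dot_scaled f phi (c : 'cV[R[i]]_n) : L2 Omega f -> bounded_measurable phi ->
  L2_dot Omega f (fun x => phi x *: c) =
  cdot (psd_integral_vec Omega (fun x => (phi x)^* *: f x)) c.
Proof.
move=> Lf bphi; have [W HW] := psd_density Omega; have [mW W0 W1 _] := HW.
have [mphi [C phiC]] := bphi; have [mphi' [C' phiC']] := bounded_measurable_conj bphi.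
have mf := L2_measurable Lf.
rewrite (L2_dotE HW)//; last exact: L2_scaled.
have wf : wL2 mu W f by rewrite -(L2E HW).
have I0 i := wL2_row_integrable mW W0 W1 i mphi' phiC' wf.
rewrite /cdot; under eq_bigr => i _.
  rewrite (psd_integral_vecE HW)//; last exact: mxmeasurableZ.
  under [X in cintegral _ X]eq_fun do rewrite -scalemxAr mxE.
  rewrite mulrC -cintegralZ//; over.
rewrite -cintegral_sum; last by move=> i; exact: cintegrableZ.
congr cintegral; apply/funext => x; rewrite /mxform /cdot.
by apply: eq_bigr => i _; rewrite !mxE rmorphM /=; ring.
Qed.

Lemma psd_integral_vec_scaled phi (c : 'cV[R[i]]_n) : bounded_measurable phi ->
  psd_integral_vec Omega (fun x => phi x *: c) = psd_integral Omega phi *m c.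
Proof.
move=> bphi; have [W HW] := psd_density Omega; have [mW W0 W1 _] := HW.
have [mphi _] := bphi.
apply/matrixP => i j; rewrite ord1 (psd_integral_vecE HW); last first.
  by apply: mxmeasurableZ => //; exact: mxmeasurable_cst.
rewrite mxE; under eq_bigr => k _.
  rewrite (psd_integralE HW)// mulrC -cintegralZ; first over.
  exact: density_entry_integrable.
rewrite -cintegral_sum; last first.
  by move=> k; apply: cintegrableZ; exact: (density_entry_integrable HW).
congr cintegral; apply/funext => x; rewrite mxE.
by apply: eq_bigr => k _; rewrite !mxE; ring.
Qed.

Lemma psd_integralZD a phi psi : bounded_measurable phi -> bounded_measurable psi ->
  psd_integral Omega (fun x => a * phi x + psi x) =
  a *: psd_integral Omega phi + psd_integral Omega psi.
Proof.
move=> bphi bpsi; have [W HW] := psd_density Omega.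
have [mphi _] := bphi; have [mpsi _] := bpsi.
have [mab _] := bounded_measurableZD a bphi bpsi.
apply/matrixP => i j.
have -> : forall A B : 'M[R[i]]_n, (a *: A + B) i j = a * A i j + B i j.
  by move=> A B; rewrite !mxE.
transitivity (a * cintegral mu (fun x => phi x * W x i j) +
              cintegral mu (fun x => psi x * W x i j)); last first.
  by congr (a * _ + _); apply/esym; [exact: (psd_integralE HW)|exact: (psd_integralE HW)].
apply: (etrans (psd_integralE HW i j mab)).
rewrite -cintegralZ; last exact: (density_entry_integrable HW).
rewrite -cintegralD; [|by apply: cintegrableZ; exact: (density_entry_integrable HW)|
  exact: (density_entry_integrable HW)].
by congr cintegral; apply/funext => x; ring.
Qed.

Lemma psd_integral_conj phi : bounded_measurable phi ->
  psd_integral Omega (fun x => (phi x)^*) = (psd_integral Omega phi)^t*.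
Proof.
move=> bphi; have [W HW] := psd_density Omega; have [mW W0 W1 _] := HW.
have [mphi _] := bphi; have [mphi' _] := bounded_measurable_conj bphi.
apply/matrixP => i j.
have -> : forall A : 'M[R[i]]_n, (A^t*) i j = (A j i)^* by move=> A; rewrite !mxE.
transitivity ((cintegral mu (fun x => phi x * W x j i))^*); last first.
  by congr (_^*); apply/esym; exact: (psd_integralE HW).
apply: (etrans (psd_integralE HW i j mphi')).
rewrite -cintegral_conj; last exact: (density_entry_integrable HW).
congr cintegral; apply/funext => x; rewrite rmorphM /=; congr (_ * _).
by rewrite -{1}(psd_herm (W0 x)) !mxE.
Qed.

Lemma psd_integral_le phi (C : R) i j : cmeasurable phi ->
  (forall x, cmod (phi x) <= C) ->
  cmod (psd_integral Omega phi i j) <= 2 * (C * fine (mu setT)).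
Proof.
move=> mphi phiC; have [W HW] := psd_density Omega; have [mW W0 W1 _] := HW.
rewrite (psd_integralE HW)//.
rewrite -(Rintegral_cst mu measurableT C); apply: cmod_cintegral_le.
- exact: cmeasurableM.
- exact: finite_measure_integrable_cst.
- move=> x; rewrite cmodM -[C]mulr1; apply: ler_pM; rewrite ?cmod_ge0//.
  exact: le_trans (psd_entry_le (W0 x) i j) (W1 x).
Qed.

End psd_L2.

(** * Hardy and de Branges-Rovnyak spaces *)

Section power_series.
Variable R : realType.
Implicit Types (z w q : R[i]).

Lemma cvg_cmod (T : Type) (F : set_system T) {FF : ProperFilter F} (u : T -> R[i]) (l : R[i]) :
  u @ F --> l -> (fun t => cmod (u t)) @ F --> cmod l.
Proof.
move=> ul; rewrite cmodE_sqrt; under eq_fun do rewrite cmodE_sqrt.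
apply: (@continuous_cvg _ _ _ _ _ _ (@Num.sqrt R)); first exact: sqrt_continuous.
by apply: cvgD; rewrite !expr2; under eq_fun do rewrite expr2; apply: cvgM;
  [exact: cvg_cRe|exact: cvg_cRe|exact: cvg_cIm|exact: cvg_cIm].
Qed.

Lemma cvg_of_cmod (T : Type) (F : set_system T) {FF : ProperFilter F} (u : T -> R[i]) (l : R[i]) :
  (fun t => cmod (u t - l)) @ F --> (0 : R) -> u @ F --> l.
Proof.
move=> ul; apply: cvg_complex; apply/cvgrPdist_le => e e0;
  move/cvgrPdist_le : ul => /(_ _ e0); apply: filterS => t; rewrite sub0r normrN;
  rewrite (ger0_norm (cmod_ge0 _)) => h; apply: le_trans h;
  by rewrite -raddfB -cmodN opprB; first [exact: normcRe_le|exact: normcIm_le].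
Qed.

Lemma cvg_cmod_le (u : nat -> R[i]) (l a : R[i]) (C : R) N : u @ \oo --> l ->
  (forall k, (N <= k)%N -> cmod (u k - a) <= C) -> cmod (l - a) <= C.
Proof.
move=> ul uC; have la : (fun k => cmod (u k - a)) @ \oo --> cmod (l - a).
  by apply: cvg_cmod; apply: cvgB_complex; [exact: ul|exact: cvg_cst].
have /cvg_lim <- // := la; apply: limr_le; first by apply/cvg_ex; eexists; exact: la.
by exists N => // k /= Nk; exact: uC.
Qed.

Lemma cvg_exp_complex z : cmod z < 1 -> (fun k => z ^+ k) @ \oo --> (0 : R[i]).
Proof.
move=> z1; apply: cvg_of_cmod; under eq_fun do rewrite subr0 cmodX.
by apply: cvg_expr; rewrite ger0_norm// cmod_ge0.
Qed.

Lemma cvg_geometric_complex z : cmod z < 1 ->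
  series (fun k => z ^+ k) @ \oo --> (1 - z)^-1.
Proof.
move=> z1; have z10 : 1 - z != 0.
  by rewrite subr_eq0; apply: contraTneq z1 => <-; rewrite cmod1 ltxx.
have -> : series (fun k => z ^+ k) = (fun N => (1 - z)^-1 * (1 - z ^+ N)).
  apply/funext => N; apply: (mulfI z10); rewrite mulrA mulfV// mul1r.
  rewrite /series /=; elim: N => [|N IH]; first by rewrite big_nil mulr0 expr0 subrr.
  by rewrite big_nat_recr//= mulrDr IH exprS; ring.
rewrite -[X in _ --> X]mulr1 -[X in _ * X]subr0.
apply: cvgM_complex; first exact: cvg_cst.
by apply: cvgB_complex; [exact: cvg_cst|exact: cvg_exp_complex].
Qed.

Lemma series_geo_cvg (r C : R) : 0 <= r < 1 -> cvgn (series (fun k => C * r ^+ k)).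
Proof.
by move=> /andP[r0 r1]; apply: is_cvg_geometric_series; rewrite ger0_norm.
Qed.

Lemma pseries_cvg (c : nat -> R[i]) (C : R) z : cmod z < 1 ->
  (forall k, cmod (c k) <= C) -> exists l : R[i], series (fun k => z ^+ k * c k) @ \oo --> l.
Proof.
move=> z1 cC; apply: (@cvg_complex_increments _ _ (fun k => C * cmod z ^+ k)).
  move=> k; rewrite seriesSB cmodM cmodX mulrC.
  by rewrite ler_wpM2r ?exprn_ge0 ?cmod_ge0.
by apply: series_geo_cvg; rewrite cmod_ge0.
Qed.

(** Strong induction: once the earlier coefficients vanish, the sum at a small real [r] gives
    [|c k| r^k <= 2 C r^(k+1)], and [r] tends to 0. *)
Lemma pseries_eq0 (c : nat -> R[i]) (C : R) : (forall k, cmod (c k) <= C) ->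
  (forall z, cmod z < 1 -> series (fun k => z ^+ k * c k) @ \oo --> (0 : R[i])) ->
  forall k, c k = 0.
Proof.
move=> cC c0 k; elim/ltn_ind: k => k IH; apply: cmod0_eq0.
have C0 : 0 <= C by exact: le_trans (cmod_ge0 _) (cC 0%N).
apply: (@le_geo _ C) => m; rewrite add0r.
pose r : R := 2^-1 ^+ m.+1; have r0 : 0 < r by exact: geo_gt0.
have r2 : 2 * r <= 1.
  by rewrite /r exprS mulrA mulfV// mul1r exprn_ile1// ?invr_ge0// invf_le1// ler1n.
have zr : cmod (r%:C%C : R[i]) = r by rewrite cmod_real ger0_norm// ltW.
have z1 : cmod (r%:C%C : R[i]) < 1 by rewrite zr; lra.
(* Since [r <= 1/2], each term [C r^N] is at most [2 C r^N - 2 C r^(N+1)]; the subtracted term lets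
   the induction on [N] telescope. *)
have bd N : (k < N)%N ->
    cmod (\sum_(0 <= i < N) r%:C%C ^+ i * c i - r%:C%C ^+ k * c k) <=
    2 * C * r ^+ k.+1 - 2 * C * r ^+ N.
  elim: N => // N IHN; rewrite ltnS leq_eqVlt => /predU1P[<-|kN].
    rewrite big_nat_recr//= addrK subrr big1_seq ?cmod0// => i /andP[_].
    by rewrite mem_index_iota => /andP[_ ik]; rewrite IH// mulr0.
  rewrite big_nat_recr//= addrAC; apply: le_trans (cmodD _ _) _.
  apply: le_trans (lerD (IHN kN) (lexx _)) _; rewrite cmodM cmodX zr.
  have rN : 0 <= r ^+ N by rewrite exprn_ge0// ltW.
  have h1 : r ^+ N * cmod (c N) <= r ^+ N * C by rewrite ler_wpM2l.
  have h2 : 2 * C * r ^+ N.+1 <= C * r ^+ N.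
    rewrite exprS (_ : 2 * C * (r * r ^+ N) = (2 * r) * (C * r ^+ N)); last by ring.
    by rewrite -[leRHS]mul1r ler_wpM2r// mulr_ge0.
  lra.
have := @cvg_cmod_le _ _ (r%:C%C ^+ k * c k) (2 * C * r ^+ k.+1) k.+1 (c0 _ z1).
have H : forall j : nat, (k < j)%N -> cmod (series (fun i => r%:C%C ^+ i * c i) j -
    r%:C%C ^+ k * c k) <= 2 * C * r ^+ k.+1.
  move=> j kj; apply: le_trans (bd _ kj) _; rewrite gerBl.
  by rewrite mulr_ge0 ?exprn_ge0 ?mulr_ge0// ltW.
move=> /(_ H); rewrite sub0r cmodN cmodM cmodX zr exprS mulrA [leRHS]mulrC.
rewrite ler_pM2l ?exprn_gt0// => h; apply: le_trans h _.
by rewrite /r exprS mulrA [2 * C]mulrC mulfK.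
Qed.

Lemma cvg_mx (T : Type) (F : set_system T) {FF : Filter F} m n
    (u : T -> 'M[R[i]]_(m, n)) (l : 'M[R[i]]_(m, n)) :
  (forall i j, (fun t => u t i j) @ F --> l i j) -> u @ F --> l.
Proof.
move=> h B [P PM PB].
have Ft : F [set t | forall ij : 'I_m * 'I_n, P ij.1 ij.2 (u t ij.1 ij.2)].
  by apply: filter_forall => -[i j]; exact: (h i j _ (PM i j)).
change (F (u @^-1` B)); apply: filterS Ft => t Pt; apply: PB => i j.
exact: (Pt (i, j)).
Qed.

Lemma cvg_mxE (T : Type) (F : set_system T) {FF : Filter F} m n
    (u : T -> 'M[R[i]]_(m, n)) (l : 'M[R[i]]_(m, n)) i j :
  u @ F --> l -> (fun t => u t i j) @ F --> l i j.
Proof. move=> ul; apply: (@cvg_comp _ _ _ u (fun A : 'M[R[i]]_(m, n) => A i j) F (nbhs l) _ ul).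
exact: coord_continuous. Qed.

Lemma cvg_complex_unique (u : nat -> R[i]) (l l1 : R[i]) :
  u @ \oo --> l -> u @ \oo --> l1 -> l = l1.
Proof. by move=> /cvg_lim <- // /cvg_lim <-. Qed.

End power_series.

(** * Square-summable coefficient sequences and the Hardy space *)

Section square_summable.
Variables (R : realType) (n : nat).
Local Notation vec := ('cV[R[i]]_n).
Implicit Types (a b : nat -> 'cV[R[i]]_n).

Definition ell2 : set (nat -> 'cV[R[i]]_n) :=
  [set a : nat -> 'cV[R[i]]_n | cvgn (series (fun k => cnorm (a k) ^+ 2))].

Definition ell2_dot a b : R[i] := limn (series (fun k => cdot (a k) (b k))).

Lemma cnormE (x : vec) : nrm (@cdot R n) x = cnorm x. Proof. by []. Qed.

Lemma cmod_cdot_le (x y : vec) : cmod (cdot x y) <= cnorm x ^+ 2 + cnorm y ^+ 2.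
Proof.
apply: le_trans (cauchy_schwarz (@cdot_sip R n) _ _) _ => //.
have := sqr_ge0 (cnorm x - cnorm y); have := sqr_ge0 (cnorm x); have := sqr_ge0 (cnorm y).
by rewrite sqrrB !cnormE; lra.
Qed.

Lemma ell2_dot_cvg a b : ell2 a -> ell2 b ->
  series (fun k => cdot (a k) (b k)) @ \oo --> ell2_dot a b.
Proof.
move=> la lb; suff [l sl] : exists l : R[i], series (fun k => cdot (a k) (b k)) @ \oo --> l.
  by rewrite /ell2_dot; have /cvg_lim -> // := sl.
apply: (@cvg_complex_increments R _ (fun k => cnorm (a k) ^+ 2 + cnorm (b k) ^+ 2)).
  by move=> k; rewrite seriesSB; exact: cmod_cdot_le.
rewrite (_ : series _ = series (fun k => cnorm (a k) ^+ 2) +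
  series (fun k => cnorm (b k) ^+ 2)); first exact: is_cvgD.
by apply/funext => N; rewrite /series /= [RHS]/GRing.add /= -big_split.
Qed.

Lemma ell2_bound a (C : R) :
  (forall N, \sum_(0 <= k < N) cnorm (a k) ^+ 2 <= C) -> ell2 a.
Proof.
move=> aC; apply: nondecreasing_is_cvgn; last by exists C => _ [N _ <-]; exact: aC.
by apply/nondecreasing_seqP => N; rewrite /series /= big_nat_recr//= lerDl sqr_ge0.
Qed.

Lemma ell2_partial a N : ell2 a ->
  \sum_(0 <= k < N) cnorm (a k) ^+ 2 <= limn (series (fun k => cnorm (a k) ^+ 2)).
Proof.
move=> la; apply: (nondecreasing_cvgn_le _ la N).
by apply/nondecreasing_seqP => k; rewrite /series /= big_nat_recr//= lerDl sqr_ge0.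
Qed.

Lemma ell2_dot_self a : ell2 a ->
  ell2_dot a a = (limn (series (fun k => cnorm (a k) ^+ 2)))%:C%C.
Proof.
move=> la; apply: (cvg_complex_unique (ell2_dot_cvg la la)) => //.
apply: cvg_complex; last first.
  rewrite [X in X @ _](_ : _ = fun=> 0); first exact: cvg_cst.
  apply/funext => N; rewrite /series /= raddf_sum /=; apply: big1 => k _.
  by rewrite (dot_nrm (@cdot_sip R n)).
rewrite [X in X @ _](_ : _ = series (fun k => cnorm (a k) ^+ 2)); first exact: la.
apply/funext => N; rewrite /series /= raddf_sum /=; apply: eq_bigr => k _.
by rewrite (dot_nrm (@cdot_sip R n)).
Qed.

Lemma ell2ZD c a b : ell2 a -> ell2 b -> ell2 (c *: a + b).
Proof.
move=> la lb; pose A := limn (series (fun k => cnorm (a k) ^+ 2)).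
pose B := limn (series (fun k => cnorm (b k) ^+ 2)).
apply: (@ell2_bound _ (2 * cmod c ^+ 2 * A + 2 * B)) => N.
apply: (@le_trans _ _ (\sum_(0 <= k < N) (2 * cmod c ^+ 2 * cnorm (a k) ^+ 2 +
    2 * cnorm (b k) ^+ 2))).
  apply: ler_sum => k _; have S := @cdot_sip R n.
  have := nrmD S (u := c *: a k) (v := b k) I I; rewrite (nrmZ S)//.
  rewrite !cnormE => h.
  have h0 : 0 <= cmod c * cnorm (a k) + cnorm (b k).
    by rewrite addr_ge0 ?mulr_ge0 ?cmod_ge0 ?cnorm_ge0.
  rewrite -(@ler_pXn2r _ 2) ?nnegrE ?nrm_ge0// in h; apply: le_trans h _.
  by have := sqr_ge0 (cmod c * cnorm (a k) - cnorm (b k)); rewrite sqrrB sqrrD exprMn; lra.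
rewrite big_split /= -!mulr_sumr; apply: lerD; rewrite ler_wpM2l ?ell2_partial//.
by rewrite mulr_ge0// sqr_ge0.
Qed.

Lemma ell2_sip : semi_inner_product ell2 ell2_dot.
Proof.
split.
- apply: (@ell2_bound _ 0) => N; rewrite big1// => k _.
  by rewrite /cnorm (dot0l (@cdot_sip R n)) //= sqrtr0 expr0n.
- exact: ell2ZD.
- move=> c a b w la lb lw.
  have lab : ell2 (c *: a + b) by exact: ell2ZD.
  apply: (cvg_complex_unique (ell2_dot_cvg lab lw)).
  have -> : series (fun k => cdot ((c *: a + b) k) (w k)) =
      (fun N => c * series (fun k => cdot (a k) (w k)) N + series (fun k => cdot (b k) (w k)) N).
    apply/funext => N; rewrite /series /= mulr_sumr -big_split /=.
    by apply: eq_bigr => k _; rewrite -cdotZDl.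
  apply: cvgD_complex; last exact: ell2_dot_cvg.
  by apply: cvgM_complex; [exact: cvg_cst|exact: ell2_dot_cvg].
- move=> a b la lb; apply: (cvg_complex_unique (ell2_dot_cvg lb la)) => //.
  have -> : series (fun k => cdot (b k) (a k)) =
      (fun N => (series (fun k => cdot (a k) (b k)) N)^*).
    apply/funext => N; rewrite /series /= rmorph_sum.
    by apply: eq_bigr => k _; rewrite cdotC.
  by apply: cvg_conj; exact: ell2_dot_cvg.
- move=> a la; rewrite ell2_dot_self// lecR.
  by apply: le_trans (ell2_partial 0 la); rewrite big_nil.
Qed.

Lemma sqr_nrm_ell2 a : ell2 a ->
  nrm ell2_dot a ^+ 2 = limn (series (fun k => cnorm (a k) ^+ 2)).
Proof. by move=> la; rewrite (sqr_nrm ell2_sip)// ell2_dot_self. Qed.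

Lemma cnorm_le_ell2 a k : ell2 a -> cnorm (a k) <= nrm ell2_dot a.
Proof.
move=> la; rewrite -ler_sqr ?nnegrE ?nrm_ge0 ?cnorm_ge0// sqr_nrm_ell2//.
apply: le_trans (ell2_partial k.+1 la); rewrite big_nat_recr//= lerDr.
by apply: sumr_ge0 => j _; exact: sqr_ge0.
Qed.

Lemma nrm_ell2_bound a (C : R) : 0 <= C ->
  (forall N, \sum_(0 <= k < N) cnorm (a k) ^+ 2 <= C ^+ 2) ->
  ell2 a /\ nrm ell2_dot a <= C.
Proof.
move=> C0 aC; have la : ell2 a by exact: ell2_bound aC.
split=> //; rewrite -ler_sqr ?nnegrE ?nrm_ge0// sqr_nrm_ell2//.
by apply: limr_le => //; apply: nearW => N; exact: aC.
Qed.

(** The limit is taken coordinate by coordinate; the norm bound passes to it on each finite partial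
    sum. *)
Lemma ell2_complete : complete ell2 ell2_dot.
Proof.
move=> x lx rx; have S := ell2_sip.
have /choice[y yP] : forall k, exists y : vec, forall i, (fun m => x m k i 0) @ \oo --> y i 0.
  move=> k; have /choice[y yP] : forall i, exists l : R[i], (fun m => x m k i 0) @ \oo --> l.
    move=> i; apply: (@cvg_complex_increments _ _ (fun m => 1 * 2^-1 ^+ m)); last first.
      by apply: series_geo_cvg; lra.
    move=> m; rewrite mul1r; apply: le_trans (rx m).
    have ld : ell2 (x m.+1 - x m) by exact: (sipB S).
    apply: le_trans (cnorm_le_ell2 k ld).
    have := cmod_le_cnorm ((x m.+1 - x m) k) i.
    by rewrite [in X in X -> _]/GRing.add /= [in X in X -> _]/GRing.opp /= !mxE.
  by exists (\col_i y i) => i; rewrite mxE; exact: yP.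
have bd m : ell2 (x m - y) /\ nrm ell2_dot (x m - y) <= 2 * 2^-1 ^+ m.
  apply: nrm_ell2_bound; first by rewrite mulr_ge0//; exact/ltW/geo_gt0.
  move=> N.
  have lim : (fun j => \sum_(0 <= k < N) cdot (x m k - x (j + m)%N k) (x m k - x (j + m)%N k))
      @ \oo --> \sum_(0 <= k < N) cdot (x m k - y k) (x m k - y k).
    apply: cvg_bigsum => k; have d i : (fun j => (x m k - x (j + m)%N k) i 0) @ \oo -->
        (x m k - y k) i 0.
      rewrite !mxE; under eq_fun do rewrite !mxE.
      apply: cvgB_complex; first exact: cvg_cst.
      by have := yP k i; rewrite -(cvg_shiftn m) => h; exact: h.
    by apply: cvg_cdot => i; exact: d.
  have -> : \sum_(0 <= k < N) cnorm ((x m - y) k) ^+ 2 =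
      complex.Re (\sum_(0 <= k < N) cdot (x m k - y k) (x m k - y k)).
    rewrite raddf_sum; apply: eq_bigr => k _.
    by rewrite /= -(sqr_nrm (@cdot_sip R n)).
  have limR := cvg_cRe lim; have /cvg_lim <- // := limR.
  apply: limr_le; first by apply/cvg_ex; eexists; exact: limR.
  apply: nearW => j; have ld : ell2 (x m - x (j + m)%N) by exact: (sipB S).
  rewrite raddf_sum /=.
  apply: le_trans (_ : \sum_(0 <= k < N) cnorm ((x m - x (j + m)%N) k) ^+ 2 <= _).
    by apply: ler_sum => k _; rewrite (sqr_nrm (@cdot_sip R n)).
  apply: le_trans (ell2_partial N ld) _; rewrite -sqr_nrm_ell2//.
  rewrite ler_pXn2r ?nnegrE ?nrm_ge0//.
  by rewrite (nrm_distC S)// addnC; exact: (rapid_dist S).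
exists y; last by move=> m; case: (bd m).
have -> : y = x 0%N - (x 0%N - y) by rewrite opprB addrC subrK.
by apply: (sipB S) => //; case: (bd 0%N).
Qed.

End square_summable.

Section hardy_space.
Variables (R : realType) (n : nat).
Local Notation vec := ('cV[R[i]]_n).
Local Notation fspace := (disc R -> 'cV[R[i]]_n).
Implicit Types (F G : disc R -> 'cV[R[i]]_n) (a b : nat -> 'cV[R[i]]_n).

Lemma disc_norm (z : disc R) : `|sval z| < 1.
Proof. exact: (proj2_sig z). Qed.

Lemma disc_cmod (z : disc R) : cmod (sval z) < 1.
Proof. by have := disc_norm z; rewrite cmodE -ltcR. Qed.

Let series_entry (z : R[i]) a i N :
  (series (fun k => z ^+ k *: a k) N : vec) i 0 = series (fun k => z ^+ k * a k i 0) N.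
Proof.
rewrite /series /= summxE; apply: eq_bigr => k _.
by rewrite mxE.
Qed.

Lemma taylor_ofP F a : taylor_of F a <->
  ell2 a /\ forall (z : disc R) i, series (fun k => sval z ^+ k * a k i 0) @ \oo --> F z i 0.
Proof.
split=> -[la aF]; split=> // z.
  move=> i; have h : (fun N => (series (fun k => sval z ^+ k *: a k) N : vec) i 0)
      @ \oo --> F z i 0 by apply: cvg_mxE; exact: aF.
  have e : (fun N => (series (fun k => sval z ^+ k *: a k) N : vec) i 0) =
      series (fun k => sval z ^+ k * a k i 0).
    by apply/funext => N; exact: series_entry.
  by rewrite e in h.
apply: cvg_mx => i j; rewrite ord1; under eq_fun do rewrite series_entry.
exact: aF.
Qed.

Lemma ell2_entry_bound a i : ell2 a -> forall k, cmod (a k i 0) <= nrm (@ell2_dot R n) a.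
Proof.
by move=> la k; apply: le_trans (cmod_le_cnorm _ _) _; exact: cnorm_le_ell2.
Qed.

Lemma ell2_taylor a : ell2 a -> exists F, taylor_of F a.
Proof.
move=> la; have /choice[F FP] : forall z : disc R, exists y : vec,
    forall i, series (fun k => sval z ^+ k * a k i 0) @ \oo --> y i 0.
  move=> z; have /choice[y yP] : forall i, exists l : R[i],
      series (fun k => sval z ^+ k * a k i 0) @ \oo --> l.
    by move=> i; apply: pseries_cvg (disc_cmod z) (ell2_entry_bound i la).
  by exists (\col_i y i) => i; rewrite mxE; exact: yP.
by exists F; apply/taylor_ofP.
Qed.

Lemma taylor_ofZD c F G a b : taylor_of F a -> taylor_of G b ->
  taylor_of (c *: F + G) (c *: a + b).
Proof.
move=> /taylor_ofP[la aF] /taylor_ofP[lb bG]; apply/taylor_ofP; split; first exact: ell2ZD.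
move=> z i; rewrite [X in _ --> X](_ : _ = c * F z i 0 + G z i 0); last by rewrite !mxE.
have -> : series (fun k => sval z ^+ k * (c *: a + b) k i 0) =
    (fun N => c * series (fun k => sval z ^+ k * a k i 0) N +
              series (fun k => sval z ^+ k * b k i 0) N).
  apply/funext => N; rewrite /series /= mulr_sumr -big_split /=.
  by apply: eq_bigr => k _; rewrite !mxE; ring.
apply: cvgD_complex; last exact: bG.
by apply: cvgM_complex; [exact: cvg_cst|exact: aF].
Qed.

(** Taylor coefficients are unique, so the sequence picked by [taylor] is the only one and depends
    linearly on the function. *)
Lemma taylor_of0 a : taylor_of 0 a -> a = 0.
Proof.
move=> /taylor_ofP[la a0]; apply/funext => k; apply/matrixP => i j; rewrite ord1 mxE.
apply: (pseries_eq0 (ell2_entry_bound i la)) => z z1.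
have z1' : `|z| < 1 by rewrite cmodE -ltcR in z1 *.
by have := a0 (exist _ z z1') i; rewrite mxE.
Qed.

Lemma taylor_of_uniq F a b : taylor_of F a -> taylor_of F b -> a = b.
Proof.
move=> Fa Fb; apply/eqP; rewrite -subr_eq0; apply/eqP; apply: taylor_of0.
by have := taylor_ofZD (-1) Fb Fa; rewrite !scaleN1r addrC subrr addrC.
Qed.

Lemma taylorP F : hardy F -> taylor_of F (taylor F).
Proof. exact: xgetPex. Qed.

Lemma taylorE F a : taylor_of F a -> taylor F = a.
Proof. by move=> Fa; exact: (taylor_of_uniq (taylorP (ex_intro _ a Fa)) Fa). Qed.

Lemma ell2_taylorF F : hardy F -> ell2 (taylor F).
Proof. by move=> /taylorP[]. Qed.

Lemma hardyZD c F G : hardy F -> hardy G -> hardy (c *: F + G).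
Proof.
by move=> /taylorP HF /taylorP HG; eexists; exact: taylor_ofZD HF HG.
Qed.

Lemma taylorZD c F G : hardy F -> hardy G ->
  taylor (c *: F + G) = c *: taylor F + taylor G.
Proof.
by move=> HF HG; apply: taylorE; apply: taylor_ofZD; exact: taylorP.
Qed.

Lemma hardy_dotE F G : hardy_dot F G = ell2_dot (taylor F) (taylor G).
Proof. by []. Qed.

Lemma taylor_of00 : taylor_of (0 : fspace) 0.
Proof.
apply/taylor_ofP; split; first exact: (sip0 (ell2_sip R n)).
move=> z i; have -> : (0 : fspace) z i 0 = 0 by rewrite mxE.
rewrite (_ : series _ = fun=> 0); last first.
  by apply/funext => N; rewrite /series /= big1// => k _; rewrite ?mxE mulr0.
exact: cvg_cst.
Qed.

Lemma hardy_sip : semi_inner_product (@hardy R n) (@hardy_dot R n).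
Proof.
have S := ell2_sip R n; split.
- by exists 0; exact: taylor_of00.
- exact: hardyZD.
- move=> c F G W HF HG HW; rewrite !hardy_dotE (taylorZD c HF HG).
  exact: (sip_linear S c (ell2_taylorF HF) (ell2_taylorF HG) (ell2_taylorF HW)).
- by move=> F G HF HG; exact: (sipC S (ell2_taylorF HF) (ell2_taylorF HG)).
- by move=> F HF; exact: (sip_ge0 S (ell2_taylorF HF)).
Qed.

Lemma hardy_complete : complete (@hardy R n) (@hardy_dot R n).
Proof.
move=> F HF rF; have taylorB G W : hardy G -> hardy W ->
    taylor (G - W) = taylor G - taylor W.
  by move=> HG HW; rewrite -scaleN1r addrC (taylorZD _ HW HG) scaleN1r addrC.
have [||a la aP] := @ell2_complete R n (fun k => taylor (F k)).
- by move=> k; exact: ell2_taylorF.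
- by move=> k; rewrite -(taylorB _ _ (HF k.+1) (HF k)); exact: rF.
have [G Ga] := ell2_taylor la; have HG : hardy G by exists a.
exists G; first exact: HG.
by move=> k; rewrite /nrm hardy_dotE (taylorB _ _ (HF k) HG) (taylorE Ga); exact: aP.
Qed.

Lemma hardy_dot_eq0 F : hardy F -> hardy_dot F F = 0 -> F = 0.
Proof.
move=> HF F0; have la := ell2_taylorF HF.
have t0 : taylor F = 0.
  apply/funext => k; apply: cnorm0_eq0; apply: le_trans (cnorm_le_ell2 k la) _.
  by rewrite /nrm -hardy_dotE F0 /= sqrtr0.
have /taylor_ofP[_ aF] := taylorP HF; have /taylor_ofP[_ a0] := taylor_of00.
apply/funext => z; apply/matrixP => i j; rewrite ord1.
by apply: cvg_complex_unique (aF z i) _; rewrite t0; exact: a0.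
Qed.

Definition szego (w : R[i]) (x : vec) : fspace := fun z => (1 - sval z * w^*)^-1 *: x.

Lemma szego_taylor w x : cmod w < 1 -> taylor_of (szego w x) (fun k => (w^*) ^+ k *: x).
Proof.
move=> w1; apply/taylor_ofP; split.
  have := @series_geo_cvg R (cmod w ^+ 2) (cnorm x ^+ 2).
  have -> : (fun k => cnorm x ^+ 2 * (cmod w ^+ 2) ^+ k) =
      (fun k => cnorm ((w^*) ^+ k *: x) ^+ 2).
    apply/funext => k; rewrite -[cnorm (_ *: _)]cnormE (nrmZ (@cdot_sip R n))// cnormE.
    by rewrite cmodX cmod_conj [RHS]exprMn [RHS]mulrC; congr (_ * _); exact: exprAC.
  by apply; rewrite sqr_ge0 expr_lt1 ?cmod_ge0.
move=> z i; rewrite mxE; have zw : cmod (sval z * w^*) < 1.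
  rewrite cmodM cmod_conj; apply: le_lt_trans (disc_cmod z).
  by rewrite -[leRHS]mulr1 ler_wpM2l ?cmod_ge0// ltW.
have -> : series (fun k => sval z ^+ k * ((w^*) ^+ k *: x) i 0) =
    (fun N => series (fun k => (sval z * w^*) ^+ k) N * x i 0).
  apply/funext => N; rewrite /series /= mulr_suml; apply: eq_bigr => k _.
  by rewrite mxE exprMn mulrA.
by apply: cvgM_complex; [exact: cvg_geometric_complex|exact: cvg_cst].
Qed.

Lemma hardy_szego w x : cmod w < 1 -> hardy (szego w x).
Proof. by move=> w1; eexists; exact: szego_taylor. Qed.

Lemma szego_reproducing F (w : disc R) x : hardy F ->
  hardy_dot F (szego (sval w) x) = cdot (F w) x.
Proof.
move=> HF; have St := szego_taylor x (disc_cmod w).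
have la := ell2_taylorF HF; have lb : ell2 (taylor (szego (sval w) x)).
  by apply: ell2_taylorF; eexists; exact: St.
have /taylor_ofP[_ aF] := taylorP HF.
apply: (cvg_complex_unique (ell2_dot_cvg la lb)); rewrite (taylorE St).
have -> : series (fun k => cdot (taylor F k) ((sval w)^* ^+ k *: x)) =
    (fun N => \sum_i series (fun k => sval w ^+ k * taylor F k i 0) N * (x i 0)^*).
  apply/funext => N; under eq_bigr do rewrite /series /= mulr_suml.
  rewrite exchange_big /=; apply: eq_bigr => k _; apply: eq_bigr => i _.
  by rewrite mxE rmorphM rmorphXn /= conjCK; ring.
by apply: cvg_bigsum => i; apply: cvgM_complex; [exact: aF|exact: cvg_cst].
Qed.

End hardy_space.

(** * Operator norm and fixed vectors of contractions *)

Section opnorm.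
Variables (R : realType) (n : nat).
Implicit Types (A : 'M[R[i]]_n) (x : 'cV[R[i]]_n).

(** Crude, but it shows that the set whose supremum is [opnorm A] is bounded above. *)
Lemma cnorm_mulmx_le A x :
  cnorm (A *m x) <= (\sum_j cnorm (A *m delta_mx j 0)) * cnorm x.
Proof.
have S := @cdot_sip R n.
have {1}-> : x = \sum_j x j 0 *: delta_mx j 0.
  by rewrite [LHS]matrix_sum_delta; apply: eq_bigr => j _; rewrite big_ord1.
rewrite mulmx_sumr mulr_suml; elim/big_ind2: _ => [|u a v b ua vb|j _].
- by rewrite /cnorm (dot0l S) //= sqrtr0.
- by apply: le_trans (nrmD S _ _) (lerD ua vb).
- rewrite -scalemxAr -cnormE (nrmZ S)// mulrC ler_wpM2l ?cnorm_ge0//.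
  exact: cmod_le_cnorm.
Qed.

Lemma cnorm_le_opnorm A x : cnorm (A *m x) <= opnorm A * cnorm x.
Proof.
have S := @cdot_sip R n.
have [x0|x0] := eqVneq (cnorm x) 0.
  by apply: le_trans (cnorm_mulmx_le A x) _; rewrite x0 !mulr0.
have x1 : 0 < cnorm x by rewrite lt0r x0 cnorm_ge0.
rewrite -ler_pdivrMr//.
have cr : cmod ((cnorm x)^-1%:C%C : R[i]) = (cnorm x)^-1.
  by rewrite cmod_real ger0_norm// invr_ge0 cnorm_ge0.
have -> : cnorm (A *m x) / cnorm x = cnorm (A *m ((cnorm x)^-1%:C%C *: x)).
  by rewrite -scalemxAr -[RHS]cnormE (nrmZ S)// cr mulrC.
apply: ub_le_sup; last first.
  by exists ((cnorm x)^-1%:C%C *: x) => //=; rewrite -cnormE (nrmZ S)// cr mulVf.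
exists (\sum_j cnorm (A *m delta_mx j 0)) => _ [y /= y1 <-].
apply: le_trans (cnorm_mulmx_le A y) _; rewrite -[leRHS]mulr1 ler_wpM2l//.
by apply: sumr_ge0 => j _; exact: cnorm_ge0.
Qed.

Lemma unitmx_inj A : (forall x, A *m x = 0 -> x = 0) -> A \in unitmx.
Proof.
move=> inj; rewrite -unitmx_tr -row_free_unit -kermx_eq0; apply/eqP.
pose C : 'M[R[i]]_n := kermx A^T; rewrite -[kermx _]/C.
have C0 : A *m C^T = 0.
  by apply: (can_inj (@trmxK _ _ _)); rewrite trmx_mul trmxK mulmx_ker trmx0.
apply/matrixP => i j; have := inj (C^T *m delta_mx i 0).
rewrite mulmxA C0 mul0mx => /(_ erefl)/(congr1 (fun v => cdot v (delta_mx j 0))).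
by rewrite mx_delta (dot0l (@cdot_sip R n))// !mxE.
Qed.

(** With [B] the adjoint, [(B x, x) = (x, A x) = (x, x)], so [|B x - x|^2 = |B x|^2 - |x|^2], which
    is nonpositive because [B] does not increase the norm of [x]. *)
Lemma contraction_fixed A x : (forall y, cnorm (A *m y) <= cnorm y) ->
  A *m x = x -> (A^t* : 'M[R[i]]_n) *m x = x.
Proof.
move=> cA Ax; set B : 'M[R[i]]_n := A^t*; have S := @cdot_sip R n.
have Bx : cnorm (B *m x) <= cnorm x.
  have [b0|b0] := eqVneq (cnorm (B *m x)) 0; first by rewrite b0 cnorm_ge0.
  have b1 : 0 < cnorm (B *m x) by rewrite lt0r b0 cnorm_ge0.
  rewrite -(ler_pM2l b1) -expr2 -cnormE (sqr_nrm S)//.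
  have -> : cdot (B *m x) (B *m x) = cdot (A *m (B *m x)) x by rewrite [RHS]cdot_adj.
  apply: le_trans (cRe_le_cmod _) _; apply: le_trans (cauchy_schwarz S I I) _.
  by rewrite !cnormE ler_wpM2r ?cnorm_ge0.
apply/eqP; rewrite -subr_eq0; apply/eqP; apply: cnorm0_eq0.
rewrite -(@ler_pXn2r _ 2) ?nnegrE ?cnorm_ge0// expr0n /= -cnormE (sqr_nrm S)//.
rewrite (dotBl S)// !(dotBr S)//.
have -> : cdot (B *m x) x = cdot x x by rewrite /B cdot_adj adjK Ax.
have -> : cdot x (B *m x) = cdot x x by rewrite -cdot_adj Ax.
rewrite subrr subr0 raddfB /= -!(sqr_nrm S)// !cnormE subr_le0.
by rewrite ler_pXn2r ?nnegrE ?cnorm_ge0.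
Qed.

End opnorm.

(* The range of a positive operator [Rt], normed so that [Rt] is a co-isometry. *)
Section operator_range.
Variables (R : realType) (U : lmodType R[i]) (H : set U) (dotH : U -> U -> R[i]).
Variables (A Rt : U -> U) (K : set U) (dotK : U -> U -> R[i]).
Hypothesis S : semi_inner_product H dotH.
Hypothesis sqrtA : positive_sqrt_of H dotH A Rt.

Let HR u : H u -> H (Rt u). Proof. by have [h _ _ _ _] := sqrtA; exact: (h u). Qed.

(** [positive_sqrt_of] asks for positivity only; over complex scalars this implies symmetry by
    polarization. *)
Lemma positive_sqrt_selfadjoint u v : H u -> H v -> dotH (Rt u) v = dotH u (Rt v).
Proof.
move=> Hu Hv; have [_ Rlin _ Rpos _] := sqrtA.
have SR : semi_inner_product H (fun u v => dotH (Rt u) v).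
  apply: sip_of_form.
  - exact: (sip0 S).
  - exact: (sipZD S).
  - move=> a u1 v1 w1 H1 H2 H3; rewrite Rlin//.
    exact: (sip_linear S a (HR H1) (HR H2) H3).
  - move=> a u1 v1 w1 H1 H2 H3; rewrite (dotDr S (sipZ S a H1) H2 (HR H3)).
    by rewrite (dotZr S a H1 (HR H3)).
  - exact: Rpos.
by rewrite (sipC SR Hv Hu) -(sipC S (HR Hv) Hu).
Qed.

Hypothesis KE : K = Rt @` H.
Hypothesis ipK : inner_product K dotK.
Hypothesis co : coisometry H dotH K dotK Rt.

Lemma operator_range_sip : semi_inner_product K dotK.
Proof.
have [_ Rlin _ _ _] := sqrtA; have [lin herm ge0 _] := ipK.
have KZD (a : R[i]) u v : K u -> K v -> K (a *: u + v).
  rewrite KE => -[f Hf <-] [g Hg <-]; exists (a *: f + g); first exact: (sipZD S).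
  exact: Rlin.
split=> //; rewrite KE; exists 0; first exact: (sip0 S).
have := Rlin (-1) 0 0 (sip0 S) (sip0 S).
by rewrite scaler0 addr0 scaleN1r addNr.
Qed.

(** The adjoint [P] embeds [K] isometrically into [H] because [Rt P = 1]. A rapid sequence is pulled
    back by [P], and its limit is pushed forward by [Rt], a contraction. *)
Lemma operator_range_complete : complete H dotH -> complete K dotK.
Proof.
move=> cH; have SK := operator_range_sip.
have [_ Rlin _ _ _] := sqrtA; have [P [RK PH adjP] RP] := co.
have PP w w' : K w -> K w' -> dotH (P w) (P w') = dotK w w'.
  by move=> Kw Kw'; rewrite -adjP ?RP//; exact: PH.
have PB w w' : K w -> K w' -> nrm dotH (P w - P w') = nrm dotK (w - w').
  move=> Kw Kw'; have h := PH _ Kw; have h' := PH _ Kw'; have hB := sipB S h h'.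
  have kB := sipB SK Kw Kw'.
  rewrite /nrm (dotBl S h h' hB) !(dotBr S h h')// (dotBl SK Kw Kw' kB) !(dotBr SK Kw Kw')//.
  by rewrite !PP.
have Rle u : H u -> nrm dotK (Rt u) <= nrm dotH u.
  move=> Hu; have Ku := RK _ Hu.
  have [r0|r0] := eqVneq (nrm dotK (Rt u)) 0; first by rewrite r0 nrm_ge0.
  have r1 : 0 < nrm dotK (Rt u) by rewrite lt0r r0 nrm_ge0.
  rewrite -(ler_pM2r r1) -expr2 (sqr_nrm SK Ku) (adjP _ _ Hu Ku).
  apply: le_trans (cRe_le_cmod _) _.
  apply: le_trans (cauchy_schwarz S Hu (PH _ Ku)) _.
  by rewrite ler_wpM2l ?nrm_ge0// /nrm PP.
move=> w Kw rw; have [||h Hh hP] := cH (fun k => P (w k)).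
- by move=> k; exact: PH.
- by move=> k; rewrite PB.
exists (Rt h); first exact: RK.
move=> k; have HPw : H (P (w k)) by exact: PH.
have -> : w k - Rt h = Rt (P (w k) - h).
  by rewrite addrC -scaleN1r [in RHS]addrC -[in RHS]scaleN1r Rlin// RP.
exact: le_trans (Rle _ (sipB S HPw Hh)) (hP k).
Qed.

(** [P Rt] is the orthogonal projection onto the complement of the kernel of [Rt]. It fixes [Rt k],
    so for [f = Rt (P f)] the product with [Rt (Rt k)] is [(P f, Rt k) = (Rt (P f), k)]. *)
Lemma operator_range_reproducing k : (forall u, H u -> dotH u u = 0 -> u = 0) -> H k ->
  K (Rt (Rt k)) /\ forall f, K f -> dotK f (Rt (Rt k)) = dotH f k.
Proof.
move=> def Hk; have SK := operator_range_sip; have HRk := HR Hk.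
have [P [RK PH adjP] RP] := co; have KRR := RK _ HRk; have HPR := PH _ KRR.
have PRself u v : H u -> H v -> dotH u (P (Rt v)) = dotH (P (Rt u)) v.
  move=> Hu Hv; have Ku := RK _ Hu; have Kv := RK _ Hv.
  by rewrite -(adjP _ _ Hu Kv) (sipC S Hv (PH _ Ku)) -(adjP _ _ Hv Ku) -(sipC SK Kv Ku).
(* The difference [u] is orthogonal to itself: moving [P Rt] and [Rt] across turns both products
   into [(Rt u, k)], by [Rt P = 1]. *)
have PRR : P (Rt (Rt k)) = Rt k.
  apply/eqP; rewrite -subr_eq0; apply/eqP; apply: def; first exact: (sipB S).
  set u := _ - _; have Hu : H u by exact: (sipB S).
  have Ku := RK _ Hu; have HPu := PH _ Ku.
  rewrite {2}/u (dotBr S HPR HRk Hu) (PRself _ _ Hu HRk).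
  rewrite -(positive_sqrt_selfadjoint HPu Hk) (RP _ Ku).
  by rewrite (positive_sqrt_selfadjoint Hu Hk) subrr.
split=> // f Kf; have HPf := PH _ Kf.
rewrite -{1}(RP f Kf) (adjP _ _ HPf KRR) PRR.
by rewrite -(positive_sqrt_selfadjoint HPf Hk) (RP f Kf).
Qed.

End operator_range.

(** * Kernels of the de Branges-Rovnyak space *)

Section deBranges_Rovnyak.
Variables (R : realType) (n : nat) (Theta : R[i] -> 'M[R[i]]_n).
Local Notation vec := ('cV[R[i]]_n).
Local Notation fspace := (disc R -> 'cV[R[i]]_n).
Local Notation H := (@hardy R n).
Local Notation dotH := (@hardy_dot R n).
Let S := hardy_sip R n.

Definition dBR_kernel (w : disc R) (x : vec) : fspace := fun z =>
  (1 - sval z * (sval w)^*)^-1 *: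
    ((1%:M - Theta (sval z) *m ((Theta (sval w))^t* : 'M[R[i]]_n)) *m x).

Let Hk (w : disc R) (x : vec) : H (szego (sval w) x).
Proof. exact: hardy_szego (disc_cmod w). Qed.

Section square_root.
Variables (Tadj Rt : fspace -> fspace).
Hypothesis adj : adjoint_of H dotH H dotH (mult_op Theta) Tadj.
Hypothesis sqrtT : positive_sqrt_of H dotH (fun F => F - mult_op Theta (Tadj F)) Rt.

(** Against any [F] both sides produce [(Theta w F(w), x)]; definiteness of the Hardy product then
    gives equality. *)
Lemma Tadj_szego (w : disc R) x :
  Tadj (szego (sval w) x) = szego (sval w) (((Theta (sval w))^t* : 'M[R[i]]_n) *m x).
Proof.
have [HT HTadj adjE] := adj.
have HTk := HTadj _ (Hk w x).
pose k' := szego (sval w) (((Theta (sval w))^t* : 'M[R[i]]_n) *m x).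
rewrite -/k'.
have Hk' : H k' by exact: Hk.
have Hd := sipB S HTk Hk'.
apply/eqP; rewrite -subr_eq0; apply/eqP; apply: (hardy_dot_eq0 Hd).
rewrite (dotBr S HTk Hk' Hd) -(adjE _ _ Hd (Hk w x)).
rewrite (szego_reproducing w x (HT _ Hd)) (szego_reproducing w _ Hd).
by rewrite /mult_op cdot_adj subrr.
Qed.

Lemma Rt_sqr_szego (w : disc R) x : Rt (Rt (szego (sval w) x)) = dBR_kernel w x.
Proof.
have [_ _ _ _ RR] := sqrtT; rewrite (RR _ (Hk w x)).
apply/funext => z; rewrite Tadj_szego /mult_op /szego /dBR_kernel.
rewrite [LHS]/GRing.add /= [in LHS]/GRing.opp /=.
by rewrite mulmxBl mul1mx -scalemxAr mulmxA -scalerBr.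
Qed.

(* The Schwarz-Pick argument: a fixed vector of [Theta z] is isotropic for the
   positive form [<(1 - T T^* ) u, v>], which forces it to be fixed by [Theta 0]. *)
Lemma oneB_Theta_unit (z : disc R) : purely_contractive Theta ->
  1%:M - Theta (sval z) \in unitmx.
Proof.
move=> [c1 c0]; apply: unitmx_inj => x; rewrite mulmxBl mul1mx => /eqP.
rewrite subr_eq0 => /eqP/esym zx.
have oz : opnorm (Theta (sval z)) <= 1 by exact: (c1 _ (disc_norm z)).
have zx' : ((Theta (sval z))^t* : 'M[R[i]]_n) *m x = x.
  apply: contraction_fixed zx => y; apply: le_trans (cnorm_le_opnorm _ _) _.
  by rewrite -[leRHS]mul1r; apply: ler_wpM2r oz; exact: cnorm_ge0.
have o1 : `|0 : R[i]| < 1 by rewrite normr0.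
pose o : disc R := exist _ 0 o1.
have [HR _ _ _ _] := sqrtT.
have HRk w y := HR _ (Hk w y); have HRR w y := HR _ (HRk w y).
have form w y w' y' : dotH (Rt (szego (sval w) y)) (Rt (szego (sval w') y')) =
    cdot (dBR_kernel w y w') y'.
  rewrite -(positive_sqrt_selfadjoint S sqrtT (HRk w y) (Hk w' y')).
  by rewrite (szego_reproducing w' y' (HRR w y)) Rt_sqr_szego.
have isotropic : nrm dotH (Rt (szego (sval z) x)) = 0.
  rewrite /nrm form /dBR_kernel mulmxBl mul1mx -mulmxA zx' zx subrr scaler0.
  by rewrite (dot0l (@cdot_sip R n)) //= sqrtr0.
(* By Cauchy-Schwarz an isotropic vector is orthogonal to everything. Testing against the kernels at
   0 gives [x - Theta 0 x = 0], because the adjoint of [Theta z] also fixes [x]. *)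
have x0 : x = Theta 0 *m x.
  apply: cdot_inj => y; apply/eqP; rewrite -subr_eq0 -(dotBl (@cdot_sip R n))//; apply/eqP.
  have := nrm0_dot S (HRk z x) (HRk o y) isotropic.
  by rewrite form /dBR_kernel /= mul0r subr0 invr1 scale1r mulmxBl mul1mx -mulmxA zx'.
have := cnorm_le_opnorm (Theta 0) x; rewrite -x0 => h; apply: cnorm0_eq0.
by rewrite leNgt; apply/negP => x1; move: h; rewrite leNgt gtr_pMl// c0.
Qed.

End square_root.

Variables (K : set (disc R -> 'cV[R[i]]_n))
  (dotK : (disc R -> 'cV[R[i]]_n) -> (disc R -> 'cV[R[i]]_n) -> R[i]).
Hypothesis dBR : is_deBranges_Rovnyak Theta K dotK.

Lemma dBR_oneB_unit (z : disc R) : purely_contractive Theta ->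
  1%:M - Theta (sval z) \in unitmx.
Proof. by have [Tadj [Rt [adj sqrtT _ _ _]]] := dBR; exact: (oneB_Theta_unit adj sqrtT). Qed.

Lemma dBR_sip : semi_inner_product K dotK.
Proof.
have [Tadj [Rt [_ sqrtT KE ip _]]] := dBR.
exact: (operator_range_sip S sqrtT KE ip).
Qed.

Lemma dBR_complete : complete K dotK.
Proof.
have [Tadj [Rt [_ sqrtT KE ip co]]] := dBR.
exact: (operator_range_complete S sqrtT KE ip co (@hardy_complete R n)).
Qed.

Lemma dBR_reproducing w x : K (dBR_kernel w x) /\
  forall f, K f -> dotK f (dBR_kernel w x) = cdot (f w) x.
Proof.
have [Tadj [Rt [adj sqrtT KE ip co]]] := dBR; have [HR _ _ _ _] := sqrtT.
have [] := operator_range_reproducing S sqrtT KE ip co (@hardy_dot_eq0 R n) (Hk w x).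
rewrite (Rt_sqr_szego adj sqrtT) => Kk rep; split=> // f Kf.
rewrite (rep f Kf) szego_reproducing//.
by move: Kf; rewrite KE => -[g Hg <-]; exact: HR.
Qed.

End deBranges_Rovnyak.

(** * Holomorphic functions on the disc *)

Section holomorphic.
Variable R : realType.
Implicit Types (f g : R[i] -> R[i]) (z w c : R[i]).

(** The quotient behind [derivable f w 1], with scaling read as multiplication so that field
    identities apply. *)
Definition diff_quot f w (h : R[i]) : R[i] := h^-1 * (f (h + w) - f w).

Lemma diff_quotE f w :
  diff_quot f w = (fun h : R[i] => h^-1 *: (f (h *: (1 : R[i]^o) + w) - f w)).
Proof. by apply/funext => h; rewrite /diff_quot -[X in f (X + _)](mulr1 h). Qed.

Lemma derivable_diff_quot f w : derivable f w 1 ->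
  exists l : R[i], diff_quot f w @ (0 : R[i])^' --> l.
Proof. by move=> /cvg_ex[/= l fl]; exists l; rewrite diff_quotE. Qed.

Lemma diff_quot_derivable f w (l : R[i]) :
  diff_quot f w @ (0 : R[i])^' --> l -> derivable f w 1.
Proof. by move=> fl; apply/cvg_ex; exists l; rewrite diff_quotE in fl. Qed.

Lemma near_dnbhs0 (P : set R[i]) (e : R) : 0 < e ->
  (forall h, cmod h < e -> h != 0 -> P h) -> (0 : R[i])^' P.
Proof.
move=> e0 eP; apply/nbhs_ballP; exists (e%:C)%C; first by rewrite /= ltcR.
move=> h h0 /= hn; apply: eP => //; rewrite -ltcR -cmodE.
by move: h0; rewrite /ball /= sub0r normrN.
Qed.

Lemma cvg_dnbhs_ray c : c != 0 -> (fun t : R => t%:C%C * c) @ (0 : R)^' --> (0 : R[i])^'.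
Proof.
move=> c0 A /nbhs_ballP[e /= e0 eA].
have er : e = (complex.Re e)%:C%C by exact/ge0_cRe/ltW.
have cc : 0 < cmod c.
  by rewrite lt0r cmod_ge0 andbT; apply: contra_neq c0 => h; apply: cmod0_eq0; rewrite h.
apply/nbhs_ballP; exists (complex.Re e / cmod c).
  by rewrite /= divr_gt0// -ltcR -er.
move=> t t0 /= tn; apply: (eA (t%:C%C * c)); last first.
  by rewrite mulf_neq0// eq_complex /= eqxx andbT.
rewrite /ball /= sub0r normrN er cmodE ltcR cmodM cmod_real -ltr_pdivlMr//.
by move: t0; rewrite /ball /= sub0r normrN.
Qed.

Lemma near_disc w : cmod w < 1 -> \forall h \near (0 : R[i])^', cmod (h + w) < 1.
Proof.
move=> w1; apply: (@near_dnbhs0 _ (1 - cmod w)); first by rewrite subr_gt0.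
by move=> h h1 _; apply: le_lt_trans (cmodD _ _) _; rewrite -ltrBrDr.
Qed.

(** Along the ray [t c] with real [t], the quotient of [f] is [-(conj c / c)] times the conjugate of
    that of [g]. The ray [c = 1] gives [a = - conj b] and [c = i] gives [a = conj b]. *)
Lemma skew_diff_quot f g w (a b : R[i]) : cmod w < 1 ->
  (forall z, cmod z < 1 -> f z = - (g z)^*) ->
  diff_quot f w @ (0 : R[i])^' --> a -> diff_quot g w @ (0 : R[i])^' --> b -> a = 0.
Proof.
move=> w1 fg fa gb.
have key c : c != 0 -> a = - (c^* / c) * b^*.
  move=> c0; have ray := cvg_dnbhs_ray c0.
  have fc : (fun t : R => diff_quot f w (t%:C%C * c)) @ (0 : R)^' --> a.
    exact: (cvg_comp _ _ ray fa).
  have gc : (fun t : R => diff_quot g w (t%:C%C * c)) @ (0 : R)^' --> b.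
    exact: (cvg_comp _ _ ray gb).
  have gc' : (fun t : R => - (c^* / c) * (diff_quot g w (t%:C%C * c))^*) @ (0 : R)^' -->
      - (c^* / c) * b^*.
    by apply: cvgM_complex; [exact: cvg_cst|exact: cvg_conj].
  suff fc' : (fun t : R => diff_quot f w (t%:C%C * c)) @ (0 : R)^' --> - (c^* / c) * b^*.
    by have /cvg_lim <- // := fc; have /cvg_lim <- // := fc'.
  apply: cvg_trans gc'; apply: near_eq_cvg.
  have nd : \forall t \near (0 : R)^', cmod (t%:C%C * c + w) < 1.
    exact: (ray _ (near_disc w1)).
  have nz : \forall t \near (0 : R)^', t != 0 by exact: nbhs_dnbhs_neq.
  near=> t; rewrite /diff_quot !fg//; last by near: t; exact: nd.
  have t0 : t%:C%C != 0 :> R[i].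
    by rewrite eq_complex /= eqxx andbT; near: t; exact: nz.
  rewrite !(rmorphM, rmorphV, rmorphB) ?unitfE ?mulf_neq0//= conjc_real.
  rewrite invfM -opprD -opprB opprK.
  by field; rewrite t0 c0 conjC_eq0 c0.
have a1 := key 1 (oner_neq0 _); have ai := key 'i (neq0Ci _).
rewrite conjC1 divr1 mulN1r in a1.
have e : - (('i : R[i])^* / 'i) = 1 by rewrite conjCi mulNr opprK divff ?neq0Ci.
rewrite e mul1r in ai.
have : a + a = 0 by rewrite {1}a1 ai addNr.
by rewrite -mulr2n => /eqP; rewrite mulrn_eq0 /= => /eqP.
Unshelve. all: by end_near. Qed.

(** The mean value theorem for the real function [t |-> Re (f (t z))] on the segment from 0 to [z],
    which stays in the disc. *)
Lemma diff_quot0_Re f z : cmod z < 1 ->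
  (forall w, cmod w < 1 -> diff_quot f w @ (0 : R[i])^' --> (0 : R[i])) ->
  complex.Re (f z) = complex.Re (f 0).
Proof.
move=> z1 f0; have [->//|z0] := eqVneq z 0.
pose phi (t : R) : R := complex.Re (f (t%:C%C * z)).
have tz (t : R) : t \in `[0, 1] -> cmod (t%:C%C * z) < 1.
  rewrite in_itv /= => /andP[t0 t1]; rewrite cmodM cmod_real ger0_norm//.
  by apply: le_lt_trans z1; rewrite ler_piMl// cmod_ge0.
have d (t : R) : t \in `[0, 1] -> is_derive t 1 phi 0.
  move=> ht; have := f0 _ (tz t ht) => q0.
  have L : (fun s : R => s^-1 *: ((phi \o shift t) (s *: 1) - phi t)) @ 0^' --> (0 : R).
    have -> : (fun s : R => s^-1 *: ((phi \o shift t) (s *: 1) - phi t)) =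
        (fun s : R => complex.Re (z * diff_quot f (t%:C%C * z) (s%:C%C * z))).
      apply/funext => s; rewrite /= /phi /diff_quot -raddfB /= -[s *: 1]/(s * 1) mulr1.
      rewrite rmorphD /= mulrDl invfM -fmorphV /= mulrA mulrCA mulrA.
      by rewrite mulfK// cRe_realM.
    suff h : (fun s : R => complex.Re (z * diff_quot f (t%:C%C * z) (s%:C%C * z)))
        @ (0 : R)^' --> complex.Re (z * 0) by rewrite mulr0 in h.
    apply: cvg_cRe; apply: cvgM_complex; first exact: cvg_cst.
    exact: (cvg_comp _ _ (cvg_dnbhs_ray z0) q0).
  split; first by apply/cvg_ex; exists 0.
  exact: cvg_lim.
have d' (t : R) : t \in `]0, 1[ -> is_derive t 1 phi 0.
  by rewrite in_itv /= => /andP[t0 t1]; apply: d; rewrite in_itv /= !ltW.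
have cphi : {within `[0, 1], continuous phi}.
  by apply: derivable_within_continuous => t /d [].
have [c _] := MVT_segment ler01 d' cphi.
by rewrite mul0r => /eqP; rewrite subr_eq0 /phi mul1r mul0r => /eqP.
Qed.

Lemma diff_quot0_cst f z : cmod z < 1 ->
  (forall w, cmod w < 1 -> diff_quot f w @ (0 : R[i])^' --> (0 : R[i])) -> f z = f 0.
Proof.
move=> z1 f0; apply/eqP; rewrite eq_complex (diff_quot0_Re z1 f0) eqxx /=.
have ImRe w : complex.Im w = complex.Re (- 'i%C * w).
  by case: w => a b /=; ring.
rewrite !ImRe (@diff_quot0_Re (fun w => - 'i%C * f w))// => w w1.
have -> : diff_quot (fun w => - 'i%C * f w) w = (fun h => - 'i%C * diff_quot f w h).
  by apply/funext => h; rewrite /diff_quot -mulrBr mulrCA.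
suff h : (fun h => - 'i%C * diff_quot f w h) @ (0 : R[i])^' --> - 'i%C * (0 : R[i]).
  by rewrite mulr0 in h.
by apply: cvgM_complex; [exact: cvg_cst|exact: (f0 w w1)].
Qed.

(** Two functions are needed because a matrix with zero Hermitian part ties its entry [(i, j)] to
    its entry [(j, i)]. *)
Lemma skew_holomorphic_cst f g : (forall z, cmod z < 1 -> derivable f z 1) ->
  (forall z, cmod z < 1 -> derivable g z 1) ->
  (forall z, cmod z < 1 -> f z = - (g z)^*) ->
  forall z, cmod z < 1 -> f z = f 0.
Proof.
move=> df dg fg z z1; apply: (diff_quot0_cst z1) => w w1.
have [a fa] := derivable_diff_quot (df w w1).
have [b gb] := derivable_diff_quot (dg w w1).
by have a0 := skew_diff_quot w1 fg fa gb; rewrite a0 in fa; exact: fa.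
Qed.

Lemma derivable_bigsum (I : Type) (r : seq I) (f : I -> R[i] -> R[i]) z :
  (forall i, derivable (f i) z 1) -> derivable (fun w => \sum_(i <- r) f i w) z 1.
Proof.
move=> df; elim: r => [|i r IH].
  under eq_fun do rewrite big_nil.
  exact: derivable_cst.
under eq_fun do rewrite big_cons.
exact: (derivableD (df i) IH).
Qed.

Lemma derivable_mul f g z : derivable f z 1 -> derivable g z 1 ->
  derivable (fun w => f w * g w) z 1.
Proof. by move=> df dg; exact: (derivableM df dg). Qed.

Lemma derivable_bigprod (I : Type) (r : seq I) (f : I -> R[i] -> R[i]) z :
  (forall i, derivable (f i) z 1) -> derivable (fun w => \prod_(i <- r) f i w) z 1.
Proof.
move=> df; elim: r => [|i r IH].
  under eq_fun do rewrite big_nil.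
  exact: derivable_cst.
under eq_fun do rewrite big_cons.
exact: (derivable_mul (df i) IH).
Qed.

Definition mxderivable m n (A : R[i] -> 'M[R[i]]_(m, n)) z :=
  forall i j, derivable (fun w => A w i j) z 1.

Lemma mxderivableP m n (A : R[i] -> 'M[R[i]]_(m, n)) z :
  derivable A z 1 -> mxderivable A z.
Proof.
move=> /cvg_ex[/= l Al] i j; apply/cvg_ex; exists (l i j).
have := cvg_comp _ _ Al (@coord_continuous _ m n i j l).
apply: cvg_trans; apply: near_eq_cvg; apply: nearW => h /=.
by rewrite !mxE.
Qed.

Lemma mxderivable_mul m n p (A : R[i] -> 'M[R[i]]_(m, n)) (B : R[i] -> 'M[R[i]]_(n, p)) z :
  mxderivable A z -> mxderivable B z -> mxderivable (fun w => A w *m B w) z.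
Proof.
move=> dA dB i j; under eq_fun do rewrite mxE.
by apply: derivable_bigsum => k; exact: derivable_mul.
Qed.

Lemma derivable_det n (A : R[i] -> 'M[R[i]]_n) z :
  mxderivable A z -> derivable (fun w => \det (A w)) z 1.
Proof.
move=> dA; apply: derivable_bigsum => s; apply: derivable_mul.
  exact: derivable_cst.
by apply: derivable_bigprod => i; exact: dA.
Qed.

Lemma mxderivable_adj n (A : R[i] -> 'M[R[i]]_n) z :
  mxderivable A z -> mxderivable (fun w => \adj (A w)) z.
Proof.
move=> dA i j; under eq_fun do rewrite mxE.
apply: derivable_mul; first exact: derivable_cst.
by apply: derivable_det => k l; under eq_fun do rewrite !mxE; exact: dA.
Qed.

End holomorphic.

(** * The Cauchy and Herglotz transforms *)

Section circle_functions.
Variable R : realType.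
Implicit Types (zeta : circle R) (z w : R[i]).

Lemma circle_cmod zeta : cmod (sval zeta) = 1.
Proof. by have := eqP (proj2_sig zeta); rewrite /cmod => ->. Qed.

Lemma circle_neq0 zeta : sval zeta != 0.
Proof.
by apply: contra_eq_neq (circle_cmod zeta) => ->; rewrite cmod0 eq_sym oner_eq0.
Qed.

Lemma circle_conj zeta : (sval zeta)^* = (sval zeta)^-1.
Proof.
apply: (mulfI (circle_neq0 zeta)); rewrite mulfV ?circle_neq0//.
by rewrite -sqr_cmod circle_cmod expr1n.
Qed.

Lemma measurable_circle (f : R[i] -> R) : continuous f ->
  measurable_fun setT (fun zeta => f (sval zeta)).
Proof.
move=> cf; apply: (measurability _ (RGenOpens.measurableE R)).
move=> _ [_ [a [b ->] <-]]; rewrite setTI; apply: sub_sigma_algebra.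
exists (f @^-1` `]a, b[%classic) => //.
by move/continuousP : cf; apply; exact: interval_open.
Qed.

Lemma cmeasurable_circle : cmeasurable (fun zeta => sval zeta).
Proof.
by split; apply: measurable_circle; [exact: continuous_cRe|exact: continuous_cIm].
Qed.

Lemma disc_lower_bound z zeta : 1 - cmod z <= cmod (1 - z^* * sval zeta).
Proof.
have := cmodD (1 - z^* * sval zeta) (z^* * sval zeta).
by rewrite subrK cmod1 cmodM cmod_conj circle_cmod mulr1; lra.
Qed.

Lemma disc_circle_neq0 z zeta : cmod z < 1 -> 1 - z^* * sval zeta != 0.
Proof.
move=> z1; apply: contraTneq (disc_lower_bound z zeta) => ->.
by rewrite cmod0 -ltNge subr_gt0.
Qed.

(** The conjugate of the kernel in [V_op]: as the second factor of an inner product it is analytic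
    in [zeta], hence a limit of polynomials. *)
Definition cauchy_kernel z zeta : R[i] := (1 - z^* * sval zeta)^-1.

Lemma cauchy_kernel_bounded z : cmod z < 1 -> bounded_measurable (cauchy_kernel z).
Proof.
move=> z1; split.
  apply: cmeasurableV; apply: cmeasurableB; first exact: cmeasurable_cst.
  by apply: cmeasurableM; [exact: cmeasurable_cst|exact: cmeasurable_circle].
exists (1 - cmod z)^-1 => zeta; rewrite cmodV lef_pV2 ?posrE ?subr_gt0//.
  exact: disc_lower_bound.
by apply: lt_le_trans (disc_lower_bound z zeta); rewrite subr_gt0.
Qed.

Lemma cauchy_kernel_conj z zeta :
  (cauchy_kernel z zeta)^* = (1 - (sval zeta)^* * z)^-1.
Proof.
have [e|e] := eqVneq (1 - z^* * sval zeta) 0.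
  have e' : 1 - (sval zeta)^* * z = (1 - z^* * sval zeta)^*.
    by rewrite rmorphB rmorphM /= conjC1 conjCK mulrC.
  by rewrite /cauchy_kernel e e' e conjC0 !invr0 conjC0.
by rewrite /cauchy_kernel fmorphV rmorphB rmorphM /= conjC1 conjCK mulrC.
Qed.

Lemma cauchy_kernel_geometric z zeta N : cmod z < 1 ->
  cauchy_kernel z zeta - \sum_(0 <= k < N) (z^*) ^+ k * sval zeta ^+ k =
  (z^* * sval zeta) ^+ N * cauchy_kernel z zeta.
Proof.
move=> z1; have n0 := disc_circle_neq0 zeta z1; apply: (mulfI n0).
rewrite mulrBr mulrCA /cauchy_kernel !mulfV// mulr1.
suff -> : (1 - z^* * sval zeta) * (\sum_(0 <= k < N) (z^*) ^+ k * sval zeta ^+ k) =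
    1 - (z^* * sval zeta) ^+ N by rewrite subKr.
elim: N => [|N IH]; first by rewrite big_nil mulr0 expr0 subrr.
by rewrite big_nat_recr//= mulrDr IH -exprMn exprS; ring.
Qed.

Definition herglotz z zeta : R[i] := (sval zeta + z) / (sval zeta - z).

Lemma herglotz_denom z zeta : 1 - cmod z <= cmod (sval zeta - z).
Proof.
by have := cmodD (sval zeta - z) z; rewrite subrK circle_cmod; lra.
Qed.

Lemma herglotz_neq0 z zeta : cmod z < 1 -> sval zeta - z != 0.
Proof.
move=> z1; apply: contraTneq (herglotz_denom z zeta) => ->.
by rewrite cmod0 -ltNge subr_gt0.
Qed.

Lemma herglotz_inv_bound z zeta : cmod z < 1 -> cmod (sval zeta - z)^-1 <= (1 - cmod z)^-1.
Proof.
move=> z1; rewrite cmodV lef_pV2 ?posrE ?subr_gt0//; first exact: herglotz_denom.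
by apply: lt_le_trans (herglotz_denom z zeta); rewrite subr_gt0.
Qed.

Lemma cmeasurable_herglotz_inv z : cmeasurable (fun zeta => (sval zeta - z)^-1).
Proof.
apply: cmeasurableV; apply: cmeasurableB; first exact: cmeasurable_circle.
exact: cmeasurable_cst.
Qed.

Lemma herglotz_bounded z : cmod z < 1 -> bounded_measurable (herglotz z).
Proof.
move=> z1; split.
  apply: cmeasurableM; last exact: cmeasurable_herglotz_inv.
  by apply: cmeasurableD; [exact: cmeasurable_circle|exact: cmeasurable_cst].
exists ((1 + cmod z) * (1 - cmod z)^-1) => zeta; rewrite cmodM.
apply: ler_pM; rewrite ?cmod_ge0 ?herglotz_inv_bound//.
by apply: le_trans (cmodD _ _) _; rewrite circle_cmod.
Qed.

(* [2 / ((1 - conj zeta z) (1 - conj w zeta))] in terms of Herglotz kernels *)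
Lemma cauchy_kernelM z w zeta : cmod z < 1 -> cmod w < 1 ->
  (cauchy_kernel z zeta)^* * cauchy_kernel w zeta =
  (2 * (1 - z * w^*))^-1 * herglotz z zeta +
  (2 * (1 - z * w^*))^-1 * (herglotz w zeta)^*.
Proof.
move=> z1 w1; rewrite cauchy_kernel_conj /cauchy_kernel /herglotz.
have c0 := circle_neq0 zeta; have n1 := herglotz_neq0 zeta z1.
have n2 := disc_circle_neq0 zeta w1.
rewrite fmorph_div /= rmorphD rmorphB /= circle_conj.
have n3 : 1 - z * w^* != 0.
  apply/negP; rewrite subr_eq0 => /eqP e.
  have e1 : cmod z * cmod w = 1 by rewrite -(cmod_conj w) -cmodM -e cmod1.
  by have := cmod_ge0 z; have := cmod_ge0 w; nra.
have -> : 1 - (sval zeta)^-1 * z = (sval zeta - z) / sval zeta by field.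
have -> : (sval zeta)^-1 - w^* = (1 - w^* * sval zeta) / sval zeta by field.
by field; rewrite c0 n1 n2 n3.
Qed.

End circle_functions.

(** * The closure of the polynomials in L2 *)

Section vector_hardy_space.
Variables (R : realType) (n : nat) (Omega : psd_measure (circle R) R n).
Local Notation vec := ('cV[R[i]]_n).
Local Notation L2O := (L2 Omega).
Local Notation dotO := (L2_dot Omega).
Local Notation H2O := (H2_Omega Omega).
Let S := L2_sip Omega.
Let M := n%:R * Num.sqrt (fine (trace_measure Omega setT)).

Definition monomial k (c : vec) : circle R -> vec := fun zeta => sval zeta ^+ k *: c.

Lemma monomial_bounded k : bounded_measurable (fun zeta : circle R => sval zeta ^+ k).
Proof.
split; last by exists 1 => zeta; rewrite cmodX circle_cmod expr1n.
elim: k => [|k IH]; first exact: cmeasurable_cst.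
under [X in cmeasurable X]eq_fun do rewrite exprS.
by apply: cmeasurableM => //; exact: cmeasurable_circle.
Qed.

Lemma monomial_L2 k c : L2O (monomial k c).
Proof. exact: (L2_scaled Omega c (monomial_bounded k)). Qed.

Lemma vpolyE (p : 'cV[{poly R[i]}]_n) :
  vpoly p = \sum_i \sum_(k < size (p i 0)) (p i 0)`_k *: monomial k (delta_mx i 0).
Proof.
apply/funext => zeta; apply/matrixP => i j; rewrite ord1 !mxE /horner_eval horner_coef.
have sumE (I : Type) (r : seq I) (f : I -> circle R -> vec) :
    (\sum_(k <- r) f k) zeta i 0 = \sum_(k <- r) f k zeta i 0.
  by elim: r => [|x r IH]; rewrite ?big_nil ?mxE// !big_cons -IH !mxE.
rewrite sumE (bigD1 i)//= [X in _ + X]big1 ?addr0.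
  rewrite sumE; apply: eq_bigr => k _.
  by rewrite !mxE !eqxx mulr1.
move=> k ki; rewrite sumE; apply: big1 => l _.
by rewrite !mxE eq_sym (negbTE ki) !mulr0.
Qed.

Lemma vpolyZD (a : R[i]) (p q : 'cV[{poly R[i]}]_n) :
  vpoly (a%:P *: p + q) = a *: vpoly p + vpoly q.
Proof.
apply/funext => zeta; apply/matrixP => i j.
by rewrite !mxE /horner_eval hornerD hornerM hornerC.
Qed.

Lemma vpoly_monomial k (c : vec) : vpoly (\col_i (c i 0 *: 'X^k)) = monomial k c.
Proof.
apply/funext => zeta; apply/matrixP => i j.
by rewrite ord1 !mxE /horner_eval hornerZ hornerXn mulrC.
Qed.

Lemma vpoly0 : vpoly (0 : 'cV[{poly R[i]}]_n) = 0.
Proof.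
by apply/funext => zeta; apply/matrixP => i j; rewrite !mxE /horner_eval horner0.
Qed.

Lemma vpoly_L2 p : L2O (vpoly p).
Proof.
rewrite vpolyE; apply: (sip_sum S) => i; apply: (sip_sum S) => k.
by apply: (sipZ S); exact: monomial_L2.
Qed.

Lemma L2_norm0 : L2_norm Omega 0 = 0.
Proof. by rewrite /L2_norm (dot0l S (sip0 S)) /= sqrtr0. Qed.

Lemma H2_sip : semi_inner_product H2O dotO.
Proof.
split.
- split; first exact: (sip0 S).
  move=> e e0; exists 0; rewrite vpoly0 subrr L2_norm0; exact: e0.
- move=> a f g [Lf fp] [Lg gp]; split; first exact: (sipZD S).
  move=> e e0; have a0 : 0 < cmod a + 1 by rewrite ltr_wpDl ?cmod_ge0.
  have [p pP] := fp (e / 2 / (cmod a + 1)) (divr_gt0 (divr_gt0 e0 (ltr0n _ 2)) a0).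
  have [q qP] := gp (e / 2) (divr_gt0 e0 (ltr0n _ 2)).
  exists (a%:P *: p + q); rewrite vpolyZD.
  have -> : a *: f + g - (a *: vpoly p + vpoly q) = a *: (f - vpoly p) + (g - vpoly q).
    by rewrite opprD addrACA -scalerBr.
  have Lfp := sipB S Lf (vpoly_L2 p); have Lgq := sipB S Lg (vpoly_L2 q).
  apply: le_lt_trans (nrmD S (sipZ S a Lfp) Lgq) _.
  rewrite (nrmZ S a Lfp) (splitr e); apply: ler_ltD; last exact: qP.
  rewrite ltr_pdivlMr// in pP; apply: le_trans (ltW pP); rewrite mulrC.
  by rewrite ler_wpM2l ?nrm_ge0// lerDl.
- by move=> a f g h [Lf _] [Lg _] [Lh _]; exact: (sip_linear S).
- by move=> f g [Lf _] [Lg _]; exact: (sipC S).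
- by move=> f [Lf _]; exact: (sip_ge0 S).
Qed.

Lemma H2_complete : complete H2O dotO.
Proof.
move=> f Hf rf; have Lf k : L2O (f k) by case: (Hf k).
have [g Lg gP] := L2_complete Lf rf.
exists g => //; split=> // e e0.
(* The distance from [f k] to the limit is at most [2 * 2^-k < e / 2], and the polynomial adds less
   than [e / 4]. *)
have e4 : 0 < e / 4 by rewrite divr_gt0.
have [k kP] := geo_lt e4.
have [p pP] := (Hf k).2 (e / 4) e4.
exists p; apply: le_lt_trans (nrm_dist S Lg (Lf k) (vpoly_L2 p)) _.
have pP' : nrm dotO (f k - vpoly p) < e / 4 := pP.
have := gP k; rewrite (nrm_distC S Lg (Lf k)).
set x := nrm _ _; set y := nrm _ _ in pP' *; set r := 2^-1 ^+ k in kP *.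
move: x y r pP' kP e4 => x y r yP rP e4 xr; clear -yP rP e4 xr; lra.
Qed.

Definition cauchy_vec (z : R[i]) (c : vec) : circle R -> vec :=
  fun zeta => cauchy_kernel z zeta *: c.

Lemma cauchy_vec_L2 z c : cmod z < 1 -> L2O (cauchy_vec z c).
Proof. by move=> z1; exact: (L2_scaled Omega c (cauchy_kernel_bounded z1)). Qed.

(** Used twice: it places the Cauchy vectors in H2, and it expands an inner product with them as a
    power series. *)
Lemma cauchy_vec_approx z c N : cmod z < 1 ->
  nrm dotO (cauchy_vec z c - \sum_(0 <= k < N) (z^*) ^+ k *: monomial k c) <=
  (1 - cmod z)^-1 * cnorm c * M * cmod z ^+ N.
Proof.
move=> z1; set f := _ - _.
have fE zeta : f zeta = ((z^* * sval zeta) ^+ N * cauchy_kernel z zeta) *: c.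
  rewrite -cauchy_kernel_geometric// scalerBl scaler_suml /f.
  have sumE (I : Type) (r : seq I) (g : I -> circle R -> vec) :
      (\sum_(i <- r) g i) zeta = \sum_(i <- r) g i zeta.
    by elim: r => [|x r IH]; rewrite ?big_nil// !big_cons -IH.
  rewrite [LHS]/GRing.add /= [in LHS]/GRing.opp /= sumE; congr (_ - _).
  by apply: eq_bigr => k _; rewrite -scalerA.
have Lf : L2O f.
  apply: (sipB S); first exact: cauchy_vec_L2.
  by apply: (sip_sum S) => k; apply: (sipZ S); exact: monomial_L2.
have d0 : 0 < 1 - cmod z by rewrite subr_gt0.
have C0 : 0 <= cmod z ^+ N * (1 - cmod z)^-1 * cnorm c.
  by rewrite !mulr_ge0 ?exprn_ge0 ?cmod_ge0 ?invr_ge0 ?cnorm_ge0// ltW.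
have bd zeta i : cmod (f zeta i 0) <= cmod z ^+ N * (1 - cmod z)^-1 * cnorm c.
  rewrite fE mxE cmodM cmodM; apply: ler_pM; rewrite ?mulr_ge0 ?cmod_ge0//; last first.
    exact: cmod_le_cnorm.
  rewrite cmodX cmodM cmod_conj circle_cmod mulr1 ler_wpM2l ?exprn_ge0 ?cmod_ge0//.
  rewrite /cauchy_kernel cmodV lef_pV2 ?posrE//; first exact: disc_lower_bound.
  exact: lt_le_trans d0 (disc_lower_bound z zeta).
have [_ le] := L2_bounded Omega (L2_measurable Lf) C0 bd.
by apply: le_trans le _; rewrite -/M le_eqVlt; apply/orP; left; apply/eqP; ring.
Qed.

Lemma geo_small (r C e : R) : 0 <= r < 1 -> 0 < e -> exists N, C * r ^+ N < e.
Proof.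
move=> /andP[r0 r1] e0; have : (fun k => C * r ^+ k) @ \oo --> (0 : R).
  by apply: cvg_geometric; rewrite ger0_norm.
move=> /cvgrPdist_lt/(_ e e0)[N _ NP]; exists N; have := NP N (leqnn N).
by rewrite sub0r normrN; apply: le_lt_trans; exact: ler_norm.
Qed.

Lemma cauchy_vec_H2 z c : cmod z < 1 -> H2O (cauchy_vec z c).
Proof.
move=> z1; split; first exact: cauchy_vec_L2.
move=> e e0; have z01 : 0 <= cmod z < 1 by rewrite cmod_ge0.
have [N NP] := geo_small ((1 - cmod z)^-1 * cnorm c * M) z01 e0.
have [p pE] : exists p, vpoly p = \sum_(0 <= k < N) (z^*) ^+ k *: monomial k c.
  elim: N {NP} => [|N [p pE]]; first by exists 0; rewrite big_nil vpoly0.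
  exists (((z^*) ^+ N)%:P *: (\col_i (c i 0 *: 'X^N)) + p).
  by rewrite vpolyZD vpoly_monomial pE big_nat_recr//= addrC.
by exists p; rewrite pE; exact: le_lt_trans (cauchy_vec_approx c N z1) NP.
Qed.

Lemma cauchy_vec_total f : H2O f ->
  (forall z c, cmod z < 1 -> dotO f (cauchy_vec z c) = 0) -> dotO f f = 0.
Proof.
move=> [Lf fp] f0.
have mono0 k c : dotO f (monomial k c) = 0.
  (* Monomials have modulus 1 on the circle, so their inner products with [f] are bounded uniformly
     in [k]. *)
  move: k; apply: (@pseries_eq0 _ _ (nrm dotO f * (cnorm c * M))).
    move=> k; apply: le_trans (cauchy_schwarz S Lf (monomial_L2 k c)) _.
    rewrite ler_wpM2l ?nrm_ge0//.
    have [|_ le] := L2_bounded Omega (L2_measurable (monomial_L2 k c)) (cnorm_ge0 c).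
      move=> zeta i; rewrite mxE cmodM cmodX circle_cmod expr1n mul1r.
      exact: cmod_le_cnorm.
    exact: le.
  move=> z z1; have z01 : 0 <= cmod z < 1 by rewrite cmod_ge0.
  apply: cvg_of_cmod; apply/cvgrPdist_lt => e e0.
  pose C := nrm dotO f * ((1 - cmod z)^-1 * cnorm c * M).
  have : (fun k => C * cmod z ^+ k) @ \oo --> (0 : R).
    by apply: cvg_geometric; rewrite ger0_norm ?cmod_ge0.
  move=> /cvgrPdist_lt/(_ e e0); apply: filterS => N; rewrite !sub0r !normrN => lt.
  rewrite subr0 ger0_norm ?cmod_ge0//; apply: le_lt_trans lt; apply: le_trans (ler_norm _).
  have Ls : L2O (\sum_(0 <= k < N) (z^*) ^+ k *: monomial k c).
    by apply: (sip_sum S) => k; apply: (sipZ S); exact: monomial_L2.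
  have Lc := cauchy_vec_L2 c z1.
  have -> : series (fun k => z ^+ k * dotO f (monomial k c)) N =
      - dotO f (cauchy_vec z c - \sum_(0 <= k < N) (z^*) ^+ k *: monomial k c).
    rewrite (dotBr S Lc Ls Lf) f0// sub0r opprK (dot_sumr S)//; last first.
      by move=> k; apply: (sipZ S); exact: monomial_L2.
    rewrite /series /=; apply: eq_bigr => k _.
    by rewrite (dotZr S _ (monomial_L2 k c) Lf) rmorphXn /= conjCK.
  rewrite cmodN; apply: le_trans (cauchy_schwarz S Lf (sipB S Lc Ls)) _.
  rewrite /C -[leRHS]mulrA; apply: ler_wpM2l; first exact: nrm_ge0.
  exact: cauchy_vec_approx.
have poly0 p : dotO f (vpoly p) = 0.
  rewrite vpolyE (dot_sumr S)//; last first.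
    move=> i; apply: (sip_sum S) => k; apply: (sipZ S); exact: monomial_L2.
  apply: big1 => i _; rewrite (dot_sumr S)//; last first.
    by move=> k; apply: (sipZ S); exact: monomial_L2.
  by apply: big1 => k _; rewrite (dotZr S _ (monomial_L2 k _) Lf) mono0 mulr0.
apply: cmod0_eq0; apply: (@le_geo _ (nrm dotO f)) => k; rewrite add0r.
have [p pP] := fp _ (geo_gt0 R k); have Lp := vpoly_L2 p.
have -> : dotO f f = dotO f (f - vpoly p) by rewrite (dotBr S Lf Lp Lf) poly0 subr0.
apply: le_trans (cauchy_schwarz S Lf (sipB S Lf Lp)) _.
by apply: ler_wpM2l; [exact: nrm_ge0|exact: ltW].
Qed.

End vector_hardy_space.

(** * Analyticity of the Herglotz transform *)

Section herglotz_transform.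
Variables (R : realType) (n : nat) (Omega : psd_measure (circle R) R n).

(** The complex derivative of [herglotz z zeta] in [z]. *)
Definition herglotz_slope (z : R[i]) (zeta : circle R) : R[i] :=
  2 * sval zeta * ((sval zeta - z)^-1 * (sval zeta - z)^-1).

(** The exact error of the difference quotient. Being [h] times a function bounded uniformly in
    [zeta], it allows differentiating under the integral by a direct estimate. *)
Definition herglotz_rem (z h : R[i]) (zeta : circle R) : R[i] :=
  h * (herglotz_slope z zeta * (sval zeta - (h + z))^-1).

Lemma herglotz_slope_bound z (zeta : circle R) : cmod z < 1 ->
  cmod (herglotz_slope z zeta) <= 2 * ((1 - cmod z)^-1 * (1 - cmod z)^-1).
Proof.
move=> z1; rewrite cmodM (cmodM 2) circle_cmod mulr1 (cmodM _ (_ - _)^-1).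
have -> : cmod (2 : R[i]) = 2.
  by rewrite -[2 : R[i]](rmorph_nat (real_complex R)) cmod_real ger0_norm.
by rewrite ler_pM2l// ler_pM ?cmod_ge0// herglotz_inv_bound.
Qed.

Lemma herglotz_slope_bounded z : cmod z < 1 -> bounded_measurable (herglotz_slope z).
Proof.
move=> z1; split; last by eexists => zeta; exact: herglotz_slope_bound.
apply: cmeasurableM.
  by apply: cmeasurableM; [exact: cmeasurable_cst|exact: cmeasurable_circle].
by apply: cmeasurableM; exact: cmeasurable_herglotz_inv.
Qed.

Lemma cmeasurable_herglotz_rem z h : cmod z < 1 -> cmeasurable (herglotz_rem z h).
Proof.
move=> z1; apply: cmeasurableM; first exact: cmeasurable_cst.
by apply: cmeasurableM; [case: (herglotz_slope_bounded z1)|exact: cmeasurable_herglotz_inv].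
Qed.

(** With [d = 1 - |z|], the condition on [h] keeps [h + z] at distance at least [d / 2] from the
    circle, and [2 d^-2] times [2 d^-1] is [4 d^-3]. *)
Lemma herglotz_rem_bound z h zeta : cmod z < 1 -> cmod h < (1 - cmod z) / 2 ->
  cmod (herglotz_rem z h zeta) <= 4 * (1 - cmod z)^-1 ^+ 3 * cmod h.
Proof.
move=> z1 hz; have d0 : 0 < 1 - cmod z by rewrite subr_gt0.
have hz1 : (1 - cmod z) / 2 <= 1 - cmod (h + z).
  by have := cmodD h z; lra.
have hz0 : cmod (h + z) < 1 by rewrite -subr_gt0; apply: lt_le_trans hz1; rewrite divr_gt0.
rewrite cmodM cmodM mulrC ler_wpM2r ?cmod_ge0//.
have -> : 4 * (1 - cmod z)^-1 ^+ 3 =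
    2 * ((1 - cmod z)^-1 * (1 - cmod z)^-1) * ((1 - cmod z) / 2)^-1.
  by field; rewrite gt_eqF.
apply: ler_pM; rewrite ?cmod_ge0// ?herglotz_slope_bound//.
apply: le_trans (herglotz_inv_bound zeta hz0) _.
by rewrite lef_pV2 ?posrE// ?subr_gt0// divr_gt0.
Qed.

(** The factor [1 *] provides the shape [a * phi + psi] expected by [psd_integralZD]. *)
Lemma herglotz_expand z h zeta : cmod z < 1 -> cmod (h + z) < 1 ->
  herglotz (h + z) zeta =
  h * (1 * herglotz_slope z zeta + herglotz_rem z h zeta) + herglotz z zeta.
Proof.
move=> z1 hz1; have := herglotz_neq0 zeta z1; have := herglotz_neq0 zeta hz1.
rewrite /herglotz /herglotz_rem /herglotz_slope => n1 n2.
by field; rewrite n2 n1.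
Qed.

Lemma herglotz_transform_derivable z : cmod z < 1 ->
  mxderivable (fun w => psd_integral Omega (herglotz w)) z.
Proof.
move=> z1 i j; pose l := psd_integral Omega (herglotz_slope z) i j.
apply: (@diff_quot_derivable _ _ _ l); apply: cvg_of_cmod; apply/cvgrPdist_lt => e e0.
have d0 : 0 < 1 - cmod z by rewrite subr_gt0.
pose m := fine (trace_measure Omega setT).
(* The 4 of [herglotz_rem_bound] times the 2 of [psd_integral_le]. Below, [C + 1] replaces [C] as a
   denominator since [C] may be 0. *)
pose C := 8 * (1 - cmod z)^-1 ^+ 3 * `|m|.
have d3 : 0 <= (1 - cmod z)^-1 ^+ 3 by rewrite exprn_ge0// invr_ge0 ltW.
have k0 : 0 <= 8 * (1 - cmod z)^-1 ^+ 3 by rewrite (mulr_ge0 _ d3).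
have C0 : 0 <= C by rewrite (mulr_ge0 k0).
have d1 : 0 < Num.min ((1 - cmod z) / 2) (e / (C + 1)).
  by rewrite lt_min !divr_gt0// ltr_wpDl.
apply: (near_dnbhs0 d1) => h; rewrite lt_min => /andP[hz he] h0.
have hz1 : cmod (h + z) < 1 by apply: le_lt_trans (cmodD _ _) _; lra.
have bs := herglotz_slope_bounded z1.
have br : bounded_measurable (herglotz_rem z h).
  split; first exact: cmeasurable_herglotz_rem.
  by eexists => zeta; exact: herglotz_rem_bound.
have -> : diff_quot (fun w => psd_integral Omega (herglotz w) i j) z h - l =
    psd_integral Omega (herglotz_rem z h) i j.
  rewrite /diff_quot.
  have -> : herglotz (h + z) =
      (fun zeta => h * (1 * herglotz_slope z zeta + herglotz_rem z h zeta) + herglotz z zeta).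
    by apply/funext => zeta; exact: herglotz_expand.
  rewrite psd_integralZD; [|exact: bounded_measurableZD|exact: herglotz_bounded].
  rewrite (psd_integralZD Omega 1 bs br).
  have ZE (A B D : 'M[R[i]]_n) :
      h^-1 * ((h *: (1 *: A + B) + D) i j - D i j) - A i j = B i j.
    by rewrite !mxE addrK mul1r mulKf// addrAC subrr add0r.
  exact: ZE.
rewrite sub0r normrN ger0_norm ?cmod_ge0//.
have le := psd_integral_le Omega i j (cmeasurable_herglotz_rem h z1)
  (fun zeta => herglotz_rem_bound zeta z1 hz).
apply: le_lt_trans le _.
have : C * cmod h < e.
  have := cmod_ge0 h; move: he; rewrite ltr_pdivlMr; last by rewrite ltr_wpDl.
  by move=> he hh; apply: le_lt_trans he; rewrite mulrC ler_wpM2l// lerDl.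
apply: le_lt_trans; rewrite /C.
have := ler_norm m; rewrite -/m => mm.
rewrite [leLHS](_ : _ = 8 * (1 - cmod z)^-1 ^+ 3 * cmod h * m); last by ring.
rewrite [leRHS](_ : _ = 8 * (1 - cmod z)^-1 ^+ 3 * cmod h * `|m|); last by ring.
by rewrite ler_wpM2l// (mulr_ge0 k0)// cmod_ge0.
Qed.

End herglotz_transform.

Lemma add_adjE (R : realType) n (A B : 'M[R[i]]_n) i j :
  (A + B^t*) i j = A i j + (B j i)^*.
Proof. by rewrite !mxE. Qed.

Lemma mxRe_inj_adj (R : realType) n (A B : 'M[R[i]]_n) :
  mxRe A = mxRe B -> A + A^t* = B + B^t*.
Proof. by apply: scalerI; rewrite invr_eq0 pnatr_eq0. Qed.

(** * The Cayley transform of [Theta] and the measure *)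

Section cayley_herglotz.
Variables (R : realType) (n : nat) (Theta : R[i] -> 'M[R[i]]_n).
Variable Omega : psd_measure (circle R) R n.

Definition cayley z : 'M[R[i]]_n := (1%:M + Theta z) *m invmx (1%:M - Theta z).

Hypothesis aTheta : analytic_on_disc Theta.
Hypothesis uTheta : forall z, cmod z < 1 -> 1%:M - Theta z \in unitmx.
Hypothesis OmegaTheta : is_Omega Theta Omega.

(** [invmx] is defined by cases on invertibility. Cramer's formula agrees with it on the disc and
    can be differentiated. *)
Let cayley_adj z : 'M[R[i]]_n :=
  (1%:M + Theta z) *m ((\det (1%:M - Theta z))^-1 *: \adj (1%:M - Theta z)).

Lemma cayley_adjE z : cmod z < 1 -> cayley z = cayley_adj z.
Proof. by move=> /uTheta u; rewrite /cayley /invmx u. Qed.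

Lemma cayley_adj_derivable z : cmod z < 1 -> mxderivable cayley_adj z.
Proof.
move=> z1; have dT : mxderivable Theta z.
  by apply: mxderivableP; apply: aTheta; rewrite cmodE ltcR.
have dp : mxderivable (fun w => 1%:M + Theta w) z.
  move=> i j; under eq_fun do rewrite mxE.
  by apply: derivableD; [exact: derivable_cst|exact: dT].
have dm : mxderivable (fun w => 1%:M - Theta w) z.
  move=> i j; under eq_fun do rewrite !mxE.
  by apply: derivableB; [exact: derivable_cst|exact: dT].
apply: mxderivable_mul dp _ => i j; under eq_fun do rewrite mxE.
apply: derivable_mul; last exact: (mxderivable_adj dm).
apply: derivableV; last exact: (derivable_det dm).
by have := uTheta z1; rewrite unitmxE unitfE.
Qed.

(* The difference of [cayley] and the Herglotz transform is analytic with
   vanishing real part, hence a constant skew-Hermitian matrix. *)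
Lemma cayley_herglotz z w : cmod z < 1 -> cmod w < 1 ->
  cayley z + (cayley w)^t* =
  psd_integral Omega (herglotz z) + (psd_integral Omega (herglotz w))^t*.
Proof.
pose f i j z := cayley_adj z i j - psd_integral Omega (herglotz z) i j.
have df i j x : cmod x < 1 -> derivable (f i j) x 1.
  move=> x1; apply: derivableB; first exact: cayley_adj_derivable.
  exact: herglotz_transform_derivable.
have skew i j x : cmod x < 1 -> f i j x = - (f j i x)^*.
  move=> x1; have x1' : `|x| < 1 by rewrite cmodE ltcR.
  have /mxRe_inj_adj/matrixP/(_ i j) := OmegaTheta x1'.
  rewrite -/(cayley x) (cayley_adjE x1) !add_adjE => e.
  rewrite /f rmorphB /= opprB; apply/eqP.
  by rewrite subr_eq addrAC eq_sym subr_eq addrC e addrC.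
have cst i j x : cmod x < 1 -> f i j x = f i j 0.
  exact: (@skew_holomorphic_cst R (f i j) (f j i) (df i j) (df j i) (skew i j) x).
move=> z1 w1; apply/matrixP => i j; rewrite (cayley_adjE z1) (cayley_adjE w1) !add_adjE.
(* Constancy decouples the two points: [f i j z = f i j 0 = - conj (f j i 0) = - conj (f j i w)]. *)
have := cst i j z z1; rewrite (skew i j 0) ?cmod0// -(cst j i w w1) /f rmorphB /= opprB.
by move=> /eqP; rewrite subr_eq addrAC eq_sym subr_eq eq_sym addrC => /eqP <-; rewrite addrC.
Qed.

End cayley_herglotz.

(** As [1 - Theta] and [1 + Theta] commute, the inverses cancel on both sides; in the two products
    that remain the mixed terms cancel and the others double. *)
Lemma oneB_cayley (R : realType) n (Theta : R[i] -> 'M[R[i]]_n) z w :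
  1%:M - Theta z \in unitmx -> 1%:M - Theta w \in unitmx ->
  (1%:M - Theta z) *m (cayley Theta z + (cayley Theta w)^t*) *m (1%:M - Theta w)^t* =
  2 *: (1%:M - Theta z *m ((Theta w)^t* : 'M[R[i]]_n)).
Proof.
have comm x : 1%:M - Theta x \in unitmx ->
    (1%:M - Theta x) *m cayley Theta x = 1%:M + Theta x.
  move=> u; rewrite /cayley mulmxA.
  have -> : (1%:M - Theta x) *m (1%:M + Theta x) = (1%:M + Theta x) *m (1%:M - Theta x).
    by rewrite mulmxBl mul1mx [RHS]mulmxBr mulmx1 mulmxDr mulmxDl mulmx1 mul1mx.
  by rewrite mulmxK.
move=> uz uw; rewrite mulmxDr mulmxDl (comm z uz).
rewrite -mulmxA -map_mxM -trmx_mul (comm w uw).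
have adjD : (1%:M + Theta w)^t* = 1%:M + (Theta w)^t* :> 'M[R[i]]_n.
  by apply/matrixP => i j; rewrite !mxE rmorphD /= rmorph_nat eq_sym.
have adjB : (1%:M - Theta w)^t* = 1%:M - (Theta w)^t* :> 'M[R[i]]_n.
  by apply/matrixP => i j; rewrite !mxE rmorphB /= rmorph_nat eq_sym.
have -> : (1%:M + Theta z) *m (1%:M - Theta w)^t* +
    (1%:M - Theta z) *m (1%:M + Theta w)^t* =
    (1%:M + Theta z) *m (1%:M - (Theta w)^t*) + (1%:M - Theta z) *m (1%:M + (Theta w)^t*).
  by rewrite adjD adjB.
rewrite !(mulmxDl, mulmxBl, mulmxDr, mulmxBr, mul1mx, mulmx1).
by rewrite mulmxN mulNmx scaler_nat mulr2n; apply/matrixP => i j; rewrite !mxE; ring.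
Qed.

(** * The transform on kernel vectors *)

Section Cauchy_transform.
Variables (R : realType) (n : nat) (Theta : R[i] -> 'M[R[i]]_n).
Variable Omega : psd_measure (circle R) R n.
Variable K : set (disc R -> 'cV[R[i]]_n).
Variable dotK : (disc R -> 'cV[R[i]]_n) -> (disc R -> 'cV[R[i]]_n) -> R[i].
Hypothesis aTheta : analytic_on_disc Theta.
Hypothesis cTheta : purely_contractive Theta.
Hypothesis OmegaTheta : is_Omega Theta Omega.
Hypothesis dBR : is_deBranges_Rovnyak Theta K dotK.
Local Notation vec := ('cV[R[i]]_n).

Lemma oneB_Theta_unitmx z : cmod z < 1 -> 1%:M - Theta z \in unitmx.
Proof.
move=> z1; have z1' : `|z| < 1 by rewrite cmodE ltcR.
exact: (dBR_oneB_unit dBR (exist _ z z1') cTheta).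
Qed.

Definition H2_kernel (w : disc R) (x : vec) : circle R -> vec :=
  cauchy_vec (sval w) (((1%:M - Theta (sval w))^t* : 'M[R[i]]_n) *m x).

Lemma H2_kernel_dot f w x : L2 Omega f ->
  L2_dot Omega f (H2_kernel w x) = cdot (V_op Theta Omega f w) x.
Proof.
move=> Lf; have b := cauchy_kernel_bounded (disc_cmod w).
rewrite /H2_kernel /cauchy_vec (L2_dot_scaled _ Lf b) -cdot_adj /V_op.
suff -> : (fun zeta => (cauchy_kernel (sval w) zeta)^* *: f zeta) =
    (fun zeta => (1 - (sval zeta)^* * sval w)^-1 *: f zeta) by [].
by apply/funext => zeta; rewrite cauchy_kernel_conj.
Qed.

(** Together with [H2_kernel_dot] and the reproducing property in [K] this is the equality of the
    Gram matrices. *)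
Lemma V_op_H2_kernel w x : V_op Theta Omega (H2_kernel w x) = dBR_kernel Theta w x.
Proof.
apply/funext => z; rewrite /V_op /dBR_kernel.
have z1 := disc_cmod z; have w1 := disc_cmod w.
set y : vec := ((1%:M - Theta (sval w))^t* : 'M[R[i]]_n) *m x.
have bz := herglotz_bounded z1; have bw := bounded_measurable_conj (herglotz_bounded w1).
have bk := bounded_measurableM (bounded_measurable_conj (cauchy_kernel_bounded z1))
  (cauchy_kernel_bounded w1).
pose k : R[i] := (2 * (1 - sval z * (sval w)^*))^-1.
have -> : (fun zeta : circle R => (1 - (sval zeta)^* * sval z)^-1 *: H2_kernel w x zeta) =
    (fun zeta => ((cauchy_kernel (sval z) zeta)^* * cauchy_kernel (sval w) zeta) *: y).
  by apply/funext => zeta; rewrite cauchy_kernel_conj -scalerA.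
rewrite psd_integral_vec_scaled//.
have -> : (fun zeta : circle R =>
      (cauchy_kernel (sval z) zeta)^* * cauchy_kernel (sval w) zeta) =
    (fun zeta => k * herglotz (sval z) zeta +
      (* The multiple by [k] is split as [k - 1] plus 1 to fit the shape [a * phi + psi] of
         [psd_integralZD]. *)
      ((k - 1) * (herglotz (sval w) zeta)^* + (herglotz (sval w) zeta)^*)).
  apply/funext => zeta; rewrite cauchy_kernelM// -/k; congr (_ + _).
  by rewrite mulrBl mul1r subrK.
rewrite (psd_integralZD Omega k bz (bounded_measurableZD (k - 1) bw bw)).
rewrite (psd_integralZD Omega (k - 1) bw bw) (psd_integral_conj Omega (herglotz_bounded w1)).
rewrite scalerBl scale1r subrK -scalerDr.
rewrite -(cayley_herglotz aTheta oneB_Theta_unitmx OmegaTheta z1 w1).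
rewrite -scalemxAl -scalemxAr /y !mulmxA.
rewrite (oneB_cayley (oneB_Theta_unitmx z1) (oneB_Theta_unitmx w1)).
by rewrite -scalemxAl scalerA /k invfM mulrAC mulVf ?pnatr_eq0// mul1r.
Qed.

End Cauchy_transform.

Theorem proposition3p2p2 (R : realType) (n : nat) (Theta : R[i] -> 'M[R[i]]_n)
    (Omega : psd_measure (circle R) R n)
    (K : set (disc R -> 'cV[R[i]]_n))
    (dotK : (disc R -> 'cV[R[i]]_n) -> (disc R -> 'cV[R[i]]_n) -> R[i]) :
  analytic_on_disc Theta -> purely_contractive Theta ->
  is_Omega Theta Omega ->
  is_deBranges_Rovnyak Theta K dotK ->
  (forall f g, H2_Omega Omega f -> H2_Omega Omega g ->
     L2_norm Omega (f - g) = 0 -> V_op Theta Omega f = V_op Theta Omega g) /\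
  isometry_onto (H2_Omega Omega) (L2_dot Omega) K dotK (V_op Theta Omega).
Proof.
move=> aTheta cTheta OmegaTheta dBR.
pose ka (i : disc R * 'cV[R[i]]_n) := H2_kernel Theta i.1 i.2.
pose de (i : disc R * 'cV[R[i]]_n) := dBR_kernel Theta i.1 i.2.
have kaH i : H2_Omega Omega (ka i) by exact: cauchy_vec_H2 (disc_cmod _).
have kaL i : L2 Omega (ka i) by exact: cauchy_vec_L2 (disc_cmod _).
have deK i : K (de i) by case: (dBR_reproducing dBR i.1 i.2).
have rep w i : K w -> dotK w (de i) = cdot (w i.1) i.2.
  by case: (dBR_reproducing dBR i.1 i.2) => _; exact.
have repH f i : L2 Omega f -> L2_dot Omega f (ka i) = cdot (V_op Theta Omega f i.1) i.2.
  exact: H2_kernel_dot.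
have gram i j : L2_dot Omega (ka i) (ka j) = dotK (de i) (de j).
  by rewrite (repH _ _ (kaL i)) (rep _ _ (deK i)) /ka (V_op_H2_kernel aTheta cTheta OmegaTheta dBR).
have tX f : H2_Omega Omega f -> (forall i, L2_dot Omega f (ka i) = 0) -> L2_dot Omega f f = 0.
  move=> Hf f0; apply: (cauchy_vec_total Hf) => z c z1.
  have z1' : `|z| < 1 by rewrite cmodE ltcR.
  (* Because this matrix is invertible, every Cauchy vector is some [H2_kernel], and totality
     carries over. *)
  have u : ((1%:M - Theta z)^t* : 'M[R[i]]_n) \in unitmx.
    by rewrite map_unitmx unitmx_tr; exact: (oneB_Theta_unitmx cTheta dBR z1).
  have := f0 (exist _ z z1', (invmx ((1%:M - Theta z)^t* : 'M[R[i]]_n)) *m c).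
  by rewrite /ka /H2_kernel /= mulKVmx.
have tK w : K w -> (forall i, dotK w (de i) = 0) -> dotK w w = 0.
  move=> Kw w0; suff -> : w = 0 by rewrite (dot0l (dBR_sip dBR) (sip0 (dBR_sip dBR))).
  apply/funext => z; apply: cdot_inj => x; rewrite -(rep _ (z, x) Kw) w0.
  by rewrite /cdot big1// => i _; rewrite mxE mul0r.
have TE f w : H2_Omega Omega f -> K w ->
    (forall i, L2_dot Omega f (ka i) = dotK w (de i)) -> V_op Theta Omega f = w.
  move=> [Lf _] Kw fw; apply/funext => z; apply: cdot_inj => x.
  by rewrite -(repH _ (z, x) Lf) fw (rep _ (z, x) Kw).
exact: (isometry_of_gram (H2_sip Omega) (dBR_sip dBR) (@H2_complete _ _ Omega)
  (dBR_complete dBR) kaH deK gram tX tK TE).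
Qed.
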